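(* Let $\alpha \in \mathbb R_+ \setminus \mathbb N$, $a \in \mathbb R$, $T > 0$, and $y \in C^{\lceil \alpha \rceil+1}[a, a+T]$. Let $N \in \mathbb N$, $h = T/N$, and $t_n = a + nh$ for $n = 0, 1, \ldots, N$ (uniform grid). For $K \in \mathbb N$, let the approximations $\hat\phi_{k,K,n}$ be computed with the backward Euler method as described in the context, and let \[ R_{\alpha,K,n}(y) = D_a^\alpha y(t_n) - \sum_{k=1}^K a_{k,K}^{\mathrm{GLa}} \hat\phi_{k,K,n}. \] Then, for all $p > 0$, \[ \max_{n = 1, 2, \ldots, N} |R_{\alpha, K, n}(y)| = O(K^{-p}) + O\left( h \cdot \exp\left( \frac{1 + q_{\mathrm D}}{1 - q_{\mathrm D}} (4K+2) \right) \right) \] as $K \to \infty$ and/or $N \to \infty$.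
   Context: Notation: $m = \lceil \alpha \rceil$, and $q_{\mathrm D} = \alpha - \lceil \alpha \rceil + 1 \in (0,1)$. The Caputo derivative of order $\alpha$ with starting point $a$ is $D_a^\alpha y(t) = \frac{1}{\Gamma(m-\alpha)} \int_a^t (t-\tau)^{m-\alpha-1} y^{(m)}(\tau)\, \mathrm d\tau$. For $w \in \mathbb R$ and $t \in [a,a+T]$ let $\phi_{\mathrm D}(w,t)$ be the solution (in $t$) of the initial value problem \[ \frac{\partial \phi_{\mathrm D}}{\partial t}(w,t) = -\mathrm e^w \phi_{\mathrm D}(w,t) + (-1)^{\lfloor \alpha \rfloor} \frac{\sin \alpha\pi}{\pi} \mathrm e^{w q_{\mathrm D}} y^{(\lceil\alpha\rceil)}(t), \qquad \phi_{\mathrm D}(w,a) = 0, \] i.e. $\phi_{\mathrm D}(w,t) = (-1)^{\lfloor \alpha \rfloor} \frac{\sin \alpha\pi}{\pi} \mathrm e^{w q_{\mathrm D}} \int_a^t y^{(\lceil\alpha\rceil)}(\tau) \exp(-(t-\tau)\mathrm e^w)\,\mathrm d\tau$. Let $x_{k,K}^{\mathrm{GLa}}$ (ordered increasingly, $k=1,\dots,K$) and $a_{k,K}^{\mathrm{GLa}}$ be the nodes and weights of the $K$-point Gauss–Laguerre quadrature formula (Gaussian quadrature for the weight $\mathrm e^{-w}$ on $[0,\infty)$). Backward Euler: for each fixed $w$, set $\phi_{\mathrm D,0}(w) = 0$ and for $n \ge 1$ let $\phi_{\mathrm D,n}(w)$ solve $\phi_{\mathrm D,n}(w) = \phi_{\mathrm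 D,n-1}(w) + h\big(-\mathrm e^w \phi_{\mathrm D,n}(w) + (-1)^{\lfloor \alpha \rfloor} \frac{\sin \alpha\pi}{\pi} \mathrm e^{w q_{\mathrm D}} y^{(\lceil\alpha\rceil)}(t_n)\big)$. Then \[ \hat\phi_{k,K,n} = \mathrm e^{x_{k,K}^{\mathrm{GLa}}} \left( \frac{1}{q_{\mathrm D}} \phi_{\mathrm D,n}\big(-x_{k,K}^{\mathrm{GLa}}/q_{\mathrm D}\big) + \frac{1}{1-q_{\mathrm D}} \phi_{\mathrm D,n}\big(x_{k,K}^{\mathrm{GLa}}/(1-q_{\mathrm D})\big) \right). \] *)

(* Defs.v *)
From Stdlib Require Import Reals.
From Coquelicot Require Import Coquelicot.
Open Scope R_scope.

Definition Rfloor (x : R) : Z := Int_part x.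
Definition Rceil (x : R) : Z := (- Int_part (- x))%Z.

Definition mD (alpha : R) : nat := Z.to_nat (Rceil alpha).
Definition qD (alpha : R) : R := alpha - IZR (Rceil alpha) + 1.
Definition cD (alpha : R) : R := powerRZ (-1) (Rfloor alpha) * sin (alpha * PI) / PI.

Definition Gamma (s : R) : R :=
  RInt_gen (fun x => Rpower x (s - 1) * exp (- x)) (at_right 0) (Rbar_locally p_infty).

Definition is_derive_within (D : R -> Prop) (f : R -> R) (t l : R) : Prop :=
  filterlim (fun s => (f s - f t) / (s - t)) (within (fun s => D s /\ s <> t) (locally t))
    (locally l).

Definition continuous_within (D : R -> Prop) (f : R -> R) (t : R) : Prop :=
  filterlim f (within D (locally t)) (locally (f t)).

Definition Ck_derivs (a b : R) (k : nat) (y : R -> R) (Y : nat -> R -> R) : Prop :=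
  (forall t, a <= t <= b -> Y O t = y t) /\
  (forall (j : nat) t, (j < k)%nat -> a <= t <= b ->
     is_derive_within (fun s => a <= s <= b) (Y j) t (Y (S j) t)) /\
  (forall t, a <= t <= b -> continuous_within (fun s => a <= s <= b) (Y k) t).

(* Caputo derivative D_a^alpha of y at t, given ym = y^(ceil alpha) (improper integral) *)
Definition Caputo (alpha a : R) (ym : R -> R) (t : R) : R :=
  / Gamma (INR (mD alpha) - alpha) *
  RInt_gen (fun tau => Rpower (t - tau) (INR (mD alpha) - alpha - 1) * ym tau)
    (at_point a) (at_left t).

Definition is_gauss_laguerre (K : nat) (x w : nat -> R) : Prop :=
  0 <= x 1%nat /\
  (forall k, (1 <= k)%nat -> (k < K)%nat -> x k < x (S k)) /\
  forall c : nat -> R,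
    is_RInt_gen (fun s => sum_n_m (fun j => c j * s ^ j) 0 (2 * K - 1) * exp (- s))
      (at_point 0) (Rbar_locally p_infty)
      (sum_n_m (fun k => w k * sum_n_m (fun j => c j * x k ^ j) 0 (2 * K - 1)) 1 K).

(* Backward Euler approximation phi_{D,n}(w) for the ODE
     d/dt phi(w,t) = - e^w phi(w,t) + cD alpha * e^(w qD) * g(t),  phi(w,a)=0,
   where g n = y^(ceil alpha)(t_n).  The implicit step
     phi_n = phi_{n-1} + h (- e^w phi_n + cD e^(w q) g_n)
   is solved for phi_n (1 + h e^w > 0). *)
Fixpoint phiBE (alpha h : R) (g : nat -> R) (n : nat) (w : R) : R :=
  match n with
  | O => 0
  | S n' => (phiBE alpha h g n' w + h * cD alpha * exp (w * qD alpha) * g n)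
            / (1 + h * exp w)
  end.

Definition phihat (alpha h : R) (g : nat -> R) (n : nat) (xk : R) : R :=
  exp xk * (/ qD alpha * phiBE alpha h g n (- xk / qD alpha)
            + / (1 - qD alpha) * phiBE alpha h g n (xk / (1 - qD alpha))).

(* Main.v *)
Require Import Defs.
From Stdlib Require Import Reals ZArith Lra Lia Psatz Factorial FunctionalExtensionality.
From Coquelicot Require Import Coquelicot.
Open Scope R_scope.

(**
  Write q = qD.  Integrating by parts against y^(m) in C^1, the Caputo derivative is the convolution of
  A(s) = s^(1-q) / ((1-q) Gamma(1-q)) with y^(m+1), plus a boundary term; the quadrature sum with exact [phi_D] is the
  same convolution with A(s) replaced by the Gauss-Laguerre sum of a kernel H_s(x), and A(s) is the Laguerre
  integral of H_s by the reflection formula Gamma(q) Gamma(1-q) = pi / sin(pi q).  Hence it suffices to bound the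
  quadrature error of the functions H_s, which have derivatives of all orders bounded uniformly in s.

  For such f, Lagrange interpolation at the zeros x_k of the orthogonal polynomial N gives the error as the sum
  over k of the integrals of N / N'(x_k) against the divided differences of f at x_k.  Since N is an eigenfunction, with
  eigenvalue K, of the symmetric operator L u = - (x u'' + (1 - x) u'), each integral is K^(-r) times the one with L^r
  applied to the divided difference, so the error is O(K^(3-r)) for every r.

  Backward Euler adds, at w = x/(1-q), an error of order h exp(x_K / (1-q)), because the second derivative of
  [phi_D] is integrable uniformly in w up to the factor exp(w q); and x_K <= 4K - 2 because x_K is
  a Rayleigh quotient of multiplication by x on polynomials of degree below K.
*)

(** The integration by parts is there for uniformity. Before it, the quadrature integrand is the
    [s]-derivative of [H_s], whose half at [w = x/(1-q)] reaches the order of [1/s] for small [s].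
    After it, the derivatives of [H_s] are built from expressions [v^k exp(-v)] with
    [v = s exp(b x)], each at most [k!], so one constant serves all [s] in [[0, T]] and the
    quadrature bound can be integrated against [y^(m+1)]. All facts on nodes and weights are drawn
    from exactness up to degree [2K - 1]. Since a rule is given for every [K], the nodal polynomials
    of all orders provide orthogonal eigenfunctions of [L], and the rule with [K + 1] nodes
    evaluates integrals of degree [2K]. Norms are estimated crudely: a lost power of [K] is regained
    by raising [r]. In the Euler part, the prefactors [exp(x)] and [exp(w q)] cancel at [w = -x/q]
    and multiply to [exp(x/(1-q))] at [w = x/(1-q)]; this product is the only source of exponential
    growth. The resulting exponent [(4K-2)/(1-q)] lies below the stated one. *)

(** * Continuity and Riemann integrals *)

Lemma cont_add (f g : R -> R) x : continuous f x -> continuous g x -> continuous (fun y => f y + g y) x.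
Proof. intros; apply (continuous_plus (V := R_NormedModule) f g); assumption. Qed.
Lemma cont_sub (f g : R -> R) x : continuous f x -> continuous g x -> continuous (fun y => f y - g y) x.
Proof. intros; apply (continuous_minus (V := R_NormedModule) f g); assumption. Qed.
Lemma cont_neg (f : R -> R) x : continuous f x -> continuous (fun y => - f y) x.
Proof. intros; apply (continuous_opp (V := R_NormedModule) f); assumption. Qed.
Lemma cont_mul (f g : R -> R) x : continuous f x -> continuous g x -> continuous (fun y => f y * g y) x.
Proof. intros; apply (continuous_mult (K := R_AbsRing) f g); assumption. Qed.
Lemma cont_exp (f : R -> R) x : continuous f x -> continuous (fun y => exp (f y)) x.
Proof. intros; apply continuous_comp; [assumption | apply continuous_exp]. Qed.
Lemma cont_pow (f : R -> R) n x : continuous f x -> continuous (fun y => f y ^ n) x.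
Proof.
  intros H; induction n; simpl.
  - apply continuous_const.
  - apply cont_mul; assumption.
Qed.
Lemma cont_derive (f : R -> R) x l : is_derive f x l -> continuous f x.
Proof. intros H; apply (ex_derive_continuous (K := R_AbsRing) (V := R_NormedModule)); exists l; exact H. Qed.

Ltac cont := repeat first
  [ lazymatch goal with
    | |- continuous (fun _ => _ + _) _ => apply cont_add
    | |- continuous (fun _ => _ - _) _ => apply cont_sub
    | |- continuous (fun _ => - _) _ => apply cont_neg
    | |- continuous (fun _ => _ * _) _ => apply cont_mul
    | |- continuous (fun _ => exp _) _ => apply cont_exp
    | |- continuous (fun _ => _ ^ _) _ => apply cont_pow
    | |- continuous (fun x => x) _ => apply continuous_id
    | |- continuous Ropp _ => apply (cont_neg (fun x => x))
    | |- continuous exp _ => apply continuous_exp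
    | |- continuous (Rplus ?a) _ => apply (cont_add (fun _ => a) (fun x => x))
    | |- continuous (Rmult ?a) _ => apply (cont_mul (fun _ => a) (fun x => x))
    | |- continuous (Rminus ?a) _ => apply (cont_sub (fun _ => a) (fun x => x))
    end
  | assumption
  | match goal with H : forall _, continuous _ _ |- _ => apply H end
  | apply continuous_const ].

Lemma ex_RInt_cont (f : R -> R) a b : (forall x, continuous f x) -> ex_RInt f a b.
Proof. intros H; apply (ex_RInt_continuous (V := R_CompleteNormedModule)); intros; apply H. Qed.

Lemma RInt_FTC (f df : R -> R) a b : (forall x, is_derive f x (df x)) -> (forall x, continuous df x) ->
  RInt df a b = f b - f a.
Proof.
  intros H1 H2. apply is_RInt_unique.
  apply (is_RInt_derive (V := R_CompleteNormedModule) f df); intros; auto.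
Qed.

Lemma rint_add (f g : R -> R) a b : ex_RInt f a b -> ex_RInt g a b ->
  RInt (fun x => f x + g x) a b = RInt f a b + RInt g a b.
Proof. apply (RInt_plus (V := R_CompleteNormedModule)). Qed.
Lemma rint_sub (f g : R -> R) a b : ex_RInt f a b -> ex_RInt g a b ->
  RInt (fun x => f x - g x) a b = RInt f a b - RInt g a b.
Proof. apply (RInt_minus (V := R_CompleteNormedModule)). Qed.
Lemma rint_scal (f : R -> R) c a b : ex_RInt f a b -> RInt (fun x => c * f x) a b = c * RInt f a b.
Proof. apply (RInt_scal (V := R_CompleteNormedModule)). Qed.
Lemma ex_rint_sub (f g : R -> R) a b : ex_RInt f a b -> ex_RInt g a b -> ex_RInt (fun x => f x - g x) a b.
Proof. apply (ex_RInt_minus (V := R_CompleteNormedModule)). Qed.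
Lemma ex_rint_scal (f : R -> R) c a b : ex_RInt f a b -> ex_RInt (fun x => c * f x) a b.
Proof. apply (ex_RInt_scal (V := R_CompleteNormedModule)). Qed.

Lemma monotone_bounded_lim (F : R -> R) M :
  (forall x y, 0 <= x -> x <= y -> F x <= F y) -> (forall x, 0 <= x -> F x <= M) ->
  exists l : R, is_lim F p_infty l.
Proof.
  intros Hm Hb.
  destruct (completeness (fun v => exists x, 0 <= x /\ v = F x)) as [l [Hu Hl]].
  - exists M; intros v [x [Hx ->]]; auto.
  - exists (F 0), 0; split; [lra | reflexivity].
  - exists l. apply is_lim_spec. intros eps. destruct eps as [e He]; simpl.
    assert (Hx : exists x, 0 <= x /\ l - e < F x).
    { apply Classical_Prop.NNPP; intros Hn.
      assert (l <= l - e); [|lra]. apply Hl; intros v [x [Hx ->]].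
      apply Rnot_lt_le; intros Hlt; apply Hn; exists x; auto. }
    destruct Hx as [x [Hx Hxl]]. exists x; intros z Hz.
    assert (F z <= l) by (apply Hu; exists z; split; [lra | reflexivity]).
    assert (F x <= F z) by (apply Hm; lra).
    rewrite Rabs_left1; lra.
Qed.

(** The left side divided by [n!] is one term of the exponential series, whose other terms are
    nonnegative. *)
Lemma pow_le_exp (y : R) n : 0 <= y -> y ^ n <= INR (fact n) * exp y.
Proof.
  intros Hy.
  assert (H := exp_ge_taylor y n Hy).
  assert (H1 : y ^ n / INR (fact n) <= exp y).
  { eapply Rle_trans; [|exact H]. destruct n; [simpl; lra|]. rewrite tech5.
    assert (0 <= sum_f_R0 (fun k => y ^ k / INR (fact k)) n); [|lra].
    apply cond_pos_sum; intros k. apply Rmult_le_pos; [apply pow_le; lra|].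
    apply Rlt_le, Rinv_0_lt_compat, INR_fact_lt_0. }
  assert (0 < INR (fact n)) by apply INR_fact_lt_0.
  apply Rmult_le_reg_r with (/ INR (fact n)); [apply Rinv_0_lt_compat; assumption|].
  replace (INR (fact n) * exp y * / INR (fact n)) with (exp y) by (field; lra). exact H1.
Qed.

(** * Integration against [exp(-x)] on the half line *)

(** A class closed under sums and products on which the Laguerre integral converges; it contains the
    polynomials and the bounded smooth functions. Continuity is required on the whole line, so that
    no one-sided notion is needed at 0, but growth only matters on the half line. *)
Definition moderate (f : R -> R) : Prop :=
  (forall x, continuous f x) /\ exists C n, forall x, 0 <= x -> Rabs (f x) <= C * (1 + x) ^ n.

(** A total function by way of [Lim]; its value is a genuine limit for moderate [f], by
    [LInt_lim]. *)
Definition LInt (f : R -> R) : R :=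
  real (Lim (fun B => RInt (fun x => f x * exp (- x)) 0 B) p_infty).

Lemma pow_exp_half n : exists C, 0 <= C /\ forall x, 0 <= x -> (1 + x) ^ n * exp (- x) <= C * exp (- x / 2).
Proof.
  exists (2 ^ n * INR (fact n) * exp (1 / 2)); split.
  - repeat apply Rmult_le_pos; try (apply Rlt_le, exp_pos); [apply pow_le; lra | apply pos_INR].
  - intros x Hx.
    assert (H := pow_le_exp ((1 + x) / 2) n ltac:(lra)).
    replace ((1 + x) ^ n) with (2 ^ n * ((1 + x) / 2) ^ n)
      by (rewrite <- Rpow_mult_distr; f_equal; field).
    replace (2 ^ n * INR (fact n) * exp (1 / 2) * exp (- x / 2))
      with (2 ^ n * (INR (fact n) * exp ((1 + x) / 2)) * exp (- x)).
    + apply Rmult_le_compat_r; [apply Rlt_le, exp_pos|].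
      apply Rmult_le_compat_l; [apply pow_le; lra | exact H].
    + replace (2 ^ n * (INR (fact n) * exp ((1 + x) / 2)) * exp (- x))
        with (2 ^ n * INR (fact n) * (exp ((1 + x) / 2) * exp (- x))) by ring.
      replace (2 ^ n * INR (fact n) * exp (1 / 2) * exp (- x / 2))
        with (2 ^ n * INR (fact n) * (exp (1 / 2) * exp (- x / 2))) by ring.
      rewrite <- !exp_plus. do 2 f_equal. field.
Qed.

Lemma RInt_pow_exp_bound n : exists M, forall B, 0 <= B -> RInt (fun x => (1 + x) ^ n * exp (- x)) 0 B <= M.
Proof.
  destruct (pow_exp_half n) as [C [HC H]]. exists (2 * C). intros B HB.
  apply Rle_trans with (RInt (fun x => C * exp (- x / 2)) 0 B).
  - apply RInt_le; [assumption | | |].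
    + apply ex_RInt_cont; intros; cont.
    + apply ex_RInt_cont; intros; unfold Rdiv; cont.
    + intros x Hx; apply H; lra.
  - rewrite (RInt_FTC (fun x => - 2 * C * exp (- x / 2))).
    + replace (- 0 / 2) with 0 by field. rewrite exp_0.
      assert (0 < exp (- B / 2)) by apply exp_pos. nra.
    + intros x. auto_derive; [trivial|]. unfold Rdiv. field.
    + intros x; unfold Rdiv; cont.
Qed.

(** With [g = C (1 + x)^n] dominating [f], both [g] and [f + g] are nonnegative on the half line, so
    their partial integrals increase and stay bounded; the partial integrals of [f] are the
    difference. *)
Lemma LInt_lim f : moderate f -> is_lim (fun B => RInt (fun x => f x * exp (- x)) 0 B) p_infty (LInt f).
Proof.
  intros [Hc [C [n Hb]]].
  assert (Hex : exists l : R, is_lim (fun B => RInt (fun x => f x * exp (- x)) 0 B) p_infty l).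
  { set (g := fun x => C * (1 + x) ^ n).
    assert (Hcg : forall x, continuous g x) by (intros; unfold g; cont).
    destruct (RInt_pow_exp_bound n) as [M HM].
    assert (HC : 0 <= C).
    { assert (H0 := Hb 0 ltac:(lra)). rewrite Rplus_0_r, pow1 in H0.
      assert (H1 := Rabs_pos (f 0)). lra. }
    assert (HgM : forall B, 0 <= B -> RInt (fun x => g x * exp (- x)) 0 B <= C * M).
    { intros B HB. rewrite (RInt_ext _ (fun x => C * ((1 + x) ^ n * exp (- x)))).
      - rewrite (RInt_scal (V := R_CompleteNormedModule)) by (apply ex_RInt_cont; intros; cont).
        apply Rmult_le_compat_l; auto.
      - intros; unfold g; simpl; ring. }
    assert (Hmono : forall k : R -> R, (forall x, continuous k x) -> (forall x, 0 <= x -> 0 <= k x) ->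
      forall x y, 0 <= x -> x <= y -> RInt (fun x => k x * exp (- x)) 0 x <= RInt (fun x => k x * exp (- x)) 0 y).
    { intros k Hk Hkp x y Hx Hxy.
      rewrite <- (RInt_Chasles (V := R_CompleteNormedModule) _ 0 x y) by (apply ex_RInt_cont; intros; cont).
      assert (0 <= RInt (fun x => k x * exp (- x)) x y).
      { apply RInt_ge_0; [assumption | apply ex_RInt_cont; intros; cont |].
        intros z Hz; apply Rmult_le_pos; [apply Hkp; lra | apply Rlt_le, exp_pos]. }
      unfold plus; simpl; lra. }
    destruct (monotone_bounded_lim (fun B => RInt (fun x => g x * exp (- x)) 0 B) (C * M)) as [lg Hlg].
    { apply Hmono; [assumption|]. intros x Hx; unfold g; apply Rmult_le_pos; [assumption | apply pow_le; lra]. }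
    { exact HgM. }
    assert (Hfg : forall x, 0 <= x -> - g x <= f x <= g x).
    { intros x Hx; apply Rabs_le_between, Hb, Hx. }
    destruct (monotone_bounded_lim (fun B => RInt (fun x => (f x + g x) * exp (- x)) 0 B) (C * M + C * M)) as [ls Hls].
    { apply (Hmono (fun x => f x + g x)); [intros; cont |]. intros x Hx; specialize (Hfg x Hx); lra. }
    { intros B HB.
      apply Rle_trans with (RInt (fun x => g x * exp (- x) + g x * exp (- x)) 0 B).
      - apply RInt_le; [assumption | apply ex_RInt_cont; intros; cont | apply ex_RInt_cont; intros; cont |].
        intros x Hx. assert (0 < exp (- x)) by apply exp_pos. specialize (Hfg x ltac:(lra)). nra.
      - rewrite (RInt_plus (V := R_CompleteNormedModule)) by (apply ex_RInt_cont; intros; cont).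
        apply Rplus_le_compat; auto. }
    exists (ls - lg).
    apply is_lim_ext with (fun B => RInt (fun x => (f x + g x) * exp (- x)) 0 B - RInt (fun x => g x * exp (- x)) 0 B).
    { intros B.
      rewrite <- (RInt_minus (V := R_CompleteNormedModule)) by (apply ex_RInt_cont; intros; cont).
      apply RInt_ext; intros; unfold minus, plus, opp; simpl; ring. }
    apply is_lim_minus'; assumption. }
  destruct Hex as [l Hl]. unfold LInt. rewrite (is_lim_unique _ _ _ Hl). exact Hl.
Qed.

Lemma LInt_unique f (l : R) : is_lim (fun B => RInt (fun x => f x * exp (- x)) 0 B) p_infty l -> LInt f = l.
Proof. intros H; unfold LInt; rewrite (is_lim_unique _ _ _ H); reflexivity. Qed.

Lemma LInt_ext f g : (forall x, 0 <= x -> f x = g x) -> LInt f = LInt g.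
Proof.
  intros H. unfold LInt. f_equal. apply Lim_ext_loc. exists 0; intros B HB.
  apply RInt_ext. intros x Hx. rewrite Rmin_left in Hx by lra. rewrite H; [reflexivity | lra].
Qed.

Lemma moderate_const c : moderate (fun _ => c).
Proof. split; [intros; cont|]. exists (Rabs c), 0%nat; intros; simpl; lra. Qed.
Lemma moderate_id : moderate (fun x => x).
Proof. split; [intros; cont|]. exists 1, 1%nat; intros; simpl; rewrite Rabs_right; lra. Qed.
Lemma moderate_mul f g : moderate f -> moderate g -> moderate (fun x => f x * g x).
Proof.
  intros [H1 [C [n H2]]] [H3 [D [m H4]]]; split; [intros; cont|].
  exists (C * D), (n + m)%nat; intros x Hx. rewrite Rabs_mult, pow_add.
  replace (C * D * ((1 + x) ^ n * (1 + x) ^ m)) with ((C * (1 + x) ^ n) * (D * (1 + x) ^ m)) by ring.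
  apply Rmult_le_compat; auto using Rabs_pos.
Qed.
Lemma moderate_add f g : moderate f -> moderate g -> moderate (fun x => f x + g x).
Proof.
  intros [H1 [C [n H2]]] [H3 [D [m H4]]]; split; [intros; cont|].
  exists (Rabs C + Rabs D), (n + m)%nat; intros x Hx. rewrite pow_add.
  eapply Rle_trans; [apply Rabs_triang|].
  specialize (H2 x Hx); specialize (H4 x Hx).
  assert (1 <= (1 + x) ^ n) by (apply pow_R1_Rle; lra).
  assert (1 <= (1 + x) ^ m) by (apply pow_R1_Rle; lra).
  assert (C <= Rabs C) by apply Rle_abs. assert (D <= Rabs D) by apply Rle_abs.
  set (u := (1 + x) ^ n) in *. set (v := (1 + x) ^ m) in *.
  assert (0 <= Rabs C) by apply Rabs_pos. assert (0 <= Rabs D) by apply Rabs_pos.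
  assert (C * u <= Rabs C * (u * v)).
  { apply Rle_trans with (Rabs C * u); [nra|]. apply Rmult_le_compat_l; nra. }
  assert (D * v <= Rabs D * (u * v)).
  { apply Rle_trans with (Rabs D * v); [nra|]. apply Rmult_le_compat_l; nra. }
  lra.
Qed.
Lemma moderate_neg f : moderate f -> moderate (fun x => - f x).
Proof.
  intros [H1 [C [n H2]]]; split; [intros; cont|]. exists C, n; intros; rewrite Rabs_Ropp; auto.
Qed.
Lemma moderate_sub f g : moderate f -> moderate g -> moderate (fun x => f x - g x).
Proof. intros H1 H2; exact (moderate_add f (fun x => - g x) H1 (moderate_neg g H2)). Qed.
Lemma moderate_pow f n : moderate f -> moderate (fun x => f x ^ n).
Proof.
  intros H; induction n; simpl; [apply moderate_const | apply moderate_mul; assumption].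
Qed.

Ltac moderate := repeat first
  [ lazymatch goal with
    | |- moderate (fun _ => _ + _) => apply moderate_add
    | |- moderate (fun _ => _ - _) => apply moderate_sub
    | |- moderate (fun _ => - _) => apply moderate_neg
    | |- moderate (fun _ => _ * _) => apply moderate_mul
    | |- moderate (fun _ => _ ^ _) => apply moderate_pow
    | |- moderate (fun x => x) => apply moderate_id
    | |- moderate Ropp => apply (moderate_neg (fun x => x))
    | |- moderate (Rplus ?a) => apply (moderate_add (fun _ => a) (fun x => x))
    | |- moderate (Rmult ?a) => apply (moderate_mul (fun _ => a) (fun x => x))
    | |- moderate (Rminus ?a) => apply (moderate_sub (fun _ => a) (fun x => x))
    end
  | assumption
  | match goal with H : forall _, moderate _ |- _ => apply H end
  | apply moderate_const ].

Lemma LInt_add f g : moderate f -> moderate g -> LInt (fun x => f x + g x) = LInt f + LInt g.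
Proof.
  intros Hf Hg. apply LInt_unique.
  apply is_lim_ext with (fun B => RInt (fun x => f x * exp (- x)) 0 B + RInt (fun x => g x * exp (- x)) 0 B).
  - intros B. destruct Hf as [Hf _], Hg as [Hg _].
    rewrite <- (RInt_plus (V := R_CompleteNormedModule)) by (apply ex_RInt_cont; intros; cont).
    apply RInt_ext; intros; unfold plus; simpl; ring.
  - apply is_lim_plus'; apply LInt_lim; assumption.
Qed.

Lemma LInt_scal f c : moderate f -> LInt (fun x => c * f x) = c * LInt f.
Proof.
  intros Hf. apply LInt_unique.
  apply is_lim_ext with (fun B => c * RInt (fun x => f x * exp (- x)) 0 B).
  - intros B. destruct Hf as [Hf _].
    rewrite <- (RInt_scal (V := R_CompleteNormedModule)) by (apply ex_RInt_cont; intros; cont).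
    apply RInt_ext; intros; unfold scal, mult; simpl; unfold mult; simpl; ring.
  - apply (is_lim_scal_l _ c p_infty (LInt f)), LInt_lim; assumption.
Qed.

Lemma LInt_sub f g : moderate f -> moderate g -> LInt (fun x => f x - g x) = LInt f - LInt g.
Proof.
  intros Hf Hg. rewrite (LInt_ext _ (fun x => f x + (-1) * g x)) by (intros; ring).
  rewrite LInt_add, LInt_scal by moderate. ring.
Qed.

Lemma LInt_zero : LInt (fun _ => 0) = 0.
Proof.
  rewrite (LInt_ext _ (fun _ => 0 * 0)) by (intros; ring). rewrite LInt_scal by moderate; ring.
Qed.

Lemma LInt_sum (F : nat -> R -> R) n m : (forall k, (n <= k <= m)%nat -> moderate (F k)) ->
  moderate (fun x => sum_n_m (fun k => F k x) n m) /\
  LInt (fun x => sum_n_m (fun k => F k x) n m) = sum_n_m (fun k => LInt (F k)) n m.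
Proof.
  intros HF. induction m.
  - destruct n.
    + rewrite sum_n_n. replace (fun x => sum_n_m (fun k => F k x) 0 0) with (F 0%nat).
      * split; [apply HF; lia | reflexivity].
      * apply functional_extensionality; intros; rewrite sum_n_n; reflexivity.
    + rewrite sum_n_m_zero by lia. replace (fun x => sum_n_m (fun k => F k x) (S n) 0) with (fun _ : R => 0).
      * split; [apply moderate_const | apply LInt_zero].
      * apply functional_extensionality; intros; rewrite sum_n_m_zero by lia; reflexivity.
  - destruct (Nat.le_gt_cases n (S m)) as [Hle | Hlt].
    + destruct IHm as [IH1 IH2]; [intros; apply HF; lia|].
      assert (HS : moderate (F (S m))) by (apply HF; lia).
      replace (fun x => sum_n_m (fun k => F k x) n (S m)) with (fun x => sum_n_m (fun k => F k x) n m + F (S m) x).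
      * split; [moderate|]. rewrite LInt_add, IH2, sum_n_Sm by moderate || lia. reflexivity.
      * apply functional_extensionality; intros; rewrite sum_n_Sm by lia; reflexivity.
    + rewrite sum_n_m_zero by lia. replace (fun x => sum_n_m (fun k => F k x) n (S m)) with (fun _ : R => 0).
      * split; [apply moderate_const | apply LInt_zero].
      * apply functional_extensionality; intros; rewrite sum_n_m_zero by lia; reflexivity.
Qed.

Lemma LInt_nonneg f : moderate f -> (forall x, 0 <= x -> 0 <= f x) -> 0 <= LInt f.
Proof.
  intros Hf H.
  assert (Hl := LInt_lim f Hf).
  assert (Rbar_le 0 (LInt f)); [|assumption].
  apply is_lim_le_loc with (fun _ => 0) (fun B => RInt (fun x => f x * exp (- x)) 0 B) p_infty;
    [| apply is_lim_const | exact Hl].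
  exists 0; intros B HB. apply RInt_ge_0; [lra | |].
  - destruct Hf as [Hf _]; apply ex_RInt_cont; intros; cont.
  - intros x Hx; apply Rmult_le_pos; [apply H; lra | apply Rlt_le, exp_pos].
Qed.

Lemma LInt_le f g : moderate f -> moderate g -> (forall x, 0 <= x -> f x <= g x) -> LInt f <= LInt g.
Proof.
  intros Hf Hg H. assert (0 <= LInt (fun x => g x - f x)).
  { apply LInt_nonneg; [moderate|]. intros x Hx; specialize (H x Hx); lra. }
  rewrite LInt_sub in H0 by assumption; lra.
Qed.

Lemma LInt_abs_le f g : moderate f -> moderate g -> (forall x, 0 <= x -> Rabs (f x) <= g x) ->
  Rabs (LInt f) <= LInt g.
Proof.
  intros Hf Hg H. apply Rabs_le. split.
  - replace (- LInt g) with (LInt (fun x => (-1) * g x)) by (rewrite LInt_scal by assumption; ring).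
    apply LInt_le; [moderate | moderate |]. intros x Hx; specialize (H x Hx). apply Rabs_le_between in H; lra.
  - apply LInt_le; [moderate | moderate |]. intros x Hx; specialize (H x Hx). apply Rabs_le_between in H; lra.
Qed.

(** By continuity the integrand stays above half its value at [x0] on an interval to the right of
    [x0], a side that lies in the half line even for [x0 = 0]. *)
Lemma LInt_pos f x0 : moderate f -> (forall x, 0 <= x -> 0 <= f x) -> 0 <= x0 -> 0 < f x0 -> 0 < LInt f.
Proof.
  intros Hf Hp Hx0 Hfx.
  assert (Hc : continuous (fun x => f x * exp (- x)) x0) by (destruct Hf as [Hc _]; cont).
  set (g := fun x => f x * exp (- x)) in *.
  assert (Hg0 : 0 < g x0) by (unfold g; apply Rmult_lt_0_compat; [assumption | apply exp_pos]).
  assert (Hcg : forall x, continuous g x) by (intros; unfold g; destruct Hf as [Hc' _]; cont).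
  assert (Hgp : forall x, 0 <= x -> 0 <= g x).
  { intros; unfold g; apply Rmult_le_pos; [auto | apply Rlt_le, exp_pos]. }
  destruct (proj1 (filterlim_locally g (g x0)) Hc (mkposreal (g x0 / 2) ltac:(lra))) as [d Hd].
  assert (Hd2 : forall x, x0 <= x <= x0 + d / 2 -> g x0 / 2 <= g x).
  { intros x Hx. assert (B : ball x0 d x).
    { unfold ball; simpl; unfold AbsRing_ball, abs, minus, plus, opp; simpl.
      destruct d as [d Hdp]; simpl in *; rewrite Rabs_right; lra. }
    apply Hd in B. unfold ball in B; simpl in B; unfold AbsRing_ball, abs, minus, plus, opp in B; simpl in B.
    apply Rabs_lt_between in B; lra. }
  assert (Hdp := cond_pos d).
  assert (Hl := LInt_lim f Hf).
  apply Rlt_le_trans with (d / 2 * (g x0 / 2)); [apply Rmult_lt_0_compat; lra|].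
  assert (Rbar_le (d / 2 * (g x0 / 2)) (LInt f)); [|assumption].
  apply is_lim_le_loc with (fun _ => d / 2 * (g x0 / 2)) (fun B => RInt g 0 B) p_infty;
    [| apply is_lim_const | exact Hl].
  exists (x0 + d / 2); intros B HB.
  assert (HexI : forall u v, ex_RInt g u v) by (intros; apply ex_RInt_cont; auto).
  rewrite <- (RInt_Chasles (V := R_CompleteNormedModule) g 0 x0 B) by auto.
  rewrite <- (RInt_Chasles (V := R_CompleteNormedModule) g x0 (x0 + d / 2) B) by auto.
  unfold plus; simpl.
  assert (0 <= RInt g 0 x0) by (apply RInt_ge_0; auto; intros; apply Hgp; lra).
  assert (0 <= RInt g (x0 + d / 2) B) by (apply RInt_ge_0; auto; [lra | intros; apply Hgp; lra]).
  assert (d / 2 * (g x0 / 2) <= RInt g x0 (x0 + d / 2)).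
  { replace (d / 2 * (g x0 / 2)) with (RInt (fun _ => g x0 / 2) x0 (x0 + d / 2)).
    - apply RInt_le; auto; [lra | apply ex_RInt_const | intros; apply Hd2; lra].
    - rewrite RInt_const. unfold scal, mult; simpl; unfold mult; simpl; ring. }
  lra.
Qed.

(** This turns orthogonality relations into identities: below, two polynomials are shown equal on
    the half line by integrating the square of their difference. *)
Lemma LInt_sq_zero f : moderate f -> LInt (fun x => f x * f x) = 0 -> forall x, 0 <= x -> f x = 0.
Proof.
  intros Hf H x Hx. apply Classical_Prop.NNPP; intros Hn.
  assert (0 < LInt (fun x => f x * f x)); [|lra].
  apply (LInt_pos (fun x => f x * f x) x); [moderate | intros; nra | assumption | nra].
Qed.

Lemma is_lim_moderate_exp f : moderate f -> is_lim (fun B => f B * exp (- B)) p_infty 0.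
Proof.
  intros [Hc [C [n H]]]. destruct (pow_exp_half n) as [D [HD HE]].
  assert (HC : 0 <= C).
  { assert (H0 := H 0 ltac:(lra)). rewrite Rplus_0_r, pow1 in H0.
    assert (H1 := Rabs_pos (f 0)). lra. }
  assert (L : is_lim (fun B => C * D * exp (- B / 2)) p_infty 0).
  { replace (Finite 0) with (Rbar_mult (C * D) 0) by (simpl; f_equal; ring).
    apply is_lim_scal_l. apply is_lim_comp with m_infty.
    - exact is_lim_exp_m.
    - apply is_lim_ext with (fun B => (- / 2) * B); [intros; field|].
      replace m_infty with (Rbar_mult (- / 2) p_infty).
      + apply is_lim_scal_l, is_lim_id.
      + simpl. destruct (Rle_dec 0 (- / 2)) as [r|r]; [exfalso; lra | reflexivity].
    - exists 0; intros; discriminate. }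
  apply is_lim_le_le_loc with (fun B => - (C * D * exp (- B / 2))) (fun B => C * D * exp (- B / 2)).
  - exists 0; intros B HB. apply Rabs_le_between. rewrite Rabs_mult, (Rabs_right (exp _)) by (apply Rle_ge, Rlt_le, exp_pos).
    apply Rle_trans with (C * (1 + B) ^ n * exp (- B)).
    + apply Rmult_le_compat_r; [apply Rlt_le, exp_pos | apply H; lra].
    + rewrite !Rmult_assoc; apply Rmult_le_compat_l; [assumption|]. apply HE; lra.
  - replace (Finite 0) with (Rbar_opp 0) by (simpl; f_equal; ring). apply is_lim_opp, L.
  - exact L.
Qed.

(** The integrand times [exp(-x)] is the derivative of [F exp(-x)], which vanishes at infinity.
    Every integration by parts against the weight goes through this form. *)
Lemma LInt_parts F dF : moderate F -> moderate dF -> (forall x, is_derive F x (dF x)) ->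
  LInt (fun x => dF x - F x) = - F 0.
Proof.
  intros HF HdF HD. apply LInt_unique.
  apply is_lim_ext with (fun B => F B * exp (- B) - F 0).
  - intros B. destruct HF as [HF _], HdF as [HdF _].
    rewrite (RInt_FTC (fun x => F x * exp (- x))).
    + rewrite Ropp_0, exp_0; ring.
    + intros x. replace ((dF x - F x) * exp (- x)) with (dF x * exp (- x) + F x * (- 1 * exp (- x))) by ring.
      apply (is_derive_mult F (fun x => exp (- x)) x).
      * apply HD.
      * auto_derive; [trivial | ring].
      * intros; apply Rmult_comm.
    + intros; cont.
  - replace (Finite (- F 0)) with (Finite (0 - F 0)) by (f_equal; ring).
    apply is_lim_minus'; [apply is_lim_moderate_exp; assumption | apply is_lim_const].
Qed.

(* [sum_n_m] returns terms typed in a Coquelicot carrier, on which [ring] does not operate. *)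
Ltac rring := match goal with |- @eq _ ?a ?b => change (@eq R a b) end; ring.

Lemma rsum_ext (f g : nat -> R) n m : (forall k, (n <= k <= m)%nat -> f k = g k) -> sum_n_m f n m = sum_n_m g n m.
Proof. intros H; apply (sum_n_m_ext_loc (G := R_AbelianMonoid)); exact H. Qed.
Lemma rsum_add (f g : nat -> R) n m : sum_n_m (fun k => f k + g k) n m = sum_n_m f n m + sum_n_m g n m.
Proof. apply (sum_n_m_plus (G := R_AbelianMonoid)). Qed.
Lemma rsum_scal (f : nat -> R) c n m : sum_n_m (fun k => c * f k) n m = c * sum_n_m f n m.
Proof. apply (sum_n_m_mult_l (K := R_Ring)). Qed.
Lemma rsum_sub (f g : nat -> R) n m : sum_n_m (fun k => f k - g k) n m = sum_n_m f n m - sum_n_m g n m.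
Proof.
  rewrite (rsum_ext _ (fun k => f k + (-1) * g k)) by (intros; ring). rewrite rsum_add, rsum_scal; rring.
Qed.
Lemma rsum_Sm (f : nat -> R) n m : (n <= S m)%nat -> sum_n_m f n (S m) = sum_n_m f n m + f (S m).
Proof. intros; rewrite sum_n_Sm by assumption; reflexivity. Qed.
Lemma rsum_empty (f : nat -> R) n m : (m < n)%nat -> sum_n_m f n m = 0.
Proof. intros; rewrite sum_n_m_zero by assumption; reflexivity. Qed.
Lemma rsum_le (f g : nat -> R) n m : (forall k, (n <= k <= m)%nat -> f k <= g k) -> sum_n_m f n m <= sum_n_m g n m.
Proof.
  induction m; intros H.
  - destruct n; [rewrite !sum_n_n; apply H; lia | rewrite !rsum_empty by lia; lra].
  - destruct (Nat.le_gt_cases n (S m)).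
    + rewrite !rsum_Sm by assumption. apply Rplus_le_compat; [apply IHm; intros; apply H; lia | apply H; lia].
    + rewrite !rsum_empty by lia; lra.
Qed.
Lemma rsum_abs (f : nat -> R) n m : Rabs (sum_n_m f n m) <= sum_n_m (fun k => Rabs (f k)) n m.
Proof. apply (norm_sum_n_m (K := R_AbsRing) (V := R_NormedModule)). Qed.
Lemma rsum_zero (f : nat -> R) n m : (forall k, (n <= k <= m)%nat -> f k = 0) -> sum_n_m f n m = 0.
Proof.
  intros H; rewrite (rsum_ext _ (fun _ => 0 * 0)) by (intros; rewrite H by assumption; ring).
  rewrite rsum_scal; rring.
Qed.
Lemma rsum_single (f : nat -> R) n m k0 : (n <= k0 <= m)%nat -> (forall k, (n <= k <= m)%nat -> k <> k0 -> f k = 0) ->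
  sum_n_m f n m = f k0.
Proof.
  induction m; intros Hk H.
  - replace k0 with 0%nat in * by lia. replace n with 0%nat by lia. apply sum_n_n.
  - rewrite rsum_Sm by lia. destruct (Nat.eq_dec k0 (S m)) as [->|Hne].
    + rewrite rsum_zero; [rring|]. intros; apply H; lia.
    + rewrite IHm; [rewrite (H (S m)) by lia; rring | lia | intros; apply H; lia].
Qed.
Lemma rsum_const c m : sum_n_m (fun _ : nat => c) 1 m = INR m * c.
Proof.
  induction m; [rewrite rsum_empty by lia; simpl; rring | rewrite rsum_Sm, IHm, S_INR by lia; rring].
Qed.

(** * Polynomial functions *)

(** Polynomial functions of degree strictly below [n], in Horner form. The strict bound makes the
    zero function the base case and lets closure properties be proved by recursion without
    coefficient lists. *)
Fixpoint Plt (n : nat) (f : R -> R) : Prop :=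
  match n with
  | O => forall x, f x = 0
  | S n' => exists c g, Plt n' g /\ forall x, f x = c + x * g x
  end.

Lemma Plt_ext n f g : (forall x, f x = g x) -> Plt n f -> Plt n g.
Proof. intros H; replace g with f; [trivial | apply functional_extensionality; exact H]. Qed.
Lemma Plt_zero n : Plt n (fun _ => 0).
Proof. induction n; [intros x; reflexivity | exists 0, (fun _ => 0); split; [assumption | intros; ring]]. Qed.
Lemma Plt_S n f : Plt n f -> Plt (S n) f.
Proof.
  revert f; induction n; intros f H.
  - exists 0, (fun _ => 0); split; [intros y; reflexivity | intros x; rewrite H; ring].
  - destruct H as [c [g [Hg H]]]. exists c, g; split; auto.
Qed.
Lemma Plt_le n m f : (n <= m)%nat -> Plt n f -> Plt m f.
Proof. induction 1; auto using Plt_S. Qed.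
Lemma Plt_const c : Plt 1 (fun _ => c).
Proof. exists c, (fun _ => 0); split; [apply Plt_zero | intros; ring]. Qed.
Lemma Plt_add n f g : Plt n f -> Plt n g -> Plt n (fun x => f x + g x).
Proof.
  revert f g; induction n; intros f g Hf Hg.
  - intros x; rewrite Hf, Hg; ring.
  - destruct Hf as [c [f' [Hf E]]], Hg as [d [g' [Hg E']]].
    exists (c + d), (fun x => f' x + g' x); split; [auto | intros; rewrite E, E'; ring].
Qed.
Lemma Plt_scal n f c : Plt n f -> Plt n (fun x => c * f x).
Proof.
  revert f; induction n; intros f Hf.
  - intros x; rewrite Hf; ring.
  - destruct Hf as [d [f' [Hf E]]].
    exists (c * d), (fun x => c * f' x); split; [auto | intros; rewrite E; ring].
Qed.
Lemma Plt_sub n f g : Plt n f -> Plt n g -> Plt n (fun x => f x - g x).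
Proof.
  intros Hf Hg; apply Plt_ext with (fun x => f x + (-1) * g x); [intros; ring|].
  apply Plt_add; [assumption | apply Plt_scal; assumption].
Qed.
Lemma Plt_mulx n f : Plt n f -> Plt (S n) (fun x => x * f x).
Proof. intros H; exists 0, f; split; [assumption | intros; ring]. Qed.
Lemma Plt_mul n m f g : Plt (S n) f -> Plt m g -> Plt (n + m) (fun x => f x * g x).
Proof.
  revert f; induction n; intros f [c [f' [Hf E]]] Hg.
  - apply Plt_ext with (fun x => c * g x); [| apply Plt_scal; assumption].
    intros x; rewrite E, Hf; ring.
  - apply Plt_ext with (fun x => c * g x + x * (f' x * g x)); [intros; rewrite E; ring|].
    apply Plt_add.
    + apply Plt_scal, Plt_le with m; [lia | assumption].
    + apply (Plt_mulx (n + m)), IHn; assumption.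
Qed.
Lemma Plt_pow n : Plt (S n) (fun x => x ^ n).
Proof. induction n; [apply (Plt_const 1) | exact (Plt_mulx _ _ IHn)]. Qed.
Lemma Plt_sum n F a b : (forall k, (a <= k <= b)%nat -> Plt n (F k)) -> Plt n (fun x => sum_n_m (fun k => F k x) a b).
Proof.
  intros H. induction b.
  - destruct a.
    + apply Plt_ext with (F 0%nat); [intros; rewrite sum_n_n; reflexivity | apply H; lia].
    + apply Plt_ext with (fun _ => 0); [intros; rewrite rsum_empty by lia; reflexivity | apply Plt_zero].
  - destruct (Nat.le_gt_cases a (S b)).
    + apply Plt_ext with (fun x => sum_n_m (fun k => F k x) a b + F (S b) x).
      * intros; rewrite rsum_Sm by assumption; reflexivity.
      * apply Plt_add; [apply IHb; intros; apply H; lia | apply H; lia].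
    + apply Plt_ext with (fun _ => 0); [intros; rewrite rsum_empty by lia; reflexivity | apply Plt_zero].
Qed.
Lemma Plt_coeffs n f : Plt (S n) f -> exists c : nat -> R, forall x, f x = sum_n_m (fun j => c j * x ^ j) 0 n.
Proof.
  revert f; induction n; intros f [c [g [Hg E]]].
  - exists (fun _ => c); intros x. rewrite sum_n_n, E, Hg; simpl; ring.
  - destruct (IHn g Hg) as [d Hd].
    exists (fun j => match j with O => c | S j => d j end); intros x.
    rewrite sum_Sn_m by lia. rewrite <- sum_n_m_S. rewrite E, Hd, <- rsum_scal. unfold plus; simpl.
    rewrite Rmult_1_r. f_equal. apply rsum_ext; intros; simpl; ring.
Qed.
Lemma Plt_moderate n f : Plt n f -> moderate f.
Proof.
  revert f; induction n; intros f H.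
  - replace f with (fun _ : R => 0); [apply moderate_const | apply functional_extensionality; auto].
  - destruct H as [c [g [Hg E]]]. specialize (IHn g Hg).
    replace f with (fun x => c + x * g x); [moderate | apply functional_extensionality; auto].
Qed.
Lemma Plt_leading n f : Plt (S n) f -> exists c, Plt n (fun x => f x - c * x ^ n).
Proof.
  revert f; induction n; intros f [c [g [Hg E]]].
  - exists c; intros x; rewrite E, Hg; simpl; ring.
  - destruct (IHn g Hg) as [d Hd]. exists d, c, (fun x => g x - d * x ^ n); split; [assumption|].
    intros; rewrite E; simpl; ring.
Qed.
Lemma Plt_derive n f : Plt n f -> exists f', Plt (pred n) f' /\ forall x, is_derive f x (f' x).
Proof.
  revert f; induction n; intros f H.
  - exists (fun _ => 0); split; [apply Plt_zero|]. intros x.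
    apply is_derive_ext with (fun _ => 0); [intros; rewrite H; reflexivity | apply (is_derive_const (V := R_NormedModule))].
  - destruct H as [c [g [Hg E]]]. destruct (IHn g Hg) as [g' [Hg' Hd]].
    exists (fun x => g x + x * g' x); split.
    + simpl. destruct n.
      * simpl in *. intros x; rewrite Hg, Hg'; ring.
      * apply Plt_add; [assumption|]. apply (Plt_mulx n), Hg'.
    + intros x. apply is_derive_ext with (fun x => c + x * g x); [intros; rewrite E; reflexivity|].
      replace (g x + x * g' x) with (0 + (1 * g x + x * g' x)) by ring.
      apply (is_derive_plus (V := R_NormedModule) (fun _ => c) (fun x => x * g x)); [apply (is_derive_const (V := R_NormedModule))|].
      apply (is_derive_mult (fun x => x) g x 1 (g' x)); [apply (is_derive_id (K := R_AbsRing)) | apply Hd | intros; apply Rmult_comm].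
Qed.

Definition monic (n : nat) (f : R -> R) : Prop := Plt n (fun x => f x - x ^ n).

Lemma monic_Plt n f : monic n f -> Plt (S n) f.
Proof.
  intros H; apply Plt_ext with (fun x => (f x - x ^ n) + x ^ n); [intros; ring|].
  apply Plt_add; [apply Plt_S, H | apply Plt_pow].
Qed.
Lemma monic_step n f a : monic n f -> monic (S n) (fun x => (x - a) * f x).
Proof.
  intros H; unfold monic.
  apply Plt_ext with (fun x => x * (f x - x ^ n) - a * f x); [intros; simpl; ring|].
  apply Plt_sub; [apply Plt_mulx, H | apply Plt_scal, monic_Plt, H].
Qed.

(** * The Laguerre operator *)

(** A smooth function is carried as the sequence of its derivatives, so that operators such as
    [laguerre] act on sequences and can be iterated. *)
Definition smooth (D : nat -> R -> R) : Prop := forall j x, is_derive (D j) x (D (S j) x).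

(** By the Leibniz rule, this is the derivative of order [j] of [L u = - (x u'' + (1 - x) u')] when
    [D] lists the derivatives of [u]. *)
Definition laguerre (D : nat -> R -> R) (j : nat) (x : R) : R :=
  - (x * D (S (S j)) x + (INR j + 1 - x) * D (S j) x - INR j * D j x).

Lemma laguerre_smooth D : smooth D -> smooth (laguerre D).
Proof.
  intros H j x. unfold laguerre.
  assert (E : forall i, ex_derive (D i) x) by (intros i; exists (D (S i) x); apply H).
  auto_derive.
  - repeat split; apply E.
  - replace (Derive (fun x0 => D (S (S j)) x0) x) with (D (S (S (S j))) x) by (symmetry; apply is_derive_unique, H).
    replace (Derive (fun x0 => D (S j) x0) x) with (D (S (S j)) x) by (symmetry; apply is_derive_unique, H).
    replace (Derive (fun x0 => D j x0) x) with (D (S j) x) by (symmetry; apply is_derive_unique, H).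
    rewrite (S_INR j). ring.
Qed.

Lemma laguerre_moderate D j : (forall i, moderate (D i)) -> moderate (laguerre D j).
Proof. intros H; unfold laguerre; moderate. Qed.

(** The difference of the two integrands is, up to the weight, the derivative of
    [x (u v' - u' v) exp(-x)]. The factor [x] kills the boundary term at 0, so no boundary condition
    is imposed on [u] and [v]. *)
Lemma laguerre_symmetric U V : smooth U -> smooth V -> (forall i, moderate (U i)) -> (forall i, moderate (V i)) ->
  LInt (fun x => laguerre U 0 x * V 0%nat x) = LInt (fun x => U 0%nat x * laguerre V 0 x).
Proof.
  intros HU HV MU MV.
  assert (P := LInt_parts
    (fun x => x * (U 0%nat x * V 1%nat x - U 1%nat x * V 0%nat x))
    (fun x => (U 0%nat x * V 1%nat x - U 1%nat x * V 0%nat x)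
              + x * (U 0%nat x * V 2%nat x - U 2%nat x * V 0%nat x))
    ltac:(moderate) ltac:(moderate)).
  assert (M1 := laguerre_moderate U 0 MU). assert (M2 := laguerre_moderate V 0 MV).
  rewrite <- Rminus_0_r at 1. apply Rminus_diag_uniq.
  rewrite Rminus_0_r, <- LInt_sub by moderate.
  rewrite (LInt_ext _ (fun x => (U 0%nat x * V 1%nat x - U 1%nat x * V 0%nat x
     + x * (U 0%nat x * V 2%nat x - U 2%nat x * V 0%nat x)) - x * (U 0%nat x * V 1%nat x - U 1%nat x * V 0%nat x))).
  - rewrite P; [ring|]. intros x.
    assert (EU : forall i, ex_derive (U i) x) by (intros i; exists (U (S i) x); apply HU).
    assert (EV : forall i, ex_derive (V i) x) by (intros i; exists (V (S i) x); apply HV).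
    assert (DU : forall i, Derive (fun y => U i y) x = U (S i) x) by (intros; apply is_derive_unique, HU).
    assert (DV : forall i, Derive (fun y => V i y) x = V (S i) x) by (intros; apply is_derive_unique, HV).
    auto_derive; [repeat split; auto|]. rewrite !DU, !DV. ring.
  - intros x _. unfold laguerre; simpl; ring.
Qed.

(** The same argument with the boundary expression [x u u' exp(-x)]. *)
Lemma laguerre_dirichlet U : smooth U -> (forall i, moderate (U i)) ->
  LInt (fun x => U 0%nat x * laguerre U 0 x) = LInt (fun x => x * (U 1%nat x * U 1%nat x)).
Proof.
  intros HU MU.
  assert (P := LInt_parts (fun x => x * (U 0%nat x * U 1%nat x))
    (fun x => U 0%nat x * U 1%nat x + x * (U 1%nat x * U 1%nat x + U 0%nat x * U 2%nat x))
    ltac:(moderate) ltac:(moderate)).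
  assert (M1 := laguerre_moderate U 0 MU).
  symmetry; apply Rminus_diag_uniq. rewrite <- LInt_sub by moderate.
  rewrite (LInt_ext _ (fun x => (U 0%nat x * U 1%nat x + x * (U 1%nat x * U 1%nat x + U 0%nat x * U 2%nat x))
     - x * (U 0%nat x * U 1%nat x))).
  - rewrite P; [ring|]. intros x.
    assert (EU : forall i, ex_derive (U i) x) by (intros i; exists (U (S i) x); apply HU).
    assert (DU : forall i, Derive (fun y => U i y) x = U (S i) x) by (intros; apply is_derive_unique, HU).
    auto_derive; [repeat split; auto|]. rewrite !DU. ring.
  - intros x _. unfold laguerre; simpl; ring.
Qed.

Lemma smooth_derive_n D n f : smooth D -> (forall x, D 0%nat x = f x) -> forall x, Derive_n f n x = D n x.
Proof.
  intros HD E; induction n; intros x; simpl; [symmetry; apply E|].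
  rewrite (Derive_ext _ (D n)) by exact IHn. apply is_derive_unique, HD.
Qed.

Lemma Plt_smooth n f : Plt n f -> smooth (Derive_n f) /\ forall j, Plt (n - j) (Derive_n f j).
Proof.
  intros Hf.
  assert (HP : forall j, Plt (n - j) (Derive_n f j)).
  { induction j.
    - rewrite Nat.sub_0_r; exact Hf.
    - destruct (Plt_derive _ _ IHj) as [g [Hg Hd]].
      apply Plt_ext with g; [intros x; symmetry; simpl; apply is_derive_unique, Hd|].
      replace (n - S j)%nat with (pred (n - j)) by lia. exact Hg. }
  split; [|exact HP]. intros j x. destruct (Plt_derive _ _ (HP j)) as [g [Hg Hd]].
  simpl. apply Derive_correct. exists (g x); apply Hd.
Qed.

Lemma Plt_laguerre n f : Plt n f -> Plt n (laguerre (Derive_n f) 0).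
Proof.
  intros H. destruct (Plt_smooth n f H) as [HS HP].
  apply Plt_ext with (fun x => (x * Derive_n f 1 x - Derive_n f 1 x) - x * Derive_n f 2 x).
  { intros; unfold laguerre; change (INR 0) with 0; ring. }
  destruct n.
  - intros x. assert (H1 := HP 1%nat x). assert (H2 := HP 2%nat x). rewrite H1, H2. ring.
  - assert (H1 := HP 1%nat). assert (H2 := HP 2%nat).
    apply Plt_sub; [apply Plt_sub|].
    + apply Plt_le with (S (S n - 1))%nat; [lia | apply Plt_mulx, H1].
    + apply Plt_le with (S n - 1)%nat; [lia | exact H1].
    + destruct n.
      * intros. apply Plt_ext with (fun _ => 0); [| apply Plt_zero].
        intros x; rewrite (H2 x); ring.
      * apply Plt_le with (S (S (S n) - 2))%nat; [lia | apply Plt_mulx, H2].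
Qed.

(** The operator is triangular on polynomials, with diagonal entry [n] in degree [n]. *)
Lemma monic_laguerre n f : monic n f -> Plt n (fun x => laguerre (Derive_n f) 0 x - INR n * f x).
Proof.
  intros H. destruct (Plt_smooth _ _ H) as [HS HP].
  set (r := fun x => f x - x ^ n) in *.
  set (D := fun j x => match j with
     | O => f x
     | 1%nat => INR n * x ^ (pred n) + Derive_n r 1 x
     | _ => INR n * (INR (pred n) * x ^ (pred (pred n))) + Derive_n r 2 x end).
  assert (D1 : forall x, Derive_n f 1 x = D 1%nat x).
  { intros x; simpl. apply is_derive_unique.
    apply is_derive_ext with (fun x => x ^ n + r x); [intros; unfold r; rring|].
    apply (is_derive_plus (V := R_NormedModule) (fun x => x ^ n) r).
    - apply is_derive_Reals, derivable_pt_lim_pow.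
    - apply (HS 0%nat). }
  assert (D2 : forall x, Derive_n f 2 x = D 2%nat x).
  { intros x. change (Derive (Derive_n f 1) x = D 2%nat x). apply is_derive_unique.
    apply is_derive_ext with (D 1%nat); [intros; rewrite D1; reflexivity|].
    apply (is_derive_plus (V := R_NormedModule) (fun x => INR n * x ^ pred n) (Derive_n r 1)).
    - apply is_derive_scal. apply is_derive_Reals, derivable_pt_lim_pow.
    - apply (HS 1%nat). }
  (* Here [L (x^n) = n x^n - n^2 x^(n-1)], and [r] is the part of [f] of lower degree. For [n = 0]
     the last term has coefficient 0. *)
  apply Plt_ext with (fun x => (laguerre (Derive_n r) 0 x - INR n * r x) + (- (INR n * INR n)) * x ^ pred n).
  { intros x. unfold laguerre. rewrite D1, D2. unfold D. change (INR 0) with 0.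
    replace (f x) with (r x + x ^ n) by (unfold r; ring).
    generalize (Derive_n r 1 x) (Derive_n r 2 x) (Derive_n r 0 x) (Derive_n f 0 x) (r x); intros.
    destruct n as [|[|n]].
    - simpl; ring.
    - simpl; ring.
    - rewrite !S_INR. simpl pred. simpl pow. rewrite ?S_INR. ring. }
  apply Plt_add.
  - apply Plt_sub; [apply Plt_laguerre, H | apply Plt_scal, H].
  - destruct n; [| apply Plt_scal, Plt_pow]. intros x; simpl; ring.
Qed.

(** * Smooth averages and divided differences *)

Lemma continuity_2d_continuous_snd (f : R -> R -> R) x y :
  continuity_2d_pt f x y -> continuous (fun v => f x v) y.
Proof.
  intros H. apply filterlim_locally; intros eps.
  destruct (H eps) as [d Hd]. exists d; intros v Hv. apply Hd; [| exact Hv].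
  rewrite Rminus_eq_0, Rabs_R0; apply cond_pos.
Qed.

Lemma average_smooth (F : R -> nat -> R -> R) :
  (forall s, smooth (F s)) -> (forall j x s, continuity_2d_pt (fun u v => F v j u) x s) ->
  smooth (fun j x => RInt (fun s => F s j x) 0 1).
Proof.
  intros HS HC j x.
  assert (HD : forall s y, Derive (fun z => F s j z) y = F s (S j) y) by (intros; apply is_derive_unique, HS).
  replace (RInt (fun s => F s (S j) x) 0 1) with (RInt (fun s => Derive (fun u => F s j u) x) 0 1)
    by (apply RInt_ext; intros; apply HD).
  apply (is_derive_RInt_param (fun x s => F s j x) 0 1 x).
  - exists (mkposreal 1 Rlt_0_1); intros y _ t _. exists (F t (S j) y); apply HS.
  - intros t _. apply continuity_2d_pt_ext with (fun u v => F v (S j) u); [intros; symmetry; apply HD | apply HC].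
  - exists (mkposreal 1 Rlt_0_1); intros y _. apply ex_RInt_cont; intros s.
    apply (continuity_2d_continuous_snd (fun u v => F v j u)), HC.
Qed.

Lemma average_bound (f : R -> R) M : (forall s, continuous f s) -> (forall s, 0 <= s <= 1 -> Rabs (f s) <= M) ->
  Rabs (RInt f 0 1) <= M.
Proof.
  intros Hc H. replace M with ((1 - 0) * M) by ring.
  apply abs_RInt_le_const; [lra | apply ex_RInt_cont; assumption | assumption].
Qed.

(** Derivative of order [j] of the divided difference of [D 0] at [x0], written as the mean of [D 1]
    over the segment from [x0] to [x]. This form is smooth across [x = x0] and inherits the bounds
    on the derivatives of [D]. *)
Definition slope (D : nat -> R -> R) (x0 : R) (j : nat) (x : R) : R :=
  RInt (fun s => s ^ j * D (S j) (x0 + s * (x - x0))) 0 1.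

Lemma continuity_2d_pow (f : R -> R -> R) n x y : continuity_2d_pt f x y -> continuity_2d_pt (fun u v => f u v ^ n) x y.
Proof.
  intros H; induction n; simpl; [apply continuity_2d_pt_const | apply continuity_2d_pt_mult; assumption].
Qed.

Lemma smooth_continuity D j x : smooth D -> continuity_pt (D j) x.
Proof. intros H; apply continuity_pt_filterlim, (cont_derive _ _ _ (H j x)). Qed.

Lemma slope_continuity D x0 j x s : smooth D ->
  continuity_2d_pt (fun u v => v ^ j * D (S j) (x0 + v * (u - x0))) x s.
Proof.
  intros H. apply continuity_2d_pt_mult; [apply continuity_2d_pow, continuity_2d_pt_id2|].
  apply (continuity_1d_2d_pt_comp (D (S j)) (fun u v => x0 + v * (u - x0))); [apply smooth_continuity, H|].
  apply continuity_2d_pt_plus; [apply continuity_2d_pt_const|].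
  apply continuity_2d_pt_mult; [apply continuity_2d_pt_id2|].
  apply continuity_2d_pt_minus; [apply continuity_2d_pt_id1 | apply continuity_2d_pt_const].
Qed.

Lemma slope_smooth D x0 : smooth D -> smooth (slope D x0).
Proof.
  intros H. apply (average_smooth (fun s j x => s ^ j * D (S j) (x0 + s * (x - x0)))).
  - intros s j x.
    replace (s ^ S j * D (S (S j)) (x0 + s * (x - x0))) with (s ^ j * (s * D (S (S j)) (x0 + s * (x - x0)))) by (simpl; ring).
    apply is_derive_scal.
    apply (is_derive_comp (V := R_NormedModule) (D (S j)) (fun x => x0 + s * (x - x0)) x _ s); [apply H|].
    auto_derive; [trivial | ring].
  - intros; apply slope_continuity, H.
Qed.

Lemma slope_bound D x0 j x M : smooth D -> (forall y, Rabs (D (S j) y) <= M) -> Rabs (slope D x0 j x) <= M.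
Proof.
  intros HD H. apply average_bound.
  - intros s. apply (continuity_2d_continuous_snd (fun u v => v ^ j * D (S j) (x0 + v * (u - x0)))), slope_continuity, HD.
  - intros s Hs. rewrite Rabs_mult, (Rabs_right (s ^ j)) by (apply Rle_ge, pow_le; lra).
    assert (s ^ j <= 1) by (rewrite <- (pow1 j); apply pow_incr; lra).
    assert (0 <= s ^ j) by (apply pow_le; lra).
    specialize (H (x0 + s * (x - x0))). assert (H2 := Rabs_pos (D (S j) (x0 + s * (x - x0)))). nra.
Qed.

Lemma slope_spec D x0 x : smooth D -> (x - x0) * slope D x0 0 x = D 0%nat x - D 0%nat x0.
Proof.
  intros HD. unfold slope.
  rewrite <- (RInt_scal (V := R_CompleteNormedModule)).
  - rewrite (RInt_ext _ (fun s => (x - x0) * D 1%nat (x0 + s * (x - x0)))).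
    + rewrite (RInt_FTC (fun s => D 0%nat (x0 + s * (x - x0)))).
      * rewrite !Rmult_0_l, Rplus_0_r. do 2 f_equal. ring.
      * intros s. apply (is_derive_comp (V := R_NormedModule) (D 0%nat) (fun s => x0 + s * (x - x0)) s _ (x - x0)); [apply HD|].
        auto_derive; [trivial | ring].
      * intros s. apply cont_mul; [cont|].
        apply (continuous_comp (fun s => x0 + s * (x - x0)) (D 1%nat)); [cont | apply (cont_derive _ _ _ (HD 1%nat _))].
    + intros; simpl; unfold scal; simpl; unfold mult; simpl; ring.
  - apply ex_RInt_cont; intros s.
    apply (continuity_2d_continuous_snd (fun u v => v ^ 0 * D 1%nat (x0 + v * (u - x0)))), slope_continuity, HD.
Qed.

(** * Nodes and weights *)

Fixpoint nodal (x : nat -> R) (K : nat) (X : R) : R :=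
  match K with O => 1 | S n => (X - x (S n)) * nodal x n X end.

(** The quotient of [nodal x K] by [X - x k], obtained without division. Its value at [x k] is the
    derivative of the nodal polynomial there. *)
Fixpoint nodal_except (x : nat -> R) (K k : nat) (X : R) : R :=
  match K with
  | O => 1
  | S n => if Nat.eq_dec k (S n) then nodal x n X else (X - x (S n)) * nodal_except x n k X
  end.

Lemma nodal_monic x K : monic K (nodal x K).
Proof.
  induction K; [intros X; simpl; ring | apply (monic_step K (nodal x K)), IHK].
Qed.

Lemma nodal_root x K k : (1 <= k <= K)%nat -> nodal x K (x k) = 0.
Proof.
  induction K; intros H; [lia|]. simpl. destruct (Nat.eq_dec k (S K)) as [->|]; [ring|].
  rewrite IHK by lia; ring.
Qed.

Lemma nodal_except_spec x K k X : (1 <= k <= K)%nat -> (X - x k) * nodal_except x K k X = nodal x K X.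
Proof.
  induction K; intros H; [lia|]. simpl. destruct (Nat.eq_dec k (S K)) as [->|]; [ring|].
  rewrite <- IHK by lia; ring.
Qed.

Lemma nodal_except_monic x K k : (1 <= k <= K)%nat -> monic (pred K) (nodal_except x K k).
Proof.
  induction K; intros H; [lia|]. simpl. destruct (Nat.eq_dec k (S K)); [apply nodal_monic|].
  destruct K; [lia|]. apply (monic_step K (nodal_except x (S K) k)), IHK; lia.
Qed.

Lemma nodal_nonzero x K X : (forall j, (1 <= j <= K)%nat -> X <> x j) -> nodal x K X <> 0.
Proof.
  induction K; intros H; simpl; [lra|]. apply Rmult_integral_contrapositive; split.
  - apply Rminus_eq_contra, H; lia.
  - apply IHK; intros; apply H; lia.
Qed.

Lemma nodal_except_nonzero x K k X : (forall j, (1 <= j <= K)%nat -> j <> k -> X <> x j) -> nodal_except x K k X <> 0.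
Proof.
  induction K; intros H; simpl; [lra|]. destruct (Nat.eq_dec k (S K)) as [->|Hn].
  - apply nodal_nonzero; intros; apply H; lia.
  - apply Rmult_integral_contrapositive; split.
    + apply Rminus_eq_contra, H; lia.
    + apply IHK; intros; apply H; lia.
Qed.

Lemma is_RInt_gen_is_lim (f : R -> R) (l : R) : is_RInt_gen f (at_point 0) (Rbar_locally p_infty) l ->
  is_lim (fun B => RInt f 0 B) p_infty l.
Proof.
  intros H P HP. destruct (H P HP) as [Q S' HQ HS Himp].
  destruct HS as [M HM]. exists M; intros B HB.
  destruct (Himp 0 B HQ (HM B HB)) as [y [Hy HPy]]; simpl in *.
  rewrite (is_RInt_unique _ _ _ _ Hy). exact HPy.
Qed.

Section Rule.
Variables (K : nat) (x w : nat -> R).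
Hypothesis HK : (1 <= K)%nat.
Hypothesis HGL : is_gauss_laguerre K x w.

Lemma rule_exact f : Plt (2 * K) f -> LInt f = sum_n_m (fun k => w k * f (x k)) 1 K.
Proof.
  intros Hf. destruct HGL as [_ [_ H]].
  destruct (Plt_coeffs (2 * K - 1) f) as [c Hc].
  { replace (S (2 * K - 1)) with (2 * K)%nat by lia; exact Hf. }
  replace f with (fun s => sum_n_m (fun j => c j * s ^ j) 0 (2 * K - 1))
    by (apply functional_extensionality; intros; symmetry; apply Hc).
  apply LInt_unique, is_RInt_gen_is_lim, H.
Qed.

Lemma node_increasing i j : (1 <= i)%nat -> (i < j)%nat -> (j <= K)%nat -> x i < x j.
Proof.
  intros Hi Hij. induction Hij; intros HjK.
  - apply HGL; lia.
  - apply Rlt_trans with (x m); [apply IHHij; lia | apply HGL; lia].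
Qed.

Lemma node_distinct i j : (1 <= i <= K)%nat -> (1 <= j <= K)%nat -> j <> i -> x i <> x j.
Proof.
  intros Hi Hj Hn. destruct (Nat.lt_gt_cases j i) as [H _]. destruct (H Hn) as [Hl | Hl].
  - assert (x j < x i) by (apply node_increasing; lia); lra.
  - assert (x i < x j) by (apply node_increasing; lia); lra.
Qed.

Lemma node_nonneg k : (1 <= k <= K)%nat -> 0 <= x k.
Proof.
  intros Hk. assert (0 <= x 1%nat) by apply HGL.
  destruct (Nat.eq_dec k 1) as [->|]; [assumption|].
  assert (x 1%nat < x k) by (apply node_increasing; lia). lra.
Qed.

Definition cardinal k X := nodal_except x K k X / nodal_except x K k (x k).

Lemma node_denominator k : (1 <= k <= K)%nat -> nodal_except x K k (x k) <> 0.
Proof. intros Hk; apply nodal_except_nonzero; intros; apply node_distinct; auto. Qed.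

Lemma nodal_except_Plt k : (1 <= k <= K)%nat -> Plt K (nodal_except x K k).
Proof.
  intros Hk. replace K with (S (pred K)) at 1 by lia. apply monic_Plt, nodal_except_monic, Hk.
Qed.

Lemma cardinal_Plt k : (1 <= k <= K)%nat -> Plt K (cardinal k).
Proof.
  intros Hk. apply Plt_ext with (fun X => / nodal_except x K k (x k) * nodal_except x K k X).
  - intros; unfold cardinal, Rdiv; ring.
  - apply Plt_scal, nodal_except_Plt, Hk.
Qed.

Lemma cardinal_self k : (1 <= k <= K)%nat -> cardinal k (x k) = 1.
Proof. intros Hk; unfold cardinal; field; apply node_denominator, Hk. Qed.

Lemma cardinal_other k j : (1 <= k <= K)%nat -> (1 <= j <= K)%nat -> j <> k -> cardinal k (x j) = 0.
Proof.
  intros Hk Hj Hn. unfold cardinal.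
  assert (H := nodal_except_spec x K k (x j) Hk). rewrite nodal_root in H by assumption.
  apply Rmult_integral in H. destruct H as [H|H].
  - exfalso; apply (node_distinct j k Hj Hk); [congruence | lra].
  - rewrite H; unfold Rdiv; ring.
Qed.

Lemma Plt_sq f : Plt K f -> Plt (2 * K) (fun X => f X * f X).
Proof.
  intros H. apply Plt_le with (pred K + K)%nat; [lia|].
  apply (Plt_mul (pred K) K f f); [replace (S (pred K)) with K by lia |]; assumption.
Qed.

Lemma weight_cardinal k : (1 <= k <= K)%nat -> w k = LInt (cardinal k).
Proof.
  intros Hk. rewrite rule_exact by (apply Plt_le with K; [lia | apply cardinal_Plt, Hk]).
  rewrite (rsum_single _ 1 K k Hk).
  - rewrite cardinal_self by assumption; ring.
  - intros j Hj Hn; rewrite cardinal_other by assumption; ring.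
Qed.

(** The square has degree at most [2K - 2], hence is integrated exactly, and it is 1 at [x k] and 0
    at the other nodes. Combined with [weight_cardinal], this makes [l] and [l^2] have the same
    integral. *)
Lemma weight_cardinal_sq k : (1 <= k <= K)%nat -> LInt (fun X => cardinal k X * cardinal k X) = w k.
Proof.
  intros Hk. rewrite rule_exact by (apply Plt_sq, cardinal_Plt, Hk).
  rewrite (rsum_single _ 1 K k Hk).
  - rewrite cardinal_self by assumption; ring.
  - intros j Hj Hn; rewrite cardinal_other by assumption; ring.
Qed.

Lemma weight_pos k : (1 <= k <= K)%nat -> 0 < w k.
Proof.
  intros Hk. rewrite <- weight_cardinal_sq by assumption.
  assert (M := Plt_moderate _ _ (cardinal_Plt k Hk)).
  apply LInt_pos with (x k); [moderate | intros; nra | apply node_nonneg, Hk |].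
  rewrite cardinal_self by assumption; lra.
Qed.

Lemma LInt_one : LInt (fun _ => 1) = 1.
Proof.
  assert (H := LInt_parts (fun _ => -1) (fun _ => 0) ltac:(moderate) ltac:(moderate)).
  rewrite (LInt_ext _ (fun _ => 1)) in H by (intros; ring).
  rewrite H; [ring|]. intros; apply (is_derive_const (V := R_NormedModule)).
Qed.

Lemma weight_sum : sum_n_m w 1 K = 1.
Proof.
  rewrite <- LInt_one, rule_exact by (apply Plt_le with 1%nat; [lia | apply Plt_const]).
  apply rsum_ext; intros; rring.
Qed.

(** The difference of the two sides has degree below [K] and vanishes at every node, so the rule
    integrates its square exactly, to zero. *)
Lemma cardinal_sum X : 0 <= X -> sum_n_m (fun k => cardinal k X) 1 K = 1.
Proof.
  assert (HP : Plt K (fun X => sum_n_m (fun k => cardinal k X) 1 K - 1)).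
  { apply Plt_sub; [apply Plt_sum; intros; apply cardinal_Plt; lia | apply Plt_le with 1%nat; [lia | apply Plt_const]]. }
  intros HX. apply Rminus_diag_uniq.
  apply (LInt_sq_zero (fun X => sum_n_m (fun k => cardinal k X) 1 K - 1)); [eapply Plt_moderate, HP | | assumption].
  rewrite rule_exact by (apply (Plt_sq _ HP)). apply rsum_zero. intros j Hj.
  rewrite (rsum_single (fun k => cardinal k (x j)) 1 K j Hj).
  - rewrite cardinal_self by lia; ring.
  - intros k Hk Hn. apply cardinal_other; auto.
Qed.

(** The product has degree at most [2K - 1] and vanishes at every node: exactness alone makes the
    nodal polynomial orthogonal to lower degrees. *)
Lemma nodal_orthogonal r : Plt K r -> LInt (fun X => nodal x K X * r X) = 0.
Proof.
  intros Hr. rewrite rule_exact.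
  - apply rsum_zero; intros k Hk; rewrite nodal_root by assumption; ring.
  - apply Plt_le with (K + K)%nat; [lia|]. apply (Plt_mul K K); [apply monic_Plt, nodal_monic | assumption].
Qed.

(** The defect [u = L N - K N] has degree below [K] by [monic_laguerre]. It is orthogonal to [N],
    and to [L N] too, since symmetry moves [L] onto [u] without raising its degree. Hence [u] is
    orthogonal to itself. *)
Lemma nodal_eigen X : 0 <= X -> laguerre (Derive_n (nodal x K)) 0 X = INR K * nodal x K X.
Proof.
  assert (HN := nodal_monic x K). assert (HN1 := monic_Plt _ _ HN).
  destruct (Plt_smooth _ _ HN1) as [HS HP].
  assert (Hu := monic_laguerre _ _ HN).
  set (u := fun X => laguerre (Derive_n (nodal x K)) 0 X - INR K * nodal x K X) in *.
  destruct (Plt_smooth _ _ Hu) as [HuS HuP].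
  assert (MN := Plt_moderate _ _ HN1). assert (Mu := Plt_moderate _ _ Hu).
  assert (MDN : forall j, moderate (Derive_n (nodal x K) j)) by (intros; eapply Plt_moderate, HP).
  assert (MDu : forall j, moderate (Derive_n u j)) by (intros; eapply Plt_moderate, HuP).
  assert (ML := laguerre_moderate _ 0 MDN).
  intros HX. apply Rminus_diag_uniq. apply (LInt_sq_zero u Mu); [|assumption].
  rewrite (LInt_ext _ (fun X => laguerre (Derive_n (nodal x K)) 0 X * u X - INR K * (nodal x K X * u X)))
    by (intros; unfold u at 1; ring).
  rewrite LInt_sub, LInt_scal, (nodal_orthogonal u Hu) by moderate.
  assert (E : LInt (fun X => laguerre (Derive_n (nodal x K)) 0 X * u X)
              = LInt (fun X => nodal x K X * laguerre (Derive_n u) 0 X))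
    by exact (laguerre_symmetric (Derive_n (nodal x K)) (Derive_n u) HS HuS MDN MDu).
  rewrite E.
  rewrite (nodal_orthogonal (laguerre (Derive_n u) 0)) by (apply Plt_laguerre, Hu). ring.
Qed.

End Rule.

Lemma laguerre_combination c f g X : smooth (Derive_n f) -> smooth (Derive_n g) ->
  laguerre (Derive_n (fun x => c * f x + g x)) 0 X = c * laguerre (Derive_n f) 0 X + laguerre (Derive_n g) 0 X.
Proof.
  intros Hf Hg.
  assert (E := smooth_derive_n (fun j x => c * Derive_n f j x + Derive_n g j x)).
  assert (HS : smooth (fun j x => c * Derive_n f j x + Derive_n g j x)).
  { intros j x. apply (is_derive_plus (V := R_NormedModule) (fun x => c * Derive_n f j x) (Derive_n g j)).
    - apply is_derive_scal, Hf.
    - apply Hg. }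
  specialize (fun n => E n (fun x => c * f x + g x) HS (fun x => eq_refl)).
  unfold laguerre. rewrite (E 0%nat), (E 1%nat), (E 2%nat). ring.
Qed.

(** The pointwise inequality [|f g| <= (f^2 + g^2) / 2] takes the place of Cauchy-Schwarz; the loss
    is a power of [K], which is harmless. *)
Lemma LInt_product_bound f g c r : moderate f -> moderate g ->
  (forall X, 0 <= X -> Rabs (g X) <= c * (1 + X) ^ r) ->
  Rabs (LInt (fun X => f X * g X)) <=
    / 2 * LInt (fun X => f X * f X) + / 2 * (c * c * LInt (fun X => (1 + X) ^ r * (1 + X) ^ r)).
Proof.
  intros Mf Mg H.
  rewrite <- (LInt_scal (fun X => (1 + X) ^ r * (1 + X) ^ r)) by moderate.
  rewrite <- !LInt_scal, <- LInt_add by moderate.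
  apply LInt_abs_le; [moderate | moderate |]. intros X HX. specialize (H X HX).
  assert (H2 : Rsqr (g X) <= Rsqr (c * (1 + X) ^ r))
    by (apply Rsqr_le_abs_1; eapply Rle_trans; [exact H | apply Rle_abs]).
  unfold Rsqr in H2.
  assert (P1 := Rle_0_sqr (f X - g X)). assert (P2 := Rle_0_sqr (f X + g X)). unfold Rsqr in P1, P2.
  apply Rabs_le. split; lra.
Qed.

(** * Spectral estimates and the quadrature error *)

Section Rules.
Variables (xs ws : nat -> nat -> R).
Hypothesis rules : forall K, (1 <= K)%nat -> is_gauss_laguerre K (xs K) (ws K).

(* On polynomials of degree at most [n] the Laguerre operator has spectrum [{0, ..., n}]. *)
Lemma laguerre_form_bound n p : Plt (S n) p ->
  LInt (fun X => p X * laguerre (Derive_n p) 0 X) <= INR n * LInt (fun X => p X * p X).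
Proof.
  revert p; induction n; intros p Hp.
  - destruct (Plt_smooth _ _ Hp) as [HS HP].
    rewrite (LInt_ext _ (fun _ => 0)); [rewrite LInt_zero; simpl; lra|].
    intros X _. unfold laguerre. rewrite (HP 1%nat X), (HP 2%nat X). simpl; ring.
  (* Split [p = c N + r] along the nodal polynomial of degree [n + 1]: the cross terms vanish by
     orthogonality, [N] contributes its eigenvalue, and [r] falls under the induction hypothesis. *)
  - assert (HR := rules (S n) ltac:(lia)). set (N := nodal (xs (S n)) (S n)).
    assert (HN : monic (S n) N) by apply nodal_monic.
    destruct (Plt_leading _ _ Hp) as [c Hc].
    set (r := fun X => p X - c * N X).
    assert (Hr : Plt (S n) r).
    { apply Plt_ext with (fun X => (p X - c * X ^ S n) - c * (N X - X ^ S n)); [intros; unfold r; ring|].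
      apply Plt_sub; [exact Hc | apply Plt_scal, HN]. }
    assert (Ep : p = fun X => c * N X + r X) by (apply functional_extensionality; intros; unfold r; ring).
    assert (HN1 := monic_Plt _ _ HN).
    destruct (Plt_smooth _ _ HN1) as [SN _]. destruct (Plt_smooth _ _ Hr) as [Sr _].
    assert (HLr := Plt_laguerre _ _ Hr).
    assert (Mr := Plt_moderate _ _ Hr). assert (MN := Plt_moderate _ _ HN1). assert (ML := Plt_moderate _ _ HLr).
    assert (O1 : LInt (fun X => N X * r X) = 0) by (apply (nodal_orthogonal (S n) _ _ ltac:(lia) HR), Hr).
    assert (O2 : LInt (fun X => N X * laguerre (Derive_n r) 0 X) = 0)
      by (apply (nodal_orthogonal (S n) _ _ ltac:(lia) HR (laguerre (Derive_n r) 0)), HLr).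
    specialize (IHn r Hr).
    assert (P2 : 0 <= LInt (fun X => r X * r X)) by (apply LInt_nonneg; [moderate | intros; nra]).
    set (l := laguerre (Derive_n r) 0) in *.
    rewrite (LInt_ext (fun X => p X * laguerre (Derive_n p) 0 X)
      (fun X => (c * c * INR (S n)) * (N X * N X) + (c * (N X * l X) + (c * INR (S n) * (N X * r X) + r X * l X)))).
    2:{ intros X HX. rewrite Ep. rewrite laguerre_combination by assumption.
        unfold N at 2. rewrite (nodal_eigen (S n) _ _ ltac:(lia) HR X HX). fold N. unfold l. ring. }
    rewrite (LInt_ext (fun X => p X * p X) (fun X => (c * c) * (N X * N X) + (2 * c * (N X * r X) + r X * r X)))
      by (intros; rewrite Ep; ring).
    repeat (rewrite LInt_add by moderate). repeat (rewrite LInt_scal by moderate).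
    rewrite O1, O2. rewrite S_INR. nra.
Qed.

(** By parts, the integral of [x p^2] is that of [p^2 + 2 x p p'], and
    [2 x p p' <= x p^2 / 2 + 2 x p'^2]. Absorbing half of the left side leaves twice the integral of
    [p^2] plus four times the Dirichlet form, which is at most [n] times the integral of [p^2]. *)
Lemma LInt_x_sq_bound n p : Plt (S n) p ->
  LInt (fun X => X * (p X * p X)) <= (4 * INR n + 2) * LInt (fun X => p X * p X).
Proof.
  intros Hp. destruct (Plt_smooth _ _ Hp) as [HS HP].
  assert (HM : forall j, moderate (Derive_n p j)) by (intros; eapply Plt_moderate, HP).
  assert (Mp := Plt_moderate _ _ Hp).
  assert (B := laguerre_form_bound n p Hp).
  assert (E : LInt (fun X => p X * laguerre (Derive_n p) 0 X) = LInt (fun X => X * (Derive_n p 1 X * Derive_n p 1 X)))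
    by exact (laguerre_dirichlet (Derive_n p) HS HM).
  rewrite E in B.
  assert (Mp' := HM 1%nat). assert (Dp : forall X, is_derive p X (Derive_n p 1 X)) by apply (HS 0%nat).
  set (p' := Derive_n p 1) in *. clearbody p'. clear HM HP HS E.
  assert (P := LInt_parts (fun X => X * (p X * p X)) (fun X => p X * p X + 2 * (X * (p X * p' X)))
    ltac:(moderate) ltac:(moderate)).
  rewrite LInt_sub in P by moderate.
  assert (H : LInt (fun X => p X * p X + 2 * (X * (p X * p' X)))
    <= LInt (fun X => p X * p X + (/ 2 * (X * (p X * p X)) + 2 * (X * (p' X * p' X))))).
  { apply LInt_le; [moderate | moderate |]. intros X HX.
    assert (0 <= X * ((p X - 2 * p' X) * (p X - 2 * p' X))) by (apply Rmult_le_pos; [assumption | apply Rle_0_sqr]). lra. }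
  repeat (rewrite LInt_add in H by moderate). repeat (rewrite LInt_scal in H by moderate).
  rewrite LInt_add in P by moderate. rewrite LInt_scal in P by moderate.
  rewrite Rmult_0_l in P. specialize (P ltac:(
    intros X; assert (D1 := Dp X);
    assert (E1 : ex_derive p X) by (exists (p' X); exact D1);
    assert (D2 : Derive (fun y : R => p y) X = p' X) by (apply is_derive_unique, D1);
    auto_derive; [repeat split; auto | rewrite D2; ring])).
  lra.
Qed.

(** For the cardinal polynomial [l] of degree [K - 1], the product [x l^2] has degree [2K - 1], the
    last one integrated exactly; the two integrals are [w_k x_k] and [w_k], and
    [4 (K - 1) + 2 = 4K - 2]. *)
Lemma node_bound K k : (1 <= k <= K)%nat -> xs K k <= 4 * INR K - 2.
Proof.
  intros Hk. assert (HR := rules K ltac:(lia)). assert (HK : (1 <= K)%nat) by lia.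
  destruct K as [|n]; [lia|].
  assert (Hc := cardinal_Plt (S n) (xs (S n)) HK k Hk). set (l := cardinal (S n) (xs (S n)) k) in *.
  assert (B := LInt_x_sq_bound n l Hc).
  unfold l in B at 3 4. rewrite (weight_cardinal_sq (S n) _ _ HK HR k Hk) in B.
  rewrite (rule_exact (S n) _ _ HK HR) in B.
  - rewrite (rsum_single _ 1 (S n) k Hk) in B.
    + unfold l in B. rewrite (cardinal_self (S n) _ _ HK HR k Hk) in B.
      assert (W := weight_pos (S n) _ _ HK HR k Hk). rewrite S_INR. nra.
    + intros j Hj Hn. unfold l. rewrite (cardinal_other (S n) _ _ HK HR k j Hk Hj Hn). ring.
  - apply Plt_le with (S (n + S n)); [lia|]. apply (Plt_mulx _ (fun X => l X * l X)), (Plt_mul n); assumption.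
Qed.

(** The integral of [(1 - l)^2] is [1 - 2 w_k + w_k], and it is nonnegative. *)
Lemma weight_le_1 K k : (1 <= k <= K)%nat -> ws K k <= 1.
Proof.
  intros Hk. assert (HR := rules K ltac:(lia)). assert (HK : (1 <= K)%nat) by lia.
  assert (Hc := cardinal_Plt K (xs K) HK k Hk).
  assert (E1 := weight_cardinal K _ _ HK HR k Hk). assert (E2 := weight_cardinal_sq K _ _ HK HR k Hk).
  set (l := cardinal K (xs K) k) in *. assert (Ml := Plt_moderate _ _ Hc).
  assert (P : 0 <= LInt (fun X => 1 - (2 * l X - l X * l X))) by (apply LInt_nonneg; [moderate | intros X _; assert (Q := Rle_0_sqr (1 - l X)); unfold Rsqr in Q; lra]).
  repeat (rewrite LInt_sub in P by moderate). rewrite LInt_scal in P by moderate.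
  rewrite LInt_one in P. change (fun x => l x) with l in P. rewrite E2, <- E1 in P. lra.
Qed.

(* The degree is 2K, so the rule with K nodes is not exact here; the one with K + 1 nodes is. *)
Lemma interpolant_norm K k : (1 <= k <= K)%nat ->
  let rho := fun X => (X - xs K k) * cardinal K (xs K) k X in
  LInt (fun X => rho X * rho X) <= (4 * INR K + 2) ^ 2.
Proof.
  intros Hk rho. assert (HR := rules K ltac:(lia)). assert (HK : (1 <= K)%nat) by lia.
  assert (HR1 := rules (S K) ltac:(lia)).
  assert (Hc := cardinal_Plt K (xs K) HK k Hk).
  assert (E2 := weight_cardinal_sq K _ _ HK HR k Hk).
  assert (W := weight_le_1 K k Hk).
  set (l := cardinal K (xs K) k) in *.
  assert (Hrho : Plt (S K) rho).
  { apply Plt_ext with (fun X => X * l X - xs K k * l X); [intros; unfold rho; ring|].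
    apply Plt_sub; [apply Plt_mulx, Hc | apply Plt_S, Plt_scal, Hc]. }
  (* Summed over the [K + 1] nodes of the next rule, the two integrals differ termwise by the factor
     [(x_i - x_k)^2], and the nodes of both rules lie in [[0, 4K + 2]]. *)
  apply Rle_trans with ((4 * INR K + 2) ^ 2 * LInt (fun X => l X * l X)).
  - rewrite (rule_exact (S K) _ _ ltac:(lia) HR1 (fun X => rho X * rho X)) by (apply (Plt_sq (S K) ltac:(lia)), Hrho).
    rewrite (rule_exact (S K) _ _ ltac:(lia) HR1 (fun X => l X * l X))
      by (apply (Plt_sq (S K) ltac:(lia)), Plt_S, Hc).
    rewrite <- rsum_scal. apply rsum_le. intros i Hi.
    assert (W1 := weight_pos (S K) _ _ ltac:(lia) HR1 i Hi).
    assert (B1 := node_bound (S K) i Hi). rewrite S_INR in B1.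
    assert (B2 := node_bound K k Hk).
    assert (P1 := node_nonneg (S K) _ _ ltac:(lia) HR1 i Hi). assert (P2 := node_nonneg K _ _ HK HR k Hk).
    unfold rho. set (v := l (xs (S K) i)). set (d := xs (S K) i - xs K k).
    assert (Hd : d * d <= (4 * INR K + 2) ^ 2).
    { assert (0 <= INR K) by apply pos_INR. unfold d. rewrite <- Rsqr_pow2. apply Rsqr_le_abs_1.
      rewrite (Rabs_right (4 * INR K + 2)) by lra. apply Rabs_le; lra. }
    replace (ws (S K) i * (d * v * (d * v))) with ((d * d) * (ws (S K) i * (v * v))) by ring.
    apply Rmult_le_compat_r; [apply Rmult_le_pos; [lra | nra] | exact Hd].
  - rewrite E2. assert (0 <= (4 * INR K + 2) ^ 2) by apply pow2_ge_0.
    assert (W1 := weight_pos K _ _ HK HR k Hk). nra.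
Qed.

(** How bounds on the derivatives evolve under one application of [laguerre]: the coefficients [X]
    and [j + 1 - X] are at most [1 + X] and [(j + 1) (1 + X)] in absolute value, so one power of
    [1 + X] is spent and the constants stay free of [X]. *)
Definition laguerre_growth (M : nat -> R) (j : nat) : R := M (S (S j)) + (INR j + 1) * M (S j) + INR j * M j.

Lemma laguerre_bound V M e : (forall j X, 0 <= X -> Rabs (V j X) <= M j * (1 + X) ^ e) ->
  forall j X, 0 <= X -> Rabs (laguerre V j X) <= laguerre_growth M j * (1 + X) ^ S e.
Proof.
  intros H j X HX. unfold laguerre, laguerre_growth.
  assert (B0 := H j X HX). assert (B1 := H (S j) X HX). assert (B2 := H (S (S j)) X HX).
  assert (J := pos_INR j).
  set (u := (1 + X) ^ e) in *. simpl pow. fold u.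
  assert (0 <= M j * u /\ 0 <= M (S j) * u /\ 0 <= M (S (S j)) * u).
  { repeat split; eapply Rle_trans; [apply Rabs_pos | exact B0 | apply Rabs_pos | exact B1 | apply Rabs_pos | exact B2]. }
  destruct H0 as [Q0 [Q1 Q2]].
  rewrite Rabs_Ropp. eapply Rle_trans; [apply Rabs_triang|]. rewrite Rabs_Ropp.
  eapply Rle_trans; [apply Rplus_le_compat_r, Rabs_triang|].
  rewrite !Rabs_mult, (Rabs_right X), (Rabs_right (INR j)) by lra.
  assert (Rabs (INR j + 1 - X) <= (INR j + 1) * (1 + X)) by (apply Rabs_le; nra).
  assert (X * Rabs (V (S (S j)) X) <= (1 + X) * (M (S (S j)) * u))
    by (apply Rmult_le_compat; [lra | apply Rabs_pos | lra | assumption]).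
  assert (Rabs (INR j + 1 - X) * Rabs (V (S j) X) <= (INR j + 1) * (1 + X) * (M (S j) * u))
    by (apply Rmult_le_compat; try apply Rabs_pos; assumption).
  assert (INR j * Rabs (V j X) <= INR j * ((1 + X) * (M j * u))).
  { apply Rmult_le_compat_l; [assumption|]. nra. }
  lra.
Qed.

Lemma bounded_moderate V M e : smooth V -> (forall j X, 0 <= X -> Rabs (V j X) <= M j * (1 + X) ^ e) ->
  forall j, moderate (V j).
Proof.
  intros HS H j; split; [intros X; apply (cont_derive _ _ _ (HS j X)) | exists (M j), e; apply H].
Qed.

(** Each factor [K] is the eigenvalue of the nodal polynomial, and symmetry moves [L] onto the other
    factor. The bound on [W] depends on [V] only through [M] and [e], hence is uniform over all
    divided differences that occur later. *)
Lemma laguerre_iterate r : forall V M e, smooth V ->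
  (forall j X, 0 <= X -> Rabs (V j X) <= M j * (1 + X) ^ e) ->
  exists W, smooth W /\ (forall j X, 0 <= X -> Rabs (W j X) <= Nat.iter r laguerre_growth M j * (1 + X) ^ (r + e)) /\
    forall K, (1 <= K)%nat ->
      INR K ^ r * LInt (fun X => nodal (xs K) K X * V 0%nat X) = LInt (fun X => nodal (xs K) K X * W 0%nat X).
Proof.
  induction r; intros V M e HS HB.
  - exists V. split; [assumption|]. split; [exact HB|]. intros; simpl; ring.
  - destruct (IHr V M e HS HB) as [W [SW [BW EW]]].
    exists (laguerre W). split; [apply laguerre_smooth, SW|]. split; [apply (laguerre_bound W _ (r + e)), BW|].
    intros K HK. assert (HR := rules K HK). simpl pow. rewrite Rmult_assoc, (EW K HK).
    assert (MW := bounded_moderate W _ _ SW BW).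
    assert (HN := monic_Plt _ _ (nodal_monic (xs K) K)).
    destruct (Plt_smooth _ _ HN) as [SN PN].
    assert (MN := Plt_moderate _ _ HN).
    assert (MDN : forall j, moderate (Derive_n (nodal (xs K) K) j)) by (intros; eapply Plt_moderate, PN).
    assert (E : LInt (fun X => laguerre (Derive_n (nodal (xs K) K)) 0 X * W 0%nat X)
              = LInt (fun X => nodal (xs K) K X * laguerre W 0 X))
      by exact (laguerre_symmetric (Derive_n (nodal (xs K) K)) W SN SW MDN MW).
    rewrite <- E, <- LInt_scal by moderate.
    apply LInt_ext. intros X HX. rewrite (nodal_eigen K _ _ HK HR X HX). ring.
Qed.

(** The constant depends on the integrand through the bounds [M] alone, as needed for a family
    indexed by [s]. In [K^3], two powers come from the norm of [rho k] and one from the number of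
    terms. *)
Lemma gauss_laguerre_error (M : nat -> R) (r : nat) :
  exists C, 0 <= C /\ forall K D, (1 <= K)%nat -> smooth D -> (forall j X, Rabs (D j X) <= M j) ->
    Rabs (LInt (D 0%nat) - sum_n_m (fun k => ws K k * D 0%nat (xs K k)) 1 K) <= C * INR K ^ 3 * / INR K ^ r.
Proof.
  set (c := Nat.iter r laguerre_growth (fun j => M (S j)) 0%nat).
  set (P := LInt (fun X => (1 + X) ^ r * (1 + X) ^ r)).
  assert (HP : 0 <= P).
  { apply LInt_nonneg; [moderate|]. intros X HX; apply Rmult_le_pos; apply pow_le; lra. }
  (* For [K >= 1], half of [(4K + 2)^2] is at most [18 K^2]. *)
  exists (18 + c * c * P); split; [nra|].
  intros K D HK SD BD. assert (HR := rules K HK).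
  assert (K1 : 1 <= INR K) by (apply (le_INR 1), HK).
  assert (Kr : 0 < INR K ^ r) by (apply pow_lt; lra).
  assert (MD : forall j, moderate (D j)).
  { apply (bounded_moderate D M 0 SD). intros j X _; rewrite pow_O, Rmult_1_r; apply BD. }
  set (l := cardinal K (xs K)).
  assert (Pl : forall k, (1 <= k <= K)%nat -> moderate (l k)) by (intros; eapply Plt_moderate, cardinal_Plt; eassumption).
  set (rho := fun k X => (X - xs K k) * l k X).
  set (G := fun k => slope D (xs K k)).
  assert (SG : forall k, smooth (G k)) by (intros k; exact (slope_smooth D (xs K k) SD)).
  assert (BG : forall k j X, 0 <= X -> Rabs (G k j X) <= M (S j) * (1 + X) ^ 0).
  { intros k j X _. rewrite pow_O, Rmult_1_r. exact (slope_bound D (xs K k) j X (M (S j)) SD (BD (S j))). }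
  assert (MG : forall k j, moderate (G k j)) by (intros k; apply (bounded_moderate (G k) _ _ (SG k) (BG k))).
  (* Since the cardinal polynomials sum to 1 and [w_k] is the integral of [l k], the error is the
     sum of the integrals of [l k (D 0 x - D 0 x_k)]. *)
  assert (E : LInt (D 0%nat) - sum_n_m (fun k => ws K k * D 0%nat (xs K k)) 1 K
    = sum_n_m (fun k => LInt (fun X => rho k X * G k 0%nat X)) 1 K).
  { rewrite (LInt_ext (D 0%nat) (fun X => sum_n_m (fun k => l k X * D 0%nat X) 1 K)).
    - destruct (LInt_sum (fun k X => l k X * D 0%nat X) 1 K) as [_ ->].
      { intros k Hk. specialize (Pl k Hk). moderate. }
      rewrite <- rsum_sub. apply rsum_ext. intros k Hk. specialize (Pl k Hk).
      rewrite (weight_cardinal K _ _ HK HR k Hk). fold (l k).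
      rewrite Rmult_comm, <- LInt_scal by assumption. rewrite <- LInt_sub by moderate.
      apply LInt_ext. intros X HX. unfold rho, G.
      transitivity (l k X * ((X - xs K k) * slope D (xs K k) 0 X)); [rewrite slope_spec by exact SD; ring | ring].
    - intros X HX. rewrite (rsum_ext _ (fun k => D 0%nat X * l k X)) by (intros; ring).
      rewrite rsum_scal. unfold l. rewrite (cardinal_sum K _ _ HK HR X HX). rring. }
  rewrite E.
  assert (T : forall k, (1 <= k <= K)%nat ->
    Rabs (LInt (fun X => rho k X * G k 0%nat X)) <= / INR K ^ r * ((18 + c * c * P) * INR K ^ 2)).
  { intros k Hk. specialize (Pl k Hk).
    destruct (laguerre_iterate r (G k) (fun j => M (S j)) 0 (SG k) (BG k)) as [W [SW [BW EW]]].
    specialize (EW K HK). rewrite Nat.add_0_r in BW.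
    assert (MW := bounded_moderate W _ _ SW BW).
    assert (MN := Plt_moderate _ _ (monic_Plt _ _ (nodal_monic (xs K) K))).
    (* The constant [1 / N'(x_k)] is never estimated by itself: it is pulled out to use the
       eigenvalue, then put back into [rho k], whose norm is known. *)
    assert (Er : forall X, rho k X = / nodal_except (xs K) K k (xs K k) * nodal (xs K) K X).
    { intros X. unfold rho, l, cardinal. rewrite <- (nodal_except_spec (xs K) K k X Hk). unfold Rdiv; ring. }
    assert (Mrho : moderate (rho k)) by (unfold rho; moderate).
    assert (E1 : LInt (fun X => rho k X * G k 0%nat X) = / INR K ^ r * LInt (fun X => rho k X * W 0%nat X)).
    { rewrite (LInt_ext (fun X => rho k X * G k 0%nat X)
        (fun X => / nodal_except (xs K) K k (xs K k) * (nodal (xs K) K X * G k 0%nat X))) by (intros; rewrite Er; ring).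
      rewrite (LInt_ext (fun X => rho k X * W 0%nat X)
        (fun X => / nodal_except (xs K) K k (xs K k) * (nodal (xs K) K X * W 0%nat X))) by (intros; rewrite Er; ring).
      assert (MGk := MG k 0%nat). specialize (MW 0%nat).
      rewrite !LInt_scal by moderate. rewrite <- EW.
      set (N0 := LInt (fun X => nodal (xs K) K X * G k 0%nat X)).
      transitivity (/ nodal_except (xs K) K k (xs K k) * (/ INR K ^ r * INR K ^ r * N0)); [rewrite Rinv_l by lra; ring | ring]. }
    rewrite E1, Rabs_mult, (Rabs_right (/ _)) by (apply Rle_ge, Rlt_le, Rinv_0_lt_compat, Kr).
    apply Rmult_le_compat_l; [apply Rlt_le, Rinv_0_lt_compat, Kr|].
    assert (IN := interpolant_norm K k Hk). cbv zeta in IN. fold (l k) in IN. change (fun X => (X - xs K k) * l k X) with (rho k) in IN.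
    assert (IN' : LInt (fun X => rho k X * rho k X) <= (4 * INR K + 2) ^ 2) by exact IN.
    eapply Rle_trans; [apply (LInt_product_bound _ _ c r Mrho (MW 0%nat) (BW 0%nat))|]. fold P.
    assert (0 <= c * c * P) by (apply Rmult_le_pos; [apply Rle_0_sqr | exact HP]).
    assert (1 <= INR K ^ 2) by nra. nra. }
  eapply Rle_trans; [apply rsum_abs|].
  eapply Rle_trans; [apply rsum_le, T|]. rewrite rsum_const.
  apply Req_le. simpl; ring.
Qed.

End Rules.

(** * The sine product *)

(** Wallis-type integrals behind Euler's product: [cos^(2n)] concentrates at 0, so the ratio of the
    moments at [x] and at 0 tends to 1, while its recursion in [n] produces the factors of the
    product. *)
Definition cosine_moment (x : R) (n : nat) : R := RInt (fun t => cos (2 * x * t) * cos t ^ (2 * n)) 0 (PI / 2).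

Lemma cont_cos (f : R -> R) t : continuous f t -> continuous (fun t => cos (f t)) t.
Proof. intros H; apply (continuous_comp f cos); [exact H | apply continuous_cos]. Qed.
Lemma cont_sin (f : R -> R) t : continuous f t -> continuous (fun t => sin (f t)) t.
Proof. intros H; apply (continuous_comp f sin); [exact H | apply continuous_sin]. Qed.

Lemma cosine_moment_cont x n t : continuous (fun t => cos (2 * x * t) * cos t ^ (2 * n)) t.
Proof. apply cont_mul; [apply cont_cos; cont | apply cont_pow, cont_cos; cont]. Qed.

Lemma cosine_moment_rec x n :
  (2 * INR n + 2) * (2 * INR n + 1) * cosine_moment x n
  = ((2 * INR n + 2) ^ 2 - 4 * x ^ 2) * cosine_moment x (S n).
Proof.
  unfold cosine_moment. apply Rminus_diag_uniq.
  replace (2 * S n)%nat with (S (S (2 * n))) by lia.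
  assert (Em : INR (2 * n) = 2 * INR n) by (rewrite mult_INR; reflexivity).
  rewrite <- Em. set (m := (2 * n)%nat) in *. clearbody m. clear n Em.
  assert (C : forall k t, continuous (fun t => cos (2 * x * t) * cos t ^ k) t)
    by (intros; apply cont_mul; [apply cont_cos; cont | apply cont_pow, cont_cos; cont]).
  assert (E : forall k, ex_RInt (fun t => cos (2 * x * t) * cos t ^ k) 0 (PI / 2)) by (intros; apply ex_RInt_cont, C).
  set (a := (INR m + 2) * (INR m + 1)). set (b := (INR m + 2) ^ 2 - 4 * x ^ 2).
  (* [F] collects the boundary terms of two integrations by parts; it vanishes at 0 through the
     sines and at [PI / 2] through the powers of the cosine. *)
  set (F := fun t => - (INR m + 2) * cos (2 * x * t) * (cos t ^ S m * sin t)
                     + 2 * x * (sin (2 * x * t) * cos t ^ S (S m))).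
  assert (H : RInt (fun t => a * (cos (2 * x * t) * cos t ^ m) - b * (cos (2 * x * t) * cos t ^ S (S m))) 0 (PI / 2)
    = F (PI / 2) - F 0).
  { apply RInt_FTC.
    - intros t. unfold F. auto_derive; [trivial|].
      assert (C2 := sin2_cos2 t). unfold Rsqr in C2.
      change (match m with O => 1 | S _ => INR m + 1 end) with (INR (S m)).
      rewrite ?S_INR, <- ?tech_pow_Rmult. simpl pred. rewrite <- ?tech_pow_Rmult. unfold a, b.
      set (c := cos t) in *. set (s := sin t) in *. set (p := c ^ m).
      transitivity ((INR m + 2) * cos (2 * x * t) * p * ((INR m + 1) * (s * s) - c * c) + 4 * x * x * cos (2 * x * t) * (c * (c * p))).
      + ring.
      + replace (s * s) with (1 - c * c) by lra. ring.
    - intros t. apply cont_sub; (apply cont_mul; [cont | apply C]). }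
  assert (F0 : F 0 = 0).
  { unfold F. rewrite !Rmult_0_r, sin_0. ring. }
  assert (F1 : F (PI / 2) = 0).
  { unfold F. rewrite cos_PI2. rewrite !pow_i by lia. ring. }
  rewrite F0, F1, Rminus_0_r in H. etransitivity; [|exact H]. symmetry.
  rewrite (RInt_minus (V := R_CompleteNormedModule) (fun t => a * (cos (2 * x * t) * cos t ^ m))
    (fun t => b * (cos (2 * x * t) * cos t ^ S (S m)))).
  - rewrite (RInt_scal (V := R_CompleteNormedModule) (fun t => cos (2 * x * t) * cos t ^ m)) by apply E.
    rewrite (RInt_scal (V := R_CompleteNormedModule) (fun t => cos (2 * x * t) * cos t ^ S (S m))) by apply E.
    reflexivity.
  - apply ex_RInt_cont; intros; apply cont_mul; [cont | apply C].
  - apply ex_RInt_cont; intros; apply cont_mul; [cont | apply C].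
Qed.

Lemma cosine_moment_0 x : 2 * x * cosine_moment x 0 = sin (PI * x).
Proof.
  unfold cosine_moment.
  rewrite <- (RInt_scal (V := R_CompleteNormedModule)) by (apply ex_RInt_cont; intros; apply cosine_moment_cont).
  rewrite (RInt_ext _ (fun t => 2 * x * cos (2 * x * t))).
  - rewrite (RInt_FTC (fun t => sin (2 * x * t))).
    + rewrite Rmult_0_r, sin_0, Rminus_0_r. f_equal. field.
    + intros t. auto_derive; [trivial | ring].
    + intros t. apply cont_mul; [cont | apply cont_cos; cont].
  - intros; unfold scal; simpl; unfold mult; simpl; ring.
Qed.

Lemma cosine_moment_00 : cosine_moment 0 0 = PI / 2.
Proof.
  unfold cosine_moment. rewrite (RInt_ext _ (fun _ => 1)).
  - rewrite RInt_const. unfold scal; simpl; unfold mult; simpl; ring.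
  - intros; simpl. rewrite Rmult_0_r, Rmult_0_l, cos_0; ring.
Qed.

Lemma cosine_moment_pos n : 0 < cosine_moment 0 n.
Proof.
  induction n; [rewrite cosine_moment_00; assert (H := PI_RGT_0); lra|].
  assert (H := cosine_moment_rec 0 n). assert (P := pos_INR n).
  apply Rnot_le_lt; intros Hn. assert (0 < (2 * INR n + 2) * (2 * INR n + 1) * cosine_moment 0 n).
  { repeat apply Rmult_lt_0_compat; lra. }
  nra.
Qed.

(** The difference of the two sides vanishes at 0 and has derivative [t sin t]. It is [t <= tan t]
    in a form that remains valid at [PI / 2]. *)
Lemma x_cos_le_sin t : 0 <= t <= PI / 2 -> t * cos t <= sin t.
Proof.
  intros Ht. assert (HP := PI_RGT_0).
  assert (H : RInt (fun u => u * sin u) 0 t = (sin t - t * cos t) - (sin 0 - 0 * cos 0)).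
  { apply (RInt_FTC (fun u => sin u - u * cos u)).
    - intros u; auto_derive; [trivial | ring].
    - intros u; apply cont_mul; [cont | apply cont_sin; cont]. }
  rewrite sin_0 in H.
  assert (0 <= RInt (fun u => u * sin u) 0 t).
  { apply RInt_ge_0; [lra | apply ex_RInt_cont; intros; apply cont_mul; [cont | apply cont_sin; cont] |].
    intros u Hu. apply Rmult_le_pos; [lra | apply sin_ge_0; lra]. }
  lra.
Qed.

(* [1 - cos (2xt) <= 2 t^2], and [t cos t <= sin t] trades [t^2] for a lower power of the cosine. *)
Lemma cosine_moment_close x n : 0 < x < 1 ->
  0 <= cosine_moment 0 (S n) - cosine_moment x (S n) <= 2 * (cosine_moment 0 n - cosine_moment 0 (S n)).
Proof.
  intros Hx. unfold cosine_moment. assert (HP := PI_RGT_0).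
  assert (E : forall x m, ex_RInt (fun t => cos (2 * x * t) * cos t ^ (2 * m)) 0 (PI / 2))
    by (intros; apply ex_RInt_cont; intros; apply cosine_moment_cont).
  assert (E1 := ex_rint_sub _ _ 0 (PI / 2) (E 0 (S n)) (E x (S n))).
  assert (E2 := ex_rint_sub _ _ 0 (PI / 2) (E 0 n) (E 0 (S n))).
  assert (E3 := ex_rint_scal _ 2 0 (PI / 2) E2). cbv beta in E1, E2, E3.
  rewrite <- !rint_sub by apply E. rewrite <- rint_scal by exact E2.
  assert (D : forall t, 0 < t < PI / 2 ->
    0 <= cos (2 * 0 * t) * cos t ^ (2 * S n) - cos (2 * x * t) * cos t ^ (2 * S n) <=
    2 * (cos (2 * 0 * t) * cos t ^ (2 * n) - (cos (2 * 0 * t) * cos t ^ (2 * S n)))).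
  { intros t Ht. replace (2 * 0 * t) with 0 by ring. rewrite cos_0, !Rmult_1_l.
    replace (2 * S n)%nat with (S (S (2 * n))) by lia. rewrite <- !tech_pow_Rmult.
    replace (2 * x * t) with (2 * (x * t)) by ring. rewrite cos_2a_sin.
    assert (C := sin2_cos2 t). unfold Rsqr in C.
    assert (T := x_cos_le_sin t ltac:(lra)).
    assert (c0 : 0 <= cos t) by (apply cos_ge_0; lra). assert (s0 : 0 <= sin t) by (apply sin_ge_0; lra).
    assert (0 < x * t < t) by nra.
    assert (X0 : 0 <= sin (x * t)) by (apply sin_ge_0; lra).
    assert (X1 : sin (x * t) < x * t) by (apply sin_lt_x; lra).
    assert (p0 : 0 <= cos t ^ (2 * n)) by (apply pow_le; lra).
    set (p := cos t ^ (2 * n)) in *. set (c := cos t) in *. set (s := sin t) in *. set (z := sin (x * t)) in *.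
    assert (Z : z * c <= s) by nra. assert (Z2 : (z * c) * (z * c) <= s * s) by (apply Rmult_le_compat; nra).
    assert (0 <= (z * c) * (z * c)) by nra.
    split.
    - replace (c * (c * p) - (1 - 2 * z * z) * (c * (c * p))) with (2 * p * ((z * c) * (z * c))) by ring. nra.
    - replace (c * (c * p) - (1 - 2 * z * z) * (c * (c * p))) with (2 * p * ((z * c) * (z * c))) by ring.
      replace (2 * (p - (c * (c * p)))) with (2 * p * (s * s)) by (replace (s * s) with (1 - c * c) by lra; ring). nra. }
  split.
  - apply RInt_ge_0; [lra | exact E1 | intros t Ht; apply D; lra].
  - apply RInt_le; [lra | exact E1 | exact E3 | intros t Ht; apply D; lra].
Qed.

Fixpoint sine_product (x : R) (n : nat) : R :=
  match n with O => 1 | S m => sine_product x m * (1 - x ^ 2 / INR (S m) ^ 2) end.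

(** Dividing the recursion at [x] by the one at 0 shows that the left side does not depend on
    [n]. *)
Lemma sine_product_moment x n :
  sine_product x n * (cosine_moment x n / cosine_moment 0 n) = cosine_moment x 0 / cosine_moment 0 0.
Proof.
  induction n; [simpl; ring|]. rewrite <- IHn. clear IHn. change (sine_product x (S n)) with (sine_product x n * (1 - x ^ 2 / INR (S n) ^ 2)). rewrite Rmult_assoc. f_equal.
  assert (H1 := cosine_moment_rec x n). assert (H0 := cosine_moment_rec 0 n).
  assert (P0 := cosine_moment_pos n). assert (P1 := cosine_moment_pos (S n)). assert (N := pos_INR n).
  set (u := cosine_moment x n) in *. set (u' := cosine_moment x (S n)) in *.
  set (v := cosine_moment 0 n) in *. set (v' := cosine_moment 0 (S n)) in *.
  rewrite S_INR. assert (Q : 0 < (2 * INR n + 2) * (2 * INR n + 1)) by nra.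
  assert (Hv : v = (2 * INR n + 2) ^ 2 / ((2 * INR n + 2) * (2 * INR n + 1)) * v').
  { apply Rmult_eq_reg_l with ((2 * INR n + 2) * (2 * INR n + 1)); [|lra]. rewrite H0. field. lra. }
  assert (Hu : u = ((2 * INR n + 2) ^ 2 - 4 * x ^ 2) / ((2 * INR n + 2) * (2 * INR n + 1)) * u').
  { apply Rmult_eq_reg_l with ((2 * INR n + 2) * (2 * INR n + 1)); [|lra]. rewrite H1. field. lra. }
  rewrite Hu, Hv. field. repeat split; nra.
Qed.

(** Euler's product with an explicit remainder [r], the ratio of moments. The rate comes from the
    recursion at 0, which makes consecutive moments differ by the fraction [1 / (2n + 1)]. *)
Lemma sine_product_bounds x n : 0 < x < 1 ->
  exists r, sine_product x (S n) * r = sin (PI * x) / (PI * x) /\ 1 - 2 / (2 * INR n + 1) <= r <= 1.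
Proof.
  intros Hx. exists (cosine_moment x (S n) / cosine_moment 0 (S n)).
  assert (HP := PI_RGT_0). assert (N := pos_INR n). split.
  - rewrite sine_product_moment, cosine_moment_00, <- cosine_moment_0. field. lra.
  - assert (H := cosine_moment_close x n Hx). assert (P1 := cosine_moment_pos (S n)).
    assert (H0 := cosine_moment_rec 0 n).
    set (u' := cosine_moment x (S n)) in *. set (v := cosine_moment 0 n) in *. set (v' := cosine_moment 0 (S n)) in *.
    assert (Hv : v = v' + v' / (2 * INR n + 1)).
    { apply Rmult_eq_reg_l with ((2 * INR n + 2) * (2 * INR n + 1)); [|nra]. rewrite H0. field. lra. }
    assert (Hd : 0 < v' / (2 * INR n + 1)) by (apply Rdiv_lt_0_compat; lra).
    split.
    + apply Rmult_le_reg_r with v'; [assumption|]. replace (u' / v' * v') with u' by (field; lra).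
      replace ((1 - 2 / (2 * INR n + 1)) * v') with (v' - 2 * (v' / (2 * INR n + 1))) by (field; lra). lra.
    + apply Rmult_le_reg_r with v'; [assumption|]. replace (u' / v' * v') with u' by (field; lra). lra.
Qed.

(** * The Gamma function *)

Definition gamma_density (s x : R) : R := Rpower x (s - 1) * exp (- x).

Lemma exp_monotone x y : x <= y -> exp x <= exp y.
Proof. intros [H|H]; [left; apply exp_increasing, H | right; f_equal; exact H]. Qed.

Lemma Rpower_pos x q : 0 < Rpower x q.
Proof. apply exp_pos. Qed.

Lemma Rpower_derive q x : 0 < x -> is_derive (fun y => Rpower y q) x (q * Rpower x (q - 1)).
Proof. intros H; apply is_derive_Reals, derivable_pt_lim_power, H. Qed.

Lemma Rpower_cont q x : 0 < x -> continuous (fun y => Rpower y q) x.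
Proof. intros H; eapply cont_derive, Rpower_derive, H. Qed.

Lemma gamma_density_cont s x : 0 < x -> continuous (gamma_density s) x.
Proof. intros H; unfold gamma_density; apply cont_mul; [apply Rpower_cont, H | cont]. Qed.

Lemma ex_RInt_pos (f : R -> R) a b : (forall x, 0 < x -> continuous f x) -> 0 < a -> 0 < b -> ex_RInt f a b.
Proof.
  intros H Ha Hb; apply (ex_RInt_continuous (V := R_CompleteNormedModule)); intros x [Hx _].
  apply H. apply Rlt_le_trans with (2 := Hx). apply Rmin_glb_lt; assumption.
Qed.

Lemma filter_prod_pos (P : R * R -> Prop) : (forall a b, 0 < a -> 1 < b -> a < b -> P (a, b)) ->
  filter_prod (at_right 0) (Rbar_locally p_infty) P.
Proof.
  intros H. apply (Filter_prod _ _ _ (fun a => 0 < a < 1) (fun b => 1 < b)).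
  - exists (mkposreal 1 Rlt_0_1). intros y Hy Hp. split; [exact Hp|].
    unfold ball in Hy; simpl in Hy; unfold AbsRing_ball, abs, minus, plus, opp in Hy; simpl in Hy.
    apply Rabs_lt_between in Hy; lra.
  - exists 1; intros; assumption.
  - intros a b Ha Hb; apply H; lra.
Qed.

Lemma ex_RInt_gen_nonneg (f : R -> R) M : (forall x, 0 < x -> continuous f x) -> (forall x, 0 < x -> 0 <= f x) ->
  (forall a b, 0 < a -> a <= b -> RInt f a b <= M) -> ex_RInt_gen f (at_right 0) (Rbar_locally p_infty).
Proof.
  intros Hc Hp HM.
  assert (E : forall a b, 0 < a -> 0 < b -> ex_RInt f a b) by (intros; apply ex_RInt_pos; assumption).
  destruct (completeness (fun v => exists a b, 0 < a /\ a <= b /\ v = RInt f a b)) as [l [Hu Hl]].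
  - exists M; intros v [a [b [Ha [Hab ->]]]]; apply HM; assumption.
  - exists (RInt f 1 1), 1, 1; repeat split; lra.
  - exists l. intros P [[e He] HP]; simpl in HP.
    assert (Hx : exists a b, 0 < a /\ a <= b /\ l - e < RInt f a b).
    { apply Classical_Prop.NNPP; intros Hn.
      assert (l <= l - e); [|lra]. apply Hl; intros v [a [b [Ha [Hab ->]]]].
      apply Rnot_lt_le; intros Hlt; apply Hn; exists a, b; auto. }
    destruct Hx as [a0 [b0 [Ha0 [Hab0 Hlt]]]].
    apply (Filter_prod _ _ _ (fun a => 0 < a < a0) (fun b => b0 < b)).
    + exists (mkposreal a0 Ha0). intros y Hy Hy0. split; [exact Hy0|].
      unfold ball in Hy; simpl in Hy; unfold AbsRing_ball, abs, minus, plus, opp in Hy; simpl in Hy.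
      apply Rabs_lt_between in Hy; lra.
    + exists b0; intros; assumption.
    + intros a b Ha Hb. exists (RInt f a b). simpl. split; [apply (RInt_correct (V := R_CompleteNormedModule)), E; lra|].
      apply HP. unfold ball; simpl; unfold AbsRing_ball, abs, minus, plus, opp; simpl.
      assert (RInt f a b <= l) by (apply Hu; exists a, b; repeat split; lra).
      rewrite <- (RInt_Chasles (V := R_CompleteNormedModule) f a a0 b) in * by (apply E; lra).
      rewrite <- (RInt_Chasles (V := R_CompleteNormedModule) f a0 b0 b) in * by (apply E; lra).
      unfold plus in *; simpl in *.
      assert (0 <= RInt f a a0) by (apply RInt_ge_0; [lra | apply E; lra | intros; apply Hp; lra]).
      assert (0 <= RInt f b0 b) by (apply RInt_ge_0; [lra | apply E; lra | intros; apply Hp; lra]).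
      apply Rabs_lt_between; lra.
Qed.

(* The primitive of [x^(s-1) (1+x)^(-s-1)] is [(x/(1+x))^s / s], which is bounded. *)
Lemma gamma_density_bound s : 0 < s -> exists M, forall a b, 0 < a -> a <= b -> RInt (gamma_density s) a b <= M.
Proof.
  intros Hs. destruct (INR_archimed 1 (s + 1)) as [n Hn]; [lra|]. rewrite Rmult_1_r in Hn.
  destruct (pow_exp_half n) as [C [HC H]].
  exists (C / s). intros a b Ha Hab.
  set (dF := fun x => C * (Rpower (x / (1 + x)) (s - 1) * / (1 + x) ^ 2)).
  assert (cont_quot : forall x, 0 < x -> continuous (fun x => x / (1 + x)) x).
  { intros x Hx. apply (ex_derive_continuous (K := R_AbsRing) (V := R_NormedModule)). auto_derive. lra. }
  assert (HdF : forall x, 0 < x -> continuous dF x).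
  { intros x Hx. unfold dF. apply cont_mul; [cont|]. apply cont_mul.
    - apply (continuous_comp (fun x => x / (1 + x)) (fun y => Rpower y (s - 1))); [auto|].
      apply Rpower_cont, Rdiv_lt_0_compat; lra.
    - apply (ex_derive_continuous (K := R_AbsRing) (V := R_NormedModule)). auto_derive. nra. }
  assert (HF : forall x, 0 < x -> is_derive (fun x => C / s * Rpower (x / (1 + x)) s) x (dF x)).
  { intros x Hx. unfold dF.
    replace (C * (Rpower (x / (1 + x)) (s - 1) * / (1 + x) ^ 2))
      with (C / s * (/ (1 + x) ^ 2 * (s * Rpower (x / (1 + x)) (s - 1)))) by (field; split; nra).
    apply is_derive_scal.
    apply (is_derive_comp (V := R_NormedModule) (fun y => Rpower y s) (fun x => x / (1 + x))).
    - apply Rpower_derive, Rdiv_lt_0_compat; lra.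
    - auto_derive; [lra | field; lra]. }
  apply Rle_trans with (RInt dF a b).
  - apply RInt_le; [assumption | apply ex_RInt_pos; auto using gamma_density_cont; lra | apply ex_RInt_pos; auto; lra |].
    intros x Hx. unfold gamma_density, dF.
    assert (E : Rpower x (s - 1) = Rpower (x / (1 + x)) (s - 1) * Rpower (1 + x) (s - 1)).
    { rewrite Rpower_mult_distr by (try apply Rdiv_lt_0_compat; lra). f_equal. field. lra. }
    rewrite E. set (u := Rpower (x / (1 + x)) (s - 1)). assert (0 < u) by apply Rpower_pos.
    replace (C * (u * / (1 + x) ^ 2)) with (u * (C * / (1 + x) ^ 2)) by ring.
    rewrite Rmult_assoc. apply Rmult_le_compat_l; [lra|].
    apply Rmult_le_reg_r with ((1 + x) ^ 2); [nra|].
    replace (C * / (1 + x) ^ 2 * (1 + x) ^ 2) with C by (field; lra).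
    apply Rle_trans with ((1 + x) ^ n * exp (- x)).
    + replace (Rpower (1 + x) (s - 1) * exp (- x) * (1 + x) ^ 2)
        with (Rpower (1 + x) (s - 1) * Rpower (1 + x) 2 * exp (- x)).
      * rewrite <- Rpower_plus. apply Rmult_le_compat_r; [apply Rlt_le, exp_pos|].
        rewrite <- (Rpower_pow n) by lra. apply Rle_Rpower; lra.
      * replace 2 with (INR 2) by reflexivity. rewrite Rpower_pow by lra. simpl INR. ring.
    + eapply Rle_trans; [apply H; lra|]. rewrite <- (Rmult_1_r C) at 2. apply Rmult_le_compat_l; [assumption|].
      rewrite <- exp_0. left; apply exp_increasing; lra.
  - rewrite (is_RInt_unique dF a b (C / s * Rpower (b / (1 + b)) s - C / s * Rpower (a / (1 + a)) s)).
    + assert (0 < Rpower (a / (1 + a)) s) by apply Rpower_pos.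
      assert (Rpower (b / (1 + b)) s <= 1).
      { unfold Rpower.
        assert (ln (b / (1 + b)) <= 0); [| apply Rle_trans with (exp 0); [apply exp_monotone; nra | rewrite exp_0; lra]].
        rewrite <- ln_1. apply ln_le; [apply Rdiv_lt_0_compat; lra|].
        apply Rmult_le_reg_r with (1 + b); [lra|]. unfold Rdiv. rewrite Rmult_assoc, Rinv_l; lra. }
      assert (0 <= C / s) by (apply Rmult_le_pos; [assumption | apply Rlt_le, Rinv_0_lt_compat; assumption]).
      nra.
    + apply (is_RInt_derive (V := R_CompleteNormedModule) (fun x => C / s * Rpower (x / (1 + x)) s) dF);
        intros x Hx; rewrite Rmin_left in Hx by lra; [apply HF | apply HdF]; lra.
Qed.

(** [RInt_gen] always returns a value; here the integral converges, so [Gamma s] is what it should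
    be. *)
Lemma Gamma_integral s : 0 < s -> is_RInt_gen (gamma_density s) (at_right 0) (Rbar_locally p_infty) (Gamma s).
Proof.
  intros Hs. destruct (gamma_density_bound s Hs) as [M HM].
  apply (RInt_gen_correct (V := R_CompleteNormedModule)). apply ex_RInt_gen_nonneg with M.
  - intros; apply gamma_density_cont; assumption.
  - intros; apply Rmult_le_pos; left; [apply Rpower_pos | apply exp_pos].
  - exact HM.
Qed.

Lemma is_RInt_gen_pos_le (f g : R -> R) lf lg :
  (forall x, 0 < x -> 0 <= f x <= g x) ->
  is_RInt_gen f (at_right 0) (Rbar_locally p_infty) lf ->
  is_RInt_gen g (at_right 0) (Rbar_locally p_infty) lg -> lf <= lg.
Proof.
  intros H Hf Hg. eapply Rle_trans; [apply Rle_abs|].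
  apply (RInt_gen_norm (V := R_CompleteNormedModule) f g lf lg (Fa := at_right 0) (Fb := Rbar_locally p_infty));
    [| | exact Hf | exact Hg].
  - apply filter_prod_pos; simpl; intros; lra.
  - apply filter_prod_pos; simpl; intros a b Ha Hb Hab x Hx. destruct (H x ltac:(lra)).
    unfold norm; simpl; unfold abs; simpl. rewrite Rabs_right; lra.
Qed.

Lemma is_RInt_gen_ext_pos (f g : R -> R) l : (forall x, 0 < x -> f x = g x) ->
  is_RInt_gen f (at_right 0) (Rbar_locally p_infty) l -> is_RInt_gen g (at_right 0) (Rbar_locally p_infty) l.
Proof.
  intros H. apply (is_RInt_gen_ext (V := R_NormedModule)). apply filter_prod_pos; simpl; intros a b Ha Hb Hab x Hx.
  rewrite Rmin_left in Hx by lra. apply H; lra.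
Qed.

Lemma Rpower_0_lim q : 0 < q -> filterlim (fun x => Rpower x q) (at_right 0) (locally 0).
Proof.
  intros Hq P [[e He] HP]; simpl in HP.
  exists (mkposreal (Rpower e (/ q)) (Rpower_pos _ _)). intros y Hy Hp. simpl in Hy.
  unfold ball in Hy; simpl in Hy; unfold AbsRing_ball, abs, minus, plus, opp in Hy; simpl in Hy.
  apply Rabs_lt_between in Hy. apply HP.
  unfold ball; simpl; unfold AbsRing_ball, abs, minus, plus, opp; simpl.
  assert (0 < Rpower y q) by apply Rpower_pos.
  assert (Rpower y q < e); [|apply Rabs_lt_between; lra].
  replace e with (Rpower (Rpower e (/ q)) q).
  - apply Rlt_Rpower_l; lra.
  - rewrite Rpower_mult, Rinv_l, Rpower_1; lra.
Qed.

Lemma gamma_boundary_infty q : filterlim (fun x => Rpower x q * exp (- x)) (Rbar_locally p_infty) (locally 0).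
Proof.
  destruct (INR_archimed 1 q) as [n Hn]; [lra|]. rewrite Rmult_1_r in Hn.
  assert (L : is_lim (fun B => B ^ n * exp (- B)) p_infty 0).
  { apply (is_lim_moderate_exp (fun B => B ^ n)). moderate. }
  assert (L2 : is_lim (fun x => Rpower x q * exp (- x)) p_infty 0).
  { apply is_lim_le_le_loc with (fun _ => 0) (fun B => B ^ n * exp (- B)); [| apply is_lim_const | exact L].
    exists 1; intros B HB. split.
    - apply Rmult_le_pos; left; [apply Rpower_pos | apply exp_pos].
    - apply Rmult_le_compat_r; [left; apply exp_pos|]. rewrite <- Rpower_pow by lra. apply Rle_Rpower; lra. }
  exact L2.
Qed.

(** [x^s exp(-x)] vanishes at both ends, so the integral of its derivative is 0; computed by
    linearity, the same integral is [s Gamma s - Gamma (s + 1)]. *)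
Lemma Gamma_succ s : 0 < s -> Gamma (s + 1) = s * Gamma s.
Proof.
  intros Hs.
  assert (D : forall x, 0 < x -> is_derive (fun x => Rpower x s * exp (- x)) x (s * gamma_density s x - gamma_density (s + 1) x)).
  { intros x Hx. unfold gamma_density. replace (s + 1 - 1) with s by ring.
    replace (s * (Rpower x (s - 1) * exp (- x)) - Rpower x s * exp (- x))
      with (s * Rpower x (s - 1) * exp (- x) + Rpower x s * (- 1 * exp (- x))) by ring.
    apply (is_derive_mult (fun x => Rpower x s) (fun x => exp (- x)) x).
    - apply Rpower_derive, Hx.
    - auto_derive; [trivial | ring].
    - intros; apply Rmult_comm. }
  assert (I0 : is_RInt_gen (Derive (fun x => Rpower x s * exp (- x))) (at_right 0) (Rbar_locally p_infty) (0 - 0)).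
  { apply is_RInt_gen_Derive.
    - apply filter_prod_pos; simpl; intros a b Ha Hb Hab x Hx. rewrite Rmin_left in Hx by lra.
      eexists; apply D; lra.
    - apply filter_prod_pos; simpl; intros a b Ha Hb Hab x Hx. rewrite Rmin_left in Hx by lra.
      apply continuous_ext_loc with (fun x => s * gamma_density s x - gamma_density (s + 1) x).
      + assert (Hx0 : 0 < x) by lra. exists (mkposreal x Hx0). intros y Hy.
        symmetry; apply is_derive_unique, D.
        unfold ball in Hy; simpl in Hy; unfold AbsRing_ball, abs, minus, plus, opp in Hy; simpl in Hy.
        apply Rabs_lt_between in Hy; lra.
      + apply cont_sub; [apply cont_mul; [cont|]|]; apply gamma_density_cont; lra.
    - replace 0 with (0 * exp (- 0)) at 2 by ring.
      apply (filterlim_comp_2 (F := at_right 0) (G := locally 0) (H := locally (exp (- 0)))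
        (fun x => Rpower x s) (fun x => exp (- x)) Rmult); [apply Rpower_0_lim, Hs | |].
      + intros P HP. apply filter_le_within. revert P HP. change (continuous (fun x => exp (- x)) 0). cont.
      + apply (filterlim_mult (K := R_AbsRing) 0 (exp (- 0))).
    - apply gamma_boundary_infty. }
  assert (I1 : is_RInt_gen (fun x => s * gamma_density s x - gamma_density (s + 1) x) (at_right 0) (Rbar_locally p_infty) (0 - 0)).
  { revert I0; apply is_RInt_gen_ext_pos. intros x Hx; apply is_derive_unique, D, Hx. }
  assert (I2 : is_RInt_gen (fun x => s * gamma_density s x - gamma_density (s + 1) x) (at_right 0) (Rbar_locally p_infty)
    (s * Gamma s - Gamma (s + 1))).
  { apply (is_RInt_gen_minus (V := R_NormedModule) (fun x => s * gamma_density s x) (gamma_density (s + 1))).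
    - apply (is_RInt_gen_scal (V := R_NormedModule)), Gamma_integral, Hs.
    - apply Gamma_integral; lra. }
  assert (U1 := is_RInt_gen_unique (V := R_CompleteNormedModule) _ _ I1).
  assert (U2 := is_RInt_gen_unique (V := R_CompleteNormedModule) _ _ I2).
  rewrite U1 in U2. lra.
Qed.

Lemma Gamma_1 : Gamma 1 = 1.
Proof.
  apply (eq_trans (y := RInt_gen (gamma_density 1) (at_right 0) (Rbar_locally p_infty))); [reflexivity|].
  apply (is_RInt_gen_unique (V := R_CompleteNormedModule) (gamma_density 1) 1).
  apply is_RInt_gen_ext_pos with (Derive (fun x => - exp (- x))).
  - intros x Hx. unfold gamma_density. replace (1 - 1) with 0 by ring. rewrite Rpower_O by exact Hx.
    apply is_derive_unique. auto_derive; [trivial | ring].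
  - replace 1 with (0 - - exp (- 0)) by (rewrite Ropp_0, exp_0; ring).
    apply is_RInt_gen_Derive.
    + apply filter_prod_pos; simpl; intros. auto_derive; trivial.
    + apply filter_prod_pos; simpl; intros a b Ha Hb Hab x Hx.
      apply continuous_ext with (fun x => exp (- x)); [| cont].
      intros y; symmetry; apply is_derive_unique. auto_derive; [trivial | ring].
    + intros P HP. apply filter_le_within. revert P HP. change (continuous (fun x => - exp (- x)) 0). cont.
    + assert (L := is_lim_moderate_exp (fun _ => -1) ltac:(moderate)).
      revert L; apply (is_lim_ext (fun B => -1 * exp (- B)) (fun x => - exp (- x))). intros; ring.
Qed.

(** Weighted arithmetic-geometric mean inequality, from the tangent of [exp] at 0 taken at the
    points [- q ln u] and [(1 - q) ln u]. *)
Lemma Rpower_young u q : 0 < u -> 0 < q < 1 -> Rpower u q <= 1 - q + q * u.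
Proof.
  intros Hu Hq. unfold Rpower. set (L := ln u).
  replace u with (exp L) by (apply exp_ln, Hu).
  assert (H1 := exp_ineq1_le (- (q * L))). assert (H2 := exp_ineq1_le ((1 - q) * L)).
  assert (P := exp_pos (q * L)).
  assert (1 <= (1 - q) * exp (- (q * L)) + q * exp ((1 - q) * L)) by nra.
  replace (exp L) with (exp (q * L) * exp ((1 - q) * L)) by (rewrite <- exp_plus; f_equal; ring).
  replace (1 - q) with ((1 - q) * (exp (q * L) * exp (- (q * L)))) at 1
    by (rewrite <- exp_plus, Rplus_opp_r, exp_0; ring).
  nra.
Qed.

(** Wendel's inequality: integrate [Rpower_young] at [u = x / s] against the Gamma density. With
    this scaling, [Gamma (s + 1) = s Gamma s] makes the right side collapse to one term. *)
Lemma Gamma_add_le s q : 0 < s -> 0 < q < 1 -> Gamma (s + q) <= Rpower s q * Gamma s.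
Proof.
  intros Hs Hq.
  replace (Rpower s q * Gamma s) with (Rpower s q * (1 - q) * Gamma s + Rpower s q * q / s * Gamma (s + 1))
    by (rewrite Gamma_succ by assumption; field; lra).
  apply is_RInt_gen_pos_le with (gamma_density (s + q))
    (fun x => Rpower s q * (1 - q) * gamma_density s x + Rpower s q * q / s * gamma_density (s + 1) x).
  - intros x Hx. unfold gamma_density. replace (s + 1 - 1) with (s - 1 + 1) by ring.
    replace (s + q - 1) with (s - 1 + q) by ring. rewrite !Rpower_plus, Rpower_1 by exact Hx.
    split.
    + repeat apply Rmult_le_pos; left; apply Rpower_pos || apply exp_pos.
    + assert (Y := Rpower_young (x / s) q ltac:(apply Rdiv_lt_0_compat; lra) Hq).
      assert (E : Rpower x q = Rpower s q * Rpower (x / s) q).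
      { rewrite Rpower_mult_distr by (try apply Rdiv_lt_0_compat; lra). f_equal. field. lra. }
      rewrite E.
      replace (Rpower s q * (1 - q) * (Rpower x (s - 1) * exp (- x)) + Rpower s q * q / s * (Rpower x (s - 1) * x * exp (- x)))
        with (Rpower x (s - 1) * exp (- x) * Rpower s q * (1 - q + q * (x / s))) by (field; lra).
      replace (Rpower x (s - 1) * (Rpower s q * Rpower (x / s) q) * exp (- x))
        with (Rpower x (s - 1) * exp (- x) * Rpower s q * Rpower (x / s) q) by ring.
      apply Rmult_le_compat_l; [|exact Y].
      repeat apply Rmult_le_pos; left; apply Rpower_pos || apply exp_pos.
  - apply Gamma_integral; lra.
  - apply (is_RInt_gen_plus (V := R_NormedModule) (fun x => Rpower s q * (1 - q) * gamma_density s x)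
      (fun x => Rpower s q * q / s * gamma_density (s + 1) x));
      refine (is_RInt_gen_scal (V := R_NormedModule) (gamma_density _) _ (Gamma _) (Gamma_integral _ _)); lra.
Qed.

Lemma Gamma_fact n : Gamma (INR (S n)) = INR (fact n).
Proof.
  induction n; [exact Gamma_1|].
  rewrite S_INR, Gamma_succ, IHn by apply lt_0_INR, Nat.lt_0_succ.
  rewrite <- mult_INR. reflexivity.
Qed.

Lemma Gamma_nonneg s : 0 < s -> 0 <= Gamma s.
Proof.
  intros Hs. apply is_RInt_gen_pos_le with (fun x => 0 * gamma_density s x) (gamma_density s).
  - intros x _. assert (0 <= gamma_density s x) by (apply Rmult_le_pos; left; apply Rpower_pos || apply exp_pos). lra.
  - assert (H := is_RInt_gen_scal (V := R_NormedModule) _ 0 _ (Gamma_integral s Hs)).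
    unfold scal in H; simpl in H; unfold mult in H; simpl in H. rewrite Rmult_0_l in H. exact H.
  - apply Gamma_integral, Hs.
Qed.

(** Unfolding both Gamma factors yields [j + q] for [j <= n] and [j - q] for [j <= n + 1]. The extra
    factor [n + 1 + q] completes the pairs [j^2 - q^2]. *)
Lemma Gamma_shift_product q n : 0 < q < 1 ->
  Gamma (INR (S n) + q) * Gamma (INR (S n) + (1 - q)) * (INR (S n) + q)
  = q * Gamma q * Gamma (1 - q) * sine_product q (S n) * INR (S n) ^ 2 * INR (fact n) ^ 2.
Proof.
  intros Hq. induction n.
  - change (sine_product q 1) with (1 * (1 - q ^ 2 / INR 1 ^ 2)). change (INR (fact 0)) with 1. change (INR 1) with 1.
    rewrite (Rplus_comm 1 q), (Rplus_comm 1 (1 - q)), !Gamma_succ by lra. field.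
  - rewrite (S_INR (S n)).
    replace (INR (S n) + 1 + q) with (INR (S n) + q + 1) by ring.
    replace (INR (S n) + 1 + (1 - q)) with (INR (S n) + (1 - q) + 1) by ring.
    assert (N : 0 < INR (S n)) by apply lt_0_INR, Nat.lt_0_succ.
    rewrite !(Gamma_succ (INR (S n) + _)) by lra.
    change (sine_product q (S (S n))) with (sine_product q (S n) * (1 - q ^ 2 / INR (S (S n)) ^ 2)).
    rewrite fact_simpl, mult_INR, (S_INR (S n)).
    set (m := INR (S n)) in *.
    transitivity ((m + (1 - q)) * (m + q + 1) * (Gamma (m + q) * Gamma (m + (1 - q)) * (m + q))); [ring|].
    rewrite IHn. field. lra.
Qed.

Lemma Gamma_reflection q : 0 < q < 1 -> Gamma q * Gamma (1 - q) * (sin (q * PI) / PI) = 1.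
Proof.
  intros Hq. assert (HP := PI_RGT_0).
  set (X := Gamma q * Gamma (1 - q) * (sin (q * PI) / PI)).
  (* The middle term is a product of two factors. [Gamma_add_le], used in both directions, places
     the normalised product of shifted Gamma values in [[1 - 1/(n+2), 1]]; the remainder of the sine
     product lies in [[1 - 2/(2n+1), 1]]. For [n >= 1] both lower bounds are positive and
     multiply. *)
  assert (HX : forall n, (1 <= n)%nat -> (1 - / (INR n + 2)) * (1 - 2 / (2 * INR n + 1)) <= X * ((INR n + 1) / (INR n + 1 + q)) <= 1).
  { intros n Hn. apply (le_INR 1) in Hn. change (INR 1) with 1 in Hn. destruct (sine_product_bounds q n Hq) as [r [Hr Br]].
    assert (G := Gamma_shift_product q n Hq). assert (N := pos_INR n).
    assert (U1 := Gamma_add_le (INR (S n)) q ltac:(rewrite S_INR; lra) Hq).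
    assert (U2 := Gamma_add_le (INR (S n)) (1 - q) ltac:(rewrite S_INR; lra) ltac:(lra)).
    assert (L1 := Gamma_add_le (INR (S n) + q) (1 - q) ltac:(rewrite S_INR; lra) ltac:(lra)).
    assert (L2 := Gamma_add_le (INR (S n) + (1 - q)) q ltac:(rewrite S_INR; lra) Hq).
    replace (INR (S n) + q + (1 - q)) with (INR (S n) + 1) in L1 by ring.
    replace (INR (S n) + (1 - q) + q) with (INR (S n) + 1) in L2 by ring.
    rewrite Gamma_succ in L1, L2 by (rewrite S_INR; lra).
    assert (N1 := Gamma_nonneg (INR (S n) + q) ltac:(rewrite S_INR; lra)).
    assert (N2 := Gamma_nonneg (INR (S n) + (1 - q)) ltac:(rewrite S_INR; lra)).
    rewrite Gamma_fact in U1, U2, L1, L2. assert (F := INR_fact_lt_0 n).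
    set (A := Gamma (INR (S n) + q)) in *. set (B := Gamma (INR (S n) + (1 - q))) in *.
    set (f := INR (fact n)) in *.
    assert (UP : A * B <= INR (S n) * (f * f)).
    { replace (INR (S n) * (f * f)) with ((Rpower (INR (S n)) q * f) * (Rpower (INR (S n)) (1 - q) * f)).
      - apply Rmult_le_compat; assumption.
      - transitivity (Rpower (INR (S n)) q * Rpower (INR (S n)) (1 - q) * (f * f)); [ring|].
        rewrite <- Rpower_plus. replace (q + (1 - q)) with 1 by ring. rewrite Rpower_1; [reflexivity | rewrite S_INR; lra]. }
    assert (LOW : INR (S n) * INR (S n) * (f * f) <= (INR (S n) + 1) * (A * B)).
    { apply Rle_trans with ((Rpower (INR (S n) + 1) (1 - q) * A) * (Rpower (INR (S n) + 1) q * B)).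
      - replace (INR (S n) * INR (S n) * (f * f)) with ((INR (S n) * f) * (INR (S n) * f)) by ring.
        assert (0 <= INR (S n) * f) by (apply Rmult_le_pos; [apply pos_INR | lra]).
        apply Rmult_le_compat; try assumption.
        + eapply Rle_trans; [exact L1|]. apply Rmult_le_compat_r; [assumption|].
          apply Rle_Rpower_l; [lra | rewrite S_INR; lra].
        + eapply Rle_trans; [exact L2|]. apply Rmult_le_compat_r; [assumption|].
          apply Rle_Rpower_l; [lra | rewrite S_INR; lra].
      - apply Req_le.
        transitivity (Rpower (INR (S n) + 1) (1 - q) * Rpower (INR (S n) + 1) q * (A * B)); [ring|].
        rewrite <- Rpower_plus. replace (1 - q + q) with 1 by ring. rewrite Rpower_1; [ring | rewrite S_INR; lra]. }
    assert (EX : X * ((INR n + 1) / (INR n + 1 + q)) = A * B / (INR (S n) * (f * f)) * r).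
    { unfold X. replace (sin (q * PI) / PI) with (q * (sine_product q (S n) * r)).
      - assert (EAB : A * B = q * Gamma q * Gamma (1 - q) * sine_product q (S n) * INR (S n) ^ 2 * f ^ 2 / (INR (S n) + q)).
        { rewrite <- G. rewrite S_INR. field. lra. }
        rewrite EAB, S_INR. field. lra.
      - rewrite Hr, (Rmult_comm PI q). field. lra. }
    rewrite EX. rewrite S_INR in *.
    assert (Q1 : A * B / ((INR n + 1) * (f * f)) <= 1).
    { apply Rmult_le_reg_r with ((INR n + 1) * (f * f)); [nra|].
      unfold Rdiv. rewrite Rmult_assoc, Rinv_l by nra. lra. }
    assert (Q2 : 1 - / (INR n + 2) <= A * B / ((INR n + 1) * (f * f))).
    { apply Rmult_le_reg_r with ((INR n + 1) * (f * f)); [nra|].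
      unfold Rdiv. rewrite Rmult_assoc, Rinv_l, Rmult_1_r by nra.
      apply Rmult_le_reg_l with (INR n + 2); [lra|].
      replace ((INR n + 2) * ((1 - / (INR n + 2)) * ((INR n + 1) * (f * f)))) with ((INR n + 1) * (INR n + 1) * (f * f)) by (field; lra).
      lra. }
    set (t := A * B / ((INR n + 1) * (f * f))) in *.
    assert (I2 : 0 <= / (INR n + 2) <= 1).
    { split; [left; apply Rinv_0_lt_compat; lra|]. rewrite <- Rinv_1. apply Rinv_le_contravar; lra. }
    assert (D : 0 < 1 - 2 / (2 * INR n + 1)).
    { apply Rlt_0_minus. apply Rmult_lt_reg_r with (2 * INR n + 1); [lra|].
      unfold Rdiv. rewrite Rmult_assoc, Rinv_l; lra. }
    split; [apply Rmult_le_compat; lra | nra]. }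
  (* [X] does not depend on [n] and is within [3 / n] of 1 for every [n], so it equals 1. *)
  assert (HB : forall n, (1 <= n)%nat -> INR n * Rabs (X - 1) <= 3).
  { intros n Hn. specialize (HX n Hn). apply (le_INR 1) in Hn. change (INR 1) with 1 in Hn.
    set (m := INR n) in *.
    assert (E : X = X * ((m + 1) / (m + 1 + q)) * (1 + q / (m + 1))) by (field; lra).
    set (Z := X * ((m + 1) / (m + 1 + q))) in *.
    assert (Q : 0 <= q / (m + 1) <= / m).
    { split; [apply Rlt_le, Rdiv_lt_0_compat; lra|].
      apply Rmult_le_reg_r with (m * (m + 1)); [nra|].
      replace (q / (m + 1) * (m * (m + 1))) with (q * m) by (field; lra).
      replace (/ m * (m * (m + 1))) with (m + 1) by (field; lra). nra. }
    assert (I1 : / (m + 2) <= / m) by (apply Rinv_le_contravar; lra).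
    assert (I2 : 2 / (2 * m + 1) <= / m).
    { apply Rmult_le_reg_r with (m * (2 * m + 1)); [nra|].
      replace (2 / (2 * m + 1) * (m * (2 * m + 1))) with (2 * m) by (field; lra).
      replace (/ m * (m * (2 * m + 1))) with (2 * m + 1) by (field; lra). lra. }
    assert (I3 : 0 < / (m + 2)) by (apply Rinv_0_lt_compat; lra).
    assert (I4 : 0 < 2 / (2 * m + 1)) by (apply Rdiv_lt_0_compat; lra).
    assert (I5 : 0 < / m <= 1) by (split; [apply Rinv_0_lt_compat; lra | rewrite <- Rinv_1; apply Rinv_le_contravar; lra]).
    assert (Z1 : 1 - 2 * / m <= Z) by nra.
    assert (Z0 : 0 <= Z).
    { apply Rle_trans with ((1 - / (m + 2)) * (1 - 2 / (2 * m + 1))); [|lra].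
      apply Rmult_le_pos; lra. }
    assert (HA : Rabs (X - 1) <= 3 * / m).
    { apply Rabs_le. rewrite E. split; nra. }
    apply Rle_trans with (m * (3 * / m)); [apply Rmult_le_compat_l; lra|]. apply Req_le; field; lra. }
  apply Classical_Prop.NNPP; intros Hn.
  assert (Hp : 0 < Rabs (X - 1)) by (apply Rabs_pos_lt; lra).
  destruct (INR_archimed (Rabs (X - 1)) 3 Hp) as [n Hn3].
  specialize (HB (S n) ltac:(lia)). rewrite S_INR in HB. nra.
Qed.

(** * The diffusive kernel *)

(* [(v d/dv)^j] applied to [v^k exp(-v)]. *)
Fixpoint euler_exp (j k : nat) (v : R) : R :=
  match j with
  | O => v ^ k * exp (- v)
  | S i => INR k * euler_exp i k v - euler_exp i (S k) v
  end.

Fixpoint euler_exp_bound (j k : nat) : R :=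
  match j with
  | O => INR (fact k)
  | S i => INR k * euler_exp_bound i k + euler_exp_bound i (S k)
  end.

(** Rests on [v^k exp(-v) <= k!]. No upper bound on [v] enters, and later [v = s exp(b x)], so the
    estimates are uniform in [s] and [x] at once. *)
Lemma euler_exp_le j : forall k v, 0 <= v -> Rabs (euler_exp j k v) <= euler_exp_bound j k.
Proof.
  induction j; intros k v Hv.
  - simpl euler_exp; simpl euler_exp_bound.
    assert (0 < exp (- v)) by apply exp_pos. assert (0 <= v ^ k) by (apply pow_le, Hv).
    rewrite Rabs_right by (apply Rle_ge, Rmult_le_pos; lra).
    assert (P := pow_le_exp v k Hv).
    apply Rle_trans with (INR (fact k) * exp v * exp (- v)); [apply Rmult_le_compat_r; lra|].
    rewrite Rmult_assoc, <- exp_plus, Rplus_opp_r, exp_0; lra.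
  - change (Rabs (INR k * euler_exp j k v - euler_exp j (S k) v) <= INR k * euler_exp_bound j k + euler_exp_bound j (S k)).
    eapply Rle_trans; [apply Rabs_triang|]. rewrite Rabs_Ropp, Rabs_mult, (Rabs_right (INR k)) by (apply Rle_ge, pos_INR).
    apply Rplus_le_compat; [apply Rmult_le_compat_l; [apply pos_INR|]|]; auto.
Qed.

Lemma euler_exp_derive s b j : forall k x,
  is_derive (fun x => euler_exp j k (s * exp (b * x))) x (b * euler_exp (S j) k (s * exp (b * x))).
Proof.
  induction j; intros k x.
  - simpl euler_exp. auto_derive; [trivial|].
    destruct k; [simpl; ring|]. simpl pred. rewrite <- !tech_pow_Rmult. ring.
  - change (is_derive (fun x => INR k * euler_exp j k (s * exp (b * x)) - euler_exp j (S k) (s * exp (b * x))) x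
      (b * (INR k * euler_exp (S j) k (s * exp (b * x)) - euler_exp (S j) (S k) (s * exp (b * x))))).
    replace (b * (INR k * euler_exp (S j) k (s * exp (b * x)) - euler_exp (S j) (S k) (s * exp (b * x))))
      with (INR k * (b * euler_exp (S j) k (s * exp (b * x))) - b * euler_exp (S j) (S k) (s * exp (b * x))) by ring.
    apply (is_derive_minus (V := R_NormedModule) (fun x => INR k * euler_exp j k (s * exp (b * x))));
      [apply is_derive_scal|]; apply IHj.
Qed.

Lemma euler_exp_cont j : forall k v, continuous (euler_exp j k) v.
Proof.
  induction j; intros k v.
  - change (continuous (fun v => v ^ k * exp (- v)) v). cont.
  - change (continuous (fun v => INR k * euler_exp j k v - euler_exp j (S k) v) v).
    apply cont_sub; [apply cont_mul; [cont | apply IHj] | apply IHj].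
Qed.

(** Derivative of order [j] in [x] of [exp(- s exp(b x))]: under [v = s exp(b x)], [d/dx] becomes
    [b v d/dv]. *)
Definition decay (s b : R) (j : nat) (x : R) : R := b ^ j * euler_exp j 0 (s * exp (b * x)).

Lemma decay_smooth s b : smooth (decay s b).
Proof.
  intros j x. unfold decay.
  replace (b ^ S j * euler_exp (S j) 0 (s * exp (b * x))) with (b ^ j * (b * euler_exp (S j) 0 (s * exp (b * x)))) by (simpl; ring).
  apply is_derive_scal, euler_exp_derive.
Qed.

Lemma decay_bound s b j x : 0 <= s -> Rabs (decay s b j x) <= Rabs b ^ j * euler_exp_bound j 0.
Proof.
  intros Hs. unfold decay. rewrite Rabs_mult, <- RPow_abs. apply Rmult_le_compat_l; [apply pow_le, Rabs_pos|].
  apply euler_exp_le, Rmult_le_pos; [assumption | left; apply exp_pos].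
Qed.

(** Derivatives of [(1 - exp(-v)) / v] with [v = s exp(b x)]. Written as an average of [decay], the
    quotient makes sense at [s = 0] and obeys the same bounds. *)
Definition mean_decay (s b : R) (j : nat) (x : R) : R := RInt (fun u => decay (u * s) b j x) 0 1.

Lemma decay_continuity_2d s b j x u : continuity_2d_pt (fun x u => decay (u * s) b j x) x u.
Proof.
  unfold decay. apply continuity_2d_pt_mult; [apply continuity_2d_pt_const|].
  apply (continuity_1d_2d_pt_comp (euler_exp j 0) (fun x u => u * s * exp (b * x))).
  - apply continuity_pt_filterlim, euler_exp_cont.
  - apply continuity_2d_pt_mult.
    + apply continuity_2d_pt_mult; [apply continuity_2d_pt_id2 | apply continuity_2d_pt_const].
    + apply (continuity_1d_2d_pt_comp (fun x => exp (b * x)) (fun x u => x)).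
      * apply continuity_pt_filterlim. change (continuous (fun x => exp (b * x)) x). cont.
      * apply continuity_2d_pt_id1.
Qed.

Lemma mean_decay_smooth s b : smooth (mean_decay s b).
Proof.
  apply (average_smooth (fun u j x => decay (u * s) b j x)).
  - intros u; apply decay_smooth.
  - intros; apply decay_continuity_2d.
Qed.

Lemma mean_decay_bound s b j x : 0 <= s -> Rabs (mean_decay s b j x) <= Rabs b ^ j * euler_exp_bound j 0.
Proof.
  intros Hs. apply average_bound.
  - intros u. apply (continuity_2d_continuous_snd (fun x u => decay (u * s) b j x)), decay_continuity_2d.
  - intros u Hu. apply decay_bound. nra.
Qed.

Lemma mean_decay_0 s b x : s * mean_decay s b 0 x = exp (- (b * x)) * (1 - exp (- (s * exp (b * x)))).
Proof.
  unfold mean_decay, decay.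
  rewrite <- rint_scal.
  - rewrite (RInt_FTC (fun u => - exp (- (b * x)) * exp (- (u * s * exp (b * x))))).
    + rewrite !Rmult_0_l, Ropp_0, exp_0, Rmult_1_l. ring.
    + intros u. auto_derive; [trivial|]. simpl.
      transitivity (exp (- (b * x)) * exp (b * x) * s * exp (- (u * s * exp (b * x)))); [ring|].
      rewrite <- exp_plus, Rplus_opp_l, exp_0. ring.
    + intros u. simpl. cont.
  - apply ex_RInt_cont; intros u. simpl. cont.
Qed.

Section Kernel.
Variable q : R.
Hypothesis Hq : 0 < q < 1.

Let c := sin (q * PI) / PI.

(** Derivative of order [j] of [H_s], the exact counterpart of [phihat] at elapsed time [s] for
    constant data 1. In the first half [exp(x/q)] is compensated by [1 - exp(-v)], which
    [mean_decay] makes visible. *)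
Definition kernel (s : R) (j : nat) (x : R) : R :=
  c * (/ q * (s * mean_decay s (- / q) j x)
       + / (1 - q) * ((match j with O => 1 | _ => 0 end) - decay s (/ (1 - q)) j x)).

Lemma kernel_smooth s : smooth (kernel s).
Proof.
  intros j x. unfold kernel. apply is_derive_scal.
  apply (is_derive_plus (V := R_NormedModule) (fun x => / q * (s * mean_decay s (- / q) j x))).
  - apply is_derive_scal, is_derive_scal, mean_decay_smooth.
  - apply is_derive_scal.
    apply (is_derive_minus (V := R_NormedModule) (fun _ => match j with O => 1 | _ => 0 end)).
    + apply (is_derive_const (V := R_NormedModule)).
    + apply decay_smooth.
Qed.

Definition kernel_bound (T : R) (j : nat) : R :=
  Rabs c * (/ q * (T * (Rabs (- / q) ^ j * euler_exp_bound j 0))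
            + / (1 - q) * (1 + Rabs (/ (1 - q)) ^ j * euler_exp_bound j 0)).

Lemma kernel_le T s j x : 0 <= s <= T -> Rabs (kernel s j x) <= kernel_bound T j.
Proof.
  intros Hs. unfold kernel, kernel_bound. rewrite Rabs_mult. apply Rmult_le_compat_l; [apply Rabs_pos|].
  assert (I1 : 0 < / q) by (apply Rinv_0_lt_compat; lra). assert (I2 : 0 < / (1 - q)) by (apply Rinv_0_lt_compat; lra).
  assert (B1 := mean_decay_bound s (- / q) j x ltac:(lra)). assert (B2 := decay_bound s (/ (1 - q)) j x ltac:(lra)).
  eapply Rle_trans; [apply Rabs_triang|]. rewrite !Rabs_mult. rewrite (Rabs_right (/ q)), (Rabs_right s) by lra.
  rewrite (Rabs_right (/ (1 - q))) at 1 by lra.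
  apply Rplus_le_compat; (apply Rmult_le_compat_l; [lra|]).
  - apply Rmult_le_compat; [lra | apply Rabs_pos | lra | exact B1].
  - eapply Rle_trans; [apply Rabs_triang|]. rewrite Rabs_Ropp. apply Rplus_le_compat; [|exact B2].
    destruct j; [rewrite Rabs_R1 | rewrite Rabs_R0]; lra.
Qed.

Lemma kernel_0 s x : kernel s 0 x =
  c * (/ q * (exp (x / q) * (1 - exp (- (s * exp (- x / q))))) + / (1 - q) * (1 - exp (- (s * exp (x / (1 - q)))))).
Proof.
  unfold kernel. rewrite mean_decay_0. unfold decay. simpl.
  replace (- (- / q * x)) with (x / q) by (field; lra). replace (- / q * x) with (- x / q) by (field; lra).
  replace (/ (1 - q) * x) with (x / (1 - q)) by (field; lra). ring.
Qed.

Definition abel_kernel (s : R) : R := Rpower s (1 - q) / ((1 - q) * Gamma (1 - q)).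

(** The substitution [v = s exp(w)] maps the two half lines [w = -x/q] and [w = x/(1-q)], cut at
    [x = B], to this interval, which exhausts the positive axis. *)
Lemma Gamma_partial_lim s : 0 < s ->
  is_lim (fun B => RInt (gamma_density q) (s * exp (- B / q)) (s * exp (B / (1 - q)))) p_infty (Gamma q).
Proof.
  intros Hs P HP. destruct (Gamma_integral q ltac:(lra) P HP) as [Q U HQ HU H].
  destruct HQ as [[d Hd] HQ]. destruct HU as [M HU].
  exists (Rmax (q * (s / d)) ((1 - q) * (M / s))). intros B HB.
  assert (HB1 : q * (s / d) < B) by (eapply Rle_lt_trans; [apply Rmax_l | exact HB]).
  assert (HB2 : (1 - q) * (M / s) < B) by (eapply Rle_lt_trans; [apply Rmax_r | exact HB]).
  assert (E1 : 0 < s * exp (- B / q)) by (apply Rmult_lt_0_compat; [assumption | apply exp_pos]).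
  destruct (H (s * exp (- B / q)) (s * exp (B / (1 - q)))) as [y [Hy HPy]].
  - apply HQ; [|exact E1]. unfold ball; simpl; unfold AbsRing_ball, abs, minus, plus, opp; simpl.
    rewrite Ropp_0, Rplus_0_r, Rabs_right by lra.
    replace (- B / q) with (- (B / q)) by (field; lra). rewrite exp_Ropp.
    assert (X : s / d < exp (B / q)).
    { apply Rlt_trans with (B / q).
      - apply Rmult_lt_reg_l with q; [lra|]. replace (q * (B / q)) with B by (field; lra). exact HB1.
      - assert (Q1 := exp_ineq1_le (B / q)). lra. }
    assert (X0 := exp_pos (B / q)).
    apply Rmult_lt_reg_r with (exp (B / q)); [exact X0|]. rewrite Rmult_assoc, Rinv_l, Rmult_1_r by lra.
    apply Rmult_lt_reg_l with (/ d); [apply Rinv_0_lt_compat, Hd|].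
    replace (/ d * (d * exp (B / q))) with (exp (B / q)) by (field; lra). unfold Rdiv in X; lra.
  - apply HU. apply Rmult_lt_reg_l with (/ s); [apply Rinv_0_lt_compat, Hs|].
    replace (/ s * (s * exp (B / (1 - q)))) with (exp (B / (1 - q))) by (field; lra).
    apply Rlt_trans with (B / (1 - q)).
    + apply Rmult_lt_reg_l with (1 - q); [lra|]. replace ((1 - q) * (B / (1 - q))) with B by (field; lra).
      unfold Rdiv in HB2; lra.
    + assert (Q1 := exp_ineq1_le (B / (1 - q))). lra.
  - simpl in Hy. rewrite (is_RInt_unique _ _ _ _ Hy). exact HPy.
Qed.

Lemma is_lim_exp_neg_squeeze f C : (forall B, 0 <= B -> 0 <= f B <= C * exp (- B)) -> is_lim f p_infty 0.
Proof.
  intros H. apply is_lim_le_le_loc with (fun _ => 0) (fun B => C * exp (- B)).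
  - exists 0; intros B HB; apply H; lra.
  - apply is_lim_const.
  - apply (is_lim_moderate_exp (fun _ => C)). moderate.
Qed.

Lemma kernel_moderate s j : 0 <= s -> moderate (kernel s j).
Proof.
  intros Hs. apply (bounded_moderate (kernel s) (kernel_bound s) 0 (kernel_smooth s)).
  intros i x _. simpl. rewrite Rmult_1_r. apply kernel_le; lra.
Qed.

(** Integration by parts in each half leaves the same density [v^(q-1) exp(-v)], and the halves join
    into one Gamma integral. The factor [c Gamma q] becomes [1 / Gamma (1 - q)] by reflection. *)
Lemma kernel_integral s : 0 < s -> LInt (kernel s 0) = abel_kernel s.
Proof.
  intros Hs. apply LInt_unique.
  set (U := fun B => s * exp (B / (1 - q))). set (V := fun B => s * exp (- B / q)).
  assert (HU : forall B, 0 < U B) by (intros; apply Rmult_lt_0_compat; [assumption | apply exp_pos]).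
  assert (HV : forall B, 0 < V B) by (intros; apply Rmult_lt_0_compat; [assumption | apply exp_pos]).
  set (g := fun z => RInt (gamma_density q) s z).
  assert (Dg : forall z, 0 < z -> is_derive g z (gamma_density q z)).
  { intros z Hz. apply (is_derive_RInt (V := R_NormedModule) (gamma_density q) g s z).
    - exists (mkposreal z Hz). intros y Hy.
      unfold ball in Hy; simpl in Hy; unfold AbsRing_ball, abs, minus, plus, opp in Hy; simpl in Hy.
      apply Rabs_lt_between in Hy. apply (RInt_correct (V := R_CompleteNormedModule)), ex_RInt_pos; [apply gamma_density_cont | |]; lra.
    - apply gamma_density_cont, Hz. }
  (* The first two terms are boundary terms of size [O(exp(-B))]. The base point of [g] is
     immaterial, and [U 0 = V 0] gives [Phi 0 = 0]. *)
  set (Phi := fun B => c / (1 - q) * (exp (B / q - B) * (1 - exp (- V B)) - exp (- B) * (1 - exp (- U B))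
     + Rpower s (1 - q) * (g (U B) - g (V B)))).
  assert (E : forall B, RInt (fun x => kernel s 0 x * exp (- x)) 0 B = Phi B).
  { intros B. replace (Phi B) with (Phi B - Phi 0).
    - apply RInt_FTC.
      + intros x. unfold Phi.
        assert (DU : is_derive U x (U x / (1 - q))) by (unfold U, Rdiv; auto_derive; [trivial | ring]).
        assert (DV : is_derive V x (- V x / q)) by (unfold V, Rdiv; auto_derive; [trivial | ring]).
        assert (DgU := is_derive_comp (V := R_NormedModule) g U x _ _ (Dg _ (HU x)) DU).
        assert (DgV := is_derive_comp (V := R_NormedModule) g V x _ _ (Dg _ (HV x)) DV).
        unfold scal in DgU, DgV; simpl in DgU, DgV; unfold mult in DgU, DgV; simpl in DgU, DgV.
        set (gU := fun x => g (U x)) in *. set (gV := fun x => g (V x)) in *.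
        change (is_derive (fun B => c / (1 - q) * (exp (B / q - B) * (1 - exp (- V B)) - exp (- B) * (1 - exp (- U B))
          + Rpower s (1 - q) * (gU B - gV B))) x (kernel s 0 x * exp (- x))).
        assert (XU : ex_derive U x) by (eexists; exact DU). assert (XV : ex_derive V x) by (eexists; exact DV).
        assert (XgU : ex_derive gU x) by (eexists; exact DgU). assert (XgV : ex_derive gV x) by (eexists; exact DgV).
        assert (YU : Derive (fun x : R => U x) x = U x / (1 - q)) by (apply is_derive_unique, DU).
        assert (YV : Derive (fun x : R => V x) x = - V x / q) by (apply is_derive_unique, DV).
        assert (YgU : Derive (fun x : R => gU x) x = U x / (1 - q) * gamma_density q (U x)) by (apply is_derive_unique, DgU).
        assert (YgV : Derive (fun x : R => gV x) x = - V x / q * gamma_density q (V x)) by (apply is_derive_unique, DgV).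
        auto_derive; [repeat split; auto|]. rewrite YU, YV, YgU, YgV. change (x * / q + - x) with (x / q - x). clear YU YV YgU YgV XU XV XgU XgV DU DV DgU DgV.
        assert (PD : forall z, 0 < z -> z * gamma_density q z = Rpower z q * exp (- z)).
        { intros z Hz. unfold gamma_density. replace (Rpower z q) with (Rpower z (q - 1 + 1)) by (f_equal; ring).
          rewrite Rpower_plus, Rpower_1 by exact Hz. ring. }
        assert (PU : Rpower s (1 - q) * (U x / (1 - q) * gamma_density q (U x)) = exp (- x) * U x / (1 - q) * exp (- U x)).
        { replace (U x / (1 - q) * gamma_density q (U x)) with (/ (1 - q) * (U x * gamma_density q (U x))) by (field; lra).
          rewrite PD by apply HU. unfold U at 1. rewrite <- Rpower_mult_distr by (assumption || apply exp_pos).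
          transitivity (Rpower s (1 - q) * Rpower s q * Rpower (exp (x / (1 - q))) q * / (1 - q) * exp (- U x)); [ring|].
          rewrite <- Rpower_plus. replace (1 - q + q) with 1 by ring. rewrite Rpower_1 by exact Hs.
          unfold Rpower at 1. rewrite ln_exp.
          replace (exp (- x) * U x) with (s * (exp (- x) * exp (x / (1 - q)))) by (unfold U; ring).
          rewrite <- exp_plus. replace (- x + x / (1 - q)) with (q * (x / (1 - q))) by (field; lra). field; lra. }
        assert (PV : Rpower s (1 - q) * (V x / q * gamma_density q (V x)) = exp (- x) * s / q * exp (- V x)).
        { replace (V x / q * gamma_density q (V x)) with (/ q * (V x * gamma_density q (V x))) by (field; lra).
          rewrite PD by apply HV. unfold V at 1. rewrite <- Rpower_mult_distr by (assumption || apply exp_pos).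
          transitivity (Rpower s (1 - q) * Rpower s q * Rpower (exp (- x / q)) q * / q * exp (- V x)); [ring|].
          rewrite <- Rpower_plus. replace (1 - q + q) with 1 by ring. rewrite Rpower_1 by exact Hs.
          unfold Rpower at 1. rewrite ln_exp. replace (q * (- x / q)) with (- x) by (field; lra). field; lra. }
        assert (PE : exp (x / q - x) * V x = s * exp (- x)).
        { unfold V. transitivity (s * (exp (x / q - x) * exp (- x / q))); [ring|]. rewrite <- exp_plus. do 2 f_equal. field; lra. }
        rewrite kernel_0. fold (U x). fold (V x).
        replace (exp (x / q)) with (exp (x / q - x) * exp x) by (rewrite <- exp_plus; f_equal; ring).
        assert (PX : exp x * exp (- x) = 1) by (rewrite <- exp_plus, Rplus_opp_r, exp_0; reflexivity).
        set (a1 := exp (x / q - x)) in *. set (a2 := exp (- V x)) in *. set (a3 := exp (- U x)) in *.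
        set (e1 := exp x) in *. set (e2 := exp (- x)) in *.
        transitivity (c / (1 - q) * ((/ q - 1) * a1 * (1 - a2) - (a1 * V x) / q * a2 + e2 * (1 - a3) - e2 * U x / (1 - q) * a3
          + Rpower s (1 - q) * (U x / (1 - q) * gamma_density q (U x)) + Rpower s (1 - q) * (V x / q * gamma_density q (V x)))).
        * field; lra.
        * rewrite PU, PV, PE.
          transitivity (c * (/ q * (a1 * (1 - a2)) * (e1 * e2) + / (1 - q) * (1 - a3) * e2)); [rewrite PX; field; lra | ring].
      + intros x. destruct (kernel_moderate s 0 ltac:(lra)) as [Hc _]. apply cont_mul; [apply Hc | cont].
    - assert (P0 : Phi 0 = 0); [|lra]. unfold Phi, U, V. replace (0 / q - 0) with 0 by (field; lra).
      replace (0 / (1 - q)) with 0 by (field; lra). replace (- 0 / q) with 0 by (field; lra).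
      rewrite Ropp_0, exp_0. ring. }
  apply is_lim_ext with Phi; [intros; symmetry; apply E|]. unfold Phi.
  assert (G1 : Gamma (1 - q) <> 0).
  { intros H0. assert (HR := Gamma_reflection q Hq). rewrite H0 in HR. lra. }
  replace (abel_kernel s) with (c / (1 - q) * (0 - 0 + Rpower s (1 - q) * Gamma q)).
  2:{ unfold abel_kernel. assert (HR := Gamma_reflection q Hq). fold c in HR.
      replace (Rpower s (1 - q) / ((1 - q) * Gamma (1 - q)))
        with (Rpower s (1 - q) * (Gamma q * Gamma (1 - q) * c) / ((1 - q) * Gamma (1 - q))) by (rewrite HR; field; lra).
      field; lra. }
  apply (is_lim_scal_l _ (c / (1 - q)) p_infty (0 - 0 + Rpower s (1 - q) * Gamma q)).
  apply is_lim_plus'; [apply is_lim_minus'|].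
  - apply is_lim_exp_neg_squeeze with s. intros B HB.
    assert (X1 := exp_ineq1_le (- V B)). assert (X2 := HV B).
    assert (X3 : exp (- V B) <= 1) by (rewrite <- exp_0; apply exp_monotone; lra).
    assert (X4 := exp_pos (B / q - B)).
    assert (PE : exp (B / q - B) * V B = s * exp (- B)).
    { unfold V. transitivity (s * (exp (B / q - B) * exp (- B / q))); [ring|]. rewrite <- exp_plus. do 2 f_equal. field; lra. }
    rewrite <- PE. split; [apply Rmult_le_pos; lra | apply Rmult_le_compat_l; lra].
  - apply is_lim_exp_neg_squeeze with 1. intros B HB.
    assert (X2 := HU B). assert (X1 := exp_pos (- U B)).
    assert (X3 : exp (- U B) <= 1) by (rewrite <- exp_0; apply exp_monotone; lra).
    assert (X4 := exp_pos (- B)). split; [apply Rmult_le_pos; lra | nra].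
  - apply (is_lim_scal_l _ (Rpower s (1 - q)) p_infty (Gamma q)).
    apply is_lim_ext with (fun B => RInt (gamma_density q) (V B) (U B)); [| apply Gamma_partial_lim, Hs].
    intros B. unfold g.
    assert (Ch := RInt_Chasles (V := R_CompleteNormedModule) (gamma_density q) s (V B) (U B)
      ltac:(apply ex_RInt_pos; auto using gamma_density_cont) ltac:(apply ex_RInt_pos; auto using gamma_density_cont)).
    change (RInt (gamma_density q) s (V B) + RInt (gamma_density q) (V B) (U B) = RInt (gamma_density q) s (U B)) in Ch.
    lra.
Qed.

End Kernel.

Lemma ball_R (x e y : R) : ball x e y <-> Rabs (y - x) < e.
Proof. reflexivity. Qed.

(** * Extension of the data to the whole line *)

Definition clamp (a b t : R) : R := Rmax a (Rmin b t).

Lemma clamp_in a b t : a <= b -> a <= clamp a b t <= b.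
Proof. intros H; unfold clamp, Rmax, Rmin; repeat destruct Rle_dec; lra. Qed.
Lemma clamp_id a b t : a <= t <= b -> clamp a b t = t.
Proof. intros H; unfold clamp, Rmax, Rmin; repeat destruct Rle_dec; lra. Qed.
Lemma clamp_lipschitz a b t u : a <= b -> Rabs (clamp a b t - clamp a b u) <= Rabs (t - u).
Proof. intros H; unfold clamp, Rmax, Rmin; repeat destruct Rle_dec; unfold Rabs; repeat destruct Rcase_abs; lra. Qed.

Lemma clamp_continuous a b f t : a <= b ->
  (forall t, a <= t <= b -> continuous_within (fun s => a <= s <= b) f t) ->
  continuous (fun u => f (clamp a b u)) t.
Proof.
  intros Hab H P HP. destruct (H (clamp a b t) (clamp_in a b t Hab) P HP) as [d Hd].
  exists d; intros u Hu. apply Hd; [| apply clamp_in, Hab].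
  apply ball_R. apply ball_R in Hu. eapply Rle_lt_trans; [apply clamp_lipschitz, Hab | exact Hu].
Qed.

Lemma is_derive_within_continuous D f t l : is_derive_within D f t l -> continuous_within D f t.
Proof.
  intros H P [[e He] HP]; simpl in HP.
  destruct (H (fun v => Rabs (v - l) < 1)) as [[d Hd] H1].
  { exists (mkposreal 1 Rlt_0_1); intros v Hv; exact Hv. }
  assert (L : 0 < Rabs l + 1) by (assert (X := Rabs_pos l); lra).
  assert (Hm : 0 < Rmin d (e / (Rabs l + 1))) by (apply Rmin_glb_lt; [exact Hd | apply Rdiv_lt_0_compat; assumption]).
  exists (mkposreal _ Hm). intros s Hs Ds. apply HP. apply ball_R in Hs; simpl in Hs. apply ball_R; simpl.
  destruct (Req_dec s t) as [->|Hn]; [rewrite Rminus_eq_0, Rabs_R0; exact He|].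
  assert (S1 : Rabs (s - t) < d) by (eapply Rlt_le_trans; [exact Hs | apply Rmin_l]).
  assert (S2 : Rabs (s - t) < e / (Rabs l + 1)) by (eapply Rlt_le_trans; [exact Hs | apply Rmin_r]).
  specialize (H1 s S1 (conj Ds Hn)). cbv beta in H1.
  assert (Q : Rabs ((f s - f t) / (s - t)) < Rabs l + 1).
  { replace ((f s - f t) / (s - t)) with (((f s - f t) / (s - t) - l) + l) by ring.
    eapply Rle_lt_trans; [apply Rabs_triang|]. lra. }
  replace (f s - f t) with ((f s - f t) / (s - t) * (s - t)) by (field; lra).
  rewrite Rabs_mult. assert (X := Rabs_pos (s - t)).
  apply Rle_lt_trans with ((Rabs l + 1) * Rabs (s - t)); [apply Rmult_le_compat_r; lra|].
  apply Rmult_lt_reg_l with (/ (Rabs l + 1)); [apply Rinv_0_lt_compat, L|].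
  replace (/ (Rabs l + 1) * ((Rabs l + 1) * Rabs (s - t))) with (Rabs (s - t)) by (field; lra).
  unfold Rdiv in S2; lra.
Qed.

Lemma is_derive_within_clamp a b f t l : a < t < b -> is_derive_within (fun s => a <= s <= b) f t l ->
  is_derive (fun u => f (clamp a b u)) t l.
Proof.
  intros Ht H. apply is_derive_Reals. intros e He.
  destruct (H (fun v => Rabs (v - l) < e)) as [[d Hd] H1].
  { exists (mkposreal e He); intros v Hv; exact Hv. }
  assert (Hm : 0 < Rmin d (Rmin (t - a) (b - t))) by (repeat apply Rmin_glb_lt; lra).
  exists (mkposreal _ Hm). intros h Hh Hhd; simpl in Hhd.
  assert (M1 := Rmin_l d (Rmin (t - a) (b - t))). assert (M2 := Rmin_r d (Rmin (t - a) (b - t))).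
  assert (M3 := Rmin_l (t - a) (b - t)). assert (M4 := Rmin_r (t - a) (b - t)).
  assert (B := Rabs_lt_between h (Rmin d (Rmin (t - a) (b - t)))). destruct B as [B _]. specialize (B Hhd).
  rewrite !clamp_id by lra.
  specialize (H1 (t + h)). cbv beta in H1. replace (t + h - t) with h in H1 by ring. apply H1.
  - apply ball_R; simpl. replace (t + h - t) with h by ring. lra.
  - split; lra.
Qed.

(** The data are controlled on [[a, b]] only. Integrating the clamped derivative gives a function
    that is [C^1] on the whole line with bounded derivative, so later integrals need no side
    conditions at the ends. *)
Lemma C1_extension a b f f' : a < b ->
  (forall t, a <= t <= b -> is_derive_within (fun s => a <= s <= b) f t (f' t)) ->
  (forall t, a <= t <= b -> continuous_within (fun s => a <= s <= b) f' t) ->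
  exists g g1 G, (forall t, is_derive g t (g1 t)) /\ (forall t, continuous g1 t) /\
    (forall t, Rabs (g1 t) <= G) /\ forall t, a <= t <= b -> g t = f t.
Proof.
  intros Hab Hd Hc.
  set (g1 := fun t => f' (clamp a b t)).
  assert (C1 : forall t, continuous g1 t) by (intros; apply clamp_continuous; [lra | exact Hc]).
  set (g := fun t => f a + RInt g1 a t).
  assert (Dg : forall t, is_derive g t (g1 t)).
  { intros t. replace (g1 t) with (0 + g1 t) by ring.
    apply (is_derive_plus (V := R_NormedModule) (fun _ => f a)); [apply (is_derive_const (V := R_NormedModule))|].
    apply (is_derive_RInt (V := R_NormedModule) g1 (fun t => RInt g1 a t) a t); [|apply C1].
    exists (mkposreal 1 Rlt_0_1); intros y _. apply (RInt_correct (V := R_CompleteNormedModule)), ex_RInt_cont, C1. }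
  destruct (continuity_ab_maj (fun t => Rabs (g1 t)) a b ltac:(lra)) as [Mx [HM _]].
  { intros t _. apply continuity_pt_filterlim. apply (continuous_comp g1 Rabs); [apply C1 | apply continuous_Rabs]. }
  exists g, g1, (Rabs (g1 Mx)). split; [exact Dg|]. split; [exact C1|]. split.
  - intros t. replace (g1 t) with (g1 (clamp a b t)).
    + apply HM, clamp_in; lra.
    + unfold g1. rewrite (clamp_id a b (clamp a b t)); [reflexivity | apply clamp_in; lra].
  (* The difference has zero derivative inside the interval, is continuous up to the ends and
     vanishes at [a]. *)
  - intros t Ht. destruct (MVT_gen (fun u => f (clamp a b u) - g u) a t (fun _ => 0)) as [xi [_ E]].
    + intros u Hu. rewrite Rmin_left, Rmax_right in Hu by lra.
      replace 0 with (f' u - g1 u) by (unfold g1; rewrite clamp_id by lra; ring).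
      apply (is_derive_minus (V := R_NormedModule) (fun u => f (clamp a b u)) g); [|apply Dg].
      apply is_derive_within_clamp; [lra | apply Hd; lra].
    + intros u _. apply continuity_pt_filterlim.
      apply (cont_sub (fun u => f (clamp a b u)) g); [| apply (cont_derive _ _ _ (Dg u))].
      apply clamp_continuous; [lra|]. intros v Hv. apply is_derive_within_continuous with (f' v), Hd, Hv.
    + rewrite !clamp_id in E by lra. unfold g in E at 2. rewrite (RInt_point (V := R_CompleteNormedModule)) in E.
      unfold zero in E; simpl in E. lra.
Qed.

(** * The Caputo integral *)

(** Since [ln] is 0 off the positive axis, [Rpower 0 (1 - q)] is 1; the case split restores the
    value 0 and hence continuity on the whole line. *)
Definition power_primitive (q s : R) : R := if Rle_dec s 0 then 0 else Rpower s (1 - q) / (1 - q).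

Lemma power_primitive_pos q s : 0 < s -> power_primitive q s = Rpower s (1 - q) / (1 - q).
Proof. intros; unfold power_primitive; destruct Rle_dec; lra. Qed.

Lemma power_primitive_derive q s : q <> 1 -> 0 < s -> is_derive (power_primitive q) s (Rpower s (- q)).
Proof.
  intros Hq Hs. apply is_derive_ext_loc with (fun s => / (1 - q) * Rpower s (1 - q)).
  - exists (mkposreal s Hs). intros y Hy. change (Rabs (y - s) < s) in Hy. apply Rabs_lt_between in Hy.
    rewrite power_primitive_pos by lra. unfold Rdiv; rring.
  - replace (Rpower s (- q)) with (/ (1 - q) * ((1 - q) * Rpower s (1 - q - 1))).
    + apply is_derive_scal, Rpower_derive, Hs.
    + replace (1 - q - 1) with (- q) by ring. field; lra.
Qed.

Lemma power_primitive_cont q s : q < 1 -> continuous (power_primitive q) s.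
Proof.
  intros Hq. destruct (Rtotal_order s 0) as [H|[->|H]].
  - apply continuous_ext_loc with (fun _ => 0); [| apply continuous_const].
    exists (mkposreal (- s) ltac:(lra)). intros y Hy. change (Rabs (y - s) < - s) in Hy. apply Rabs_lt_between in Hy.
    unfold power_primitive; destruct Rle_dec; lra.
  - intros P HP. replace (power_primitive q 0) with 0 in HP by (unfold power_primitive; destruct Rle_dec; lra).
    assert (L : filterlim (fun x => Rpower x (1 - q) * / (1 - q)) (at_right 0) (locally 0)).
    { replace 0 with (0 * / (1 - q)) at 2 by ring.
      apply (filterlim_comp _ _ _ (fun x => Rpower x (1 - q)) (fun y => y * / (1 - q)) (at_right 0) (locally 0)).
      - apply Rpower_0_lim; lra.
      - change (continuous (fun y => y * / (1 - q)) 0). cont. }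
    destruct (L P HP) as [d Hd]. exists d. intros y Hy. unfold power_primitive. destruct Rle_dec.
    + apply (locally_singleton _ _ HP).
    + apply (Hd y Hy); lra.
  - eapply cont_derive, power_primitive_derive; lra.
Qed.

(** The integrand is singular at [t], but its integral up to [u] equals [F u], which involves only
    the continuous primitive; the improper integral is thus the value [F t]. *)
Lemma caputo_by_parts q a t g g1 : 0 < q < 1 -> a < t ->
  (forall u, is_derive g u (g1 u)) -> (forall u, continuous g1 u) ->
  is_RInt_gen (fun u => Rpower (t - u) (- q) * g u) (at_point a) (at_left t)
    (power_primitive q (t - a) * g a + RInt (fun u => power_primitive q (t - u) * g1 u) a t).
Proof.
  intros Hq Hat Dg C1.
  assert (Cg : forall u, continuous g u) by (intros; eapply cont_derive, Dg).
  assert (Cp : forall u, continuous (fun u => power_primitive q (t - u)) u).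
  { intros u. apply (continuous_comp (fun u => t - u) (power_primitive q)); [cont | apply power_primitive_cont; lra]. }
  set (F := fun u => power_primitive q (t - a) * g a - power_primitive q (t - u) * g u
                     + RInt (fun u => power_primitive q (t - u) * g1 u) a u).
  assert (CI : forall u, continuous (fun u => power_primitive q (t - u) * g1 u) u)
    by (intros; apply (cont_mul (fun u => power_primitive q (t - u)) g1); auto).
  assert (DI : forall u, is_derive (fun u => RInt (fun u => power_primitive q (t - u) * g1 u) a u) u (power_primitive q (t - u) * g1 u)).
  { intros u. apply (is_derive_RInt (V := R_NormedModule) (fun u => power_primitive q (t - u) * g1 u) _ a u); [|apply CI].
    exists (mkposreal 1 Rlt_0_1); intros y _. apply (RInt_correct (V := R_CompleteNormedModule)), ex_RInt_cont, CI. }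
  assert (CF : continuous F t).
  { unfold F. apply cont_add; [| eapply cont_derive, DI]. apply cont_sub; [cont|].
    apply (cont_mul (fun u => power_primitive q (t - u)) g); auto. }
  assert (Ft : F t = power_primitive q (t - a) * g a + RInt (fun u => power_primitive q (t - u) * g1 u) a t).
  { unfold F. replace (power_primitive q (t - t)) with 0; [ring|].
    unfold power_primitive; destruct Rle_dec; lra. }
  rewrite <- Ft. intros P HP.
  apply (Filter_prod _ _ _ (fun u => u = a) (fun v => a < v < t /\ P (F v))).
  - reflexivity.
  - destruct (CF P HP) as [[d Hd] H].
    exists (mkposreal (Rmin d (t - a)) ltac:(apply Rmin_glb_lt; lra)). intros y Hy Hyt. change (Rabs (y - t) < Rmin d (t - a)) in Hy.
    assert (M1 := Rmin_l d (t - a)). assert (M2 := Rmin_r d (t - a)).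
    split; [apply Rabs_lt_between in Hy; lra|]. apply H. change (Rabs (y - t) < d). lra.
  - intros u v -> [Hv HPv]. exists (F v). split; [|exact HPv]. simpl.
    replace (F v) with (minus (F v) (F a)).
    + apply (is_RInt_derive (V := R_CompleteNormedModule) F).
      * intros x Hx. rewrite Rmin_left, Rmax_right in Hx by lra.
        assert (D1 : is_derive (fun u => power_primitive q (t - u)) x (- 1 * Rpower (t - x) (- q))).
        { apply (is_derive_comp (V := R_NormedModule) (power_primitive q) (fun u => t - u) x).
          - apply power_primitive_derive; lra.
          - auto_derive; [trivial | ring]. }
        set (pp := fun u => power_primitive q (t - u)) in *.
        set (I := fun u => RInt (fun u => power_primitive q (t - u) * g1 u) a u) in *.
        change (is_derive (fun u => power_primitive q (t - a) * g a - pp u * g u + I u) x (Rpower (t - x) (- q) * g x)).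
        assert (X1 : ex_derive pp x) by (eexists; exact D1). assert (X2 : ex_derive g x) by (eexists; apply Dg).
        assert (X3 : ex_derive I x) by (eexists; apply DI).
        assert (Y1 : Derive (fun x : R => pp x) x = - 1 * Rpower (t - x) (- q)) by (apply is_derive_unique, D1).
        assert (Y2 : Derive (fun x : R => g x) x = g1 x) by (apply is_derive_unique, Dg).
        assert (Y3 : Derive (fun x : R => I x) x = pp x * g1 x) by (apply is_derive_unique, DI).
        auto_derive; [repeat split; auto|]. rewrite Y1, Y2, Y3. ring.
      * intros x Hx. rewrite Rmin_left, Rmax_right in Hx by lra. apply cont_mul; [|apply Cg].
        apply (continuous_comp (fun u => t - u) (fun s => Rpower s (- q))); [cont | apply Rpower_cont; lra].
    + replace (F a) with 0; [unfold minus, plus, opp; simpl; ring|].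
      unfold F. rewrite (RInt_point (V := R_CompleteNormedModule)). unfold zero; simpl; ring.
Qed.

(** * Backward Euler *)

Section Euler.
Variables (a lam G : R) (g g1 : R -> R).
Hypothesis Hlam : 0 < lam.
Hypothesis Dg : forall t, is_derive g t (g1 t).
Hypothesis C1 : forall t, continuous g1 t.
Hypothesis HG : forall t, Rabs (g1 t) <= G.

Definition forced (t : R) : R := exp (- (lam * (t - a))) * RInt (fun u => exp (lam * (u - a)) * g1 u) a t.
(* The derivative of the solution of [psi' = - lam psi + g], [psi a = 0]. *)
Definition velocity (t : R) : R := exp (- (lam * (t - a))) * g a + forced t.
(** The solution is recovered from its derivative through the equation itself, so that all estimates
    can be made on [velocity]. *)
Definition relaxation (t : R) : R := (g t - velocity t) / lam.

Lemma forced_integrand_cont u : continuous (fun u => exp (lam * (u - a)) * g1 u) u.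
Proof. cont. Qed.

Lemma forced_derive t : is_derive forced t (- lam * forced t + g1 t).
Proof.
  set (I := fun t => RInt (fun u => exp (lam * (u - a)) * g1 u) a t).
  assert (DI : is_derive I t (exp (lam * (t - a)) * g1 t)).
  { apply (is_derive_RInt (V := R_NormedModule) (fun u => exp (lam * (u - a)) * g1 u) I a t); [|apply forced_integrand_cont].
    exists (mkposreal 1 Rlt_0_1); intros y _.
    apply (RInt_correct (V := R_CompleteNormedModule)), ex_RInt_cont, forced_integrand_cont. }
  change (is_derive (fun t => exp (- (lam * (t - a))) * I t) t (- lam * (exp (- (lam * (t - a))) * I t) + g1 t)).
  assert (X : ex_derive I t) by (eexists; exact DI).
  assert (Y : Derive (fun x : R => I x) t = exp (lam * (t - a)) * g1 t) by (apply is_derive_unique, DI).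
  assert (E : exp (- (lam * (t - a))) * exp (lam * (t - a)) = 1) by (rewrite <- exp_plus, Rplus_opp_l, exp_0; reflexivity).
  auto_derive; [auto|]. rewrite Y. change (t + - a) with (t - a).
  transitivity (- lam * (exp (- (lam * (t - a))) * I t) + (exp (- (lam * (t - a))) * exp (lam * (t - a))) * g1 t); [ring|].
  rewrite E; ring.
Qed.

(** The integral of [lam exp(- lam (t - u))] over [[a, t]] is at most 1, whatever the stiffness
    [lam]. *)
Lemma forced_bound t : a <= t -> lam * Rabs (forced t) <= G.
Proof.
  intros Ht. unfold forced. rewrite Rabs_mult, (Rabs_right (exp _)) by (apply Rle_ge, Rlt_le, exp_pos).
  assert (G0 : 0 <= G) by (eapply Rle_trans; [apply Rabs_pos | apply (HG t)]).
  assert (B : Rabs (RInt (fun u => exp (lam * (u - a)) * g1 u) a t) <= RInt (fun u => G * exp (lam * (u - a))) a t).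
  { eapply Rle_trans; [apply abs_RInt_le; [exact Ht | apply ex_RInt_cont, forced_integrand_cont]|].
    apply RInt_le; [exact Ht | | |].
    - apply ex_RInt_cont; intros u. apply (continuous_comp (fun u => exp (lam * (u - a)) * g1 u) Rabs);
        [apply forced_integrand_cont | apply continuous_Rabs].
    - apply ex_RInt_cont; intros; cont.
    - intros u Hu. rewrite Rabs_mult, (Rabs_right (exp _)) by (apply Rle_ge, Rlt_le, exp_pos).
      rewrite Rmult_comm. apply Rmult_le_compat_r; [left; apply exp_pos | apply HG]. }
  rewrite (RInt_FTC (fun u => G / lam * exp (lam * (u - a))) (fun u => G * exp (lam * (u - a)))) in B.
  - replace (lam * (a - a)) with 0 in B by ring. rewrite exp_0 in B.
    assert (P := exp_pos (- (lam * (t - a)))).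
    assert (E : exp (- (lam * (t - a))) * exp (lam * (t - a)) = 1) by (rewrite <- exp_plus, Rplus_opp_l, exp_0; reflexivity).
    set (e := exp (- (lam * (t - a)))) in *. set (I := Rabs (RInt _ _ _)) in *.
    apply Rle_trans with (lam * (e * (G / lam * exp (lam * (t - a)) - G / lam * 1))).
    + apply Rmult_le_compat_l; [lra|]. apply Rmult_le_compat_l; lra.
    + replace (lam * (e * (G / lam * exp (lam * (t - a)) - G / lam * 1))) with (G * (e * exp (lam * (t - a))) - G * e) by (field; lra).
      rewrite E. assert (0 <= G * e) by (apply Rmult_le_pos; lra). lra.
  - intros u. auto_derive; [trivial | change (u + - a) with (u - a); field; lra].
  - intros u; cont.
Qed.

Lemma forced_lipschitz u v : a <= u <= v -> Rabs (forced u - forced v) <= 2 * G * (v - u).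
Proof.
  intros Huv. destruct (MVT_gen forced u v (fun t => - lam * forced t + g1 t)) as [xi [Hxi E]].
  - intros t _; apply forced_derive.
  - intros t _; apply continuity_pt_filterlim. apply (cont_derive _ _ _ (forced_derive t)).
  - rewrite Rmin_left, Rmax_right in Hxi by lra.
    rewrite <- Rabs_Ropp. replace (- (forced u - forced v)) with (forced v - forced u) by ring. rewrite E.
    rewrite Rabs_mult, (Rabs_right (v - u)) by lra. apply Rmult_le_compat_r; [lra|].
    eapply Rle_trans; [apply Rabs_triang|]. rewrite Rabs_mult, Rabs_Ropp, (Rabs_right lam) by lra.
    assert (B := forced_bound xi ltac:(lra)). assert (B2 := HG xi). lra.
Qed.

(** The initial layer [exp(- lam (t - a)) g(a)] is steep for large [lam], yet monotone with total
    variation at most [|g a|]. The bound keeps the difference of exponentials so that it telescopes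
    over the time steps. *)
Lemma velocity_variation u v : a <= u <= v ->
  Rabs (velocity u - velocity v) <= Rabs (g a) * (exp (- (lam * (u - a))) - exp (- (lam * (v - a)))) + 2 * G * (v - u).
Proof.
  intros Huv. unfold velocity.
  replace (exp (- (lam * (u - a))) * g a + forced u - (exp (- (lam * (v - a))) * g a + forced v))
    with (g a * (exp (- (lam * (u - a))) - exp (- (lam * (v - a)))) + (forced u - forced v)) by ring.
  eapply Rle_trans; [apply Rabs_triang|]. apply Rplus_le_compat; [|apply forced_lipschitz, Huv].
  rewrite Rabs_mult, (Rabs_right (exp _ - exp _)); [apply Rle_refl|].
  apply Rle_ge. assert (exp (- (lam * (v - a))) <= exp (- (lam * (u - a)))); [apply exp_monotone; nra | lra].
Qed.

Lemma relaxation_derive t : is_derive relaxation t (velocity t).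
Proof.
  assert (D1 := forced_derive t).
  assert (X1 : ex_derive forced t) by (eexists; exact D1). assert (X2 : ex_derive g t) by (eexists; apply Dg).
  assert (Y1 : Derive (fun x : R => forced x) t = - lam * forced t + g1 t) by (apply is_derive_unique, D1).
  assert (Y2 : Derive (fun x : R => g x) t = g1 t) by (apply is_derive_unique, Dg).
  unfold relaxation, velocity. auto_derive; [repeat split; auto|]. rewrite Y1, Y2. change (t + - a) with (t - a). field; lra.
Qed.

Lemma relaxation_start : relaxation a = 0.
Proof.
  unfold relaxation, velocity, forced. rewrite (RInt_point (V := R_CompleteNormedModule)).
  replace (lam * (a - a)) with 0 by ring. rewrite Ropp_0, exp_0. unfold zero; simpl. field; lra.
Qed.

(** The same solution after integration by parts, as a convolution with [g1]; its kernel
    [(1 - exp(- lam s)) / lam] is the building block of [H_s]. *)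
Lemma relaxation_kernel t :
  relaxation t = (1 - exp (- (lam * (t - a)))) / lam * g a + RInt (fun u => (1 - exp (- (lam * (t - u)))) / lam * g1 u) a t.
Proof.
  assert (E : RInt (fun u => (1 - exp (- (lam * (t - u)))) / lam * g1 u) a t
    = / lam * (RInt g1 a t - exp (- (lam * (t - a))) * RInt (fun u => exp (lam * (u - a)) * g1 u) a t)).
  { rewrite <- (rint_scal (fun u => exp (lam * (u - a)) * g1 u)) by apply ex_RInt_cont, forced_integrand_cont.
    rewrite <- rint_sub.
    - rewrite <- rint_scal.
      + apply RInt_ext. intros u _.
        replace (- (lam * (t - u))) with (- (lam * (t - a)) + lam * (u - a)) by ring. rewrite exp_plus. match goal with |- @eq _ ?l ?r => change (@eq R l r) end. field; lra.
      + apply ex_RInt_cont; intros; cont.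
    - apply ex_RInt_cont, C1.
    - apply ex_RInt_cont; intros; cont. }
  rewrite E, (RInt_FTC g g1 a t Dg C1). unfold relaxation, velocity, forced. field; lra.
Qed.

Fixpoint euler (h : R) (n : nat) : R :=
  match n with O => 0 | S m => (euler h m + h * g (a + INR n * h)) / (1 + h * lam) end.

Lemma euler_error h n : 0 < h ->
  Rabs (relaxation (a + INR n * h) - euler h n)
  <= h * (Rabs (g a) * (1 - exp (- (lam * (INR n * h)))) + 2 * G * (INR n * h)).
Proof.
  intros Hh. induction n.
  - simpl INR. simpl euler. rewrite Rmult_0_l, Rplus_0_r, relaxation_start, Rmult_0_r, Ropp_0, exp_0.
    rewrite Rminus_0_r, Rabs_R0. apply Req_le; ring.
  - change (euler h (S n)) with ((euler h n + h * g (a + INR (S n) * h)) / (1 + h * lam)).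
    assert (N := pos_INR n). rewrite S_INR.
    set (t0 := a + INR n * h) in *. set (t1 := a + (INR n + 1) * h).
    assert (T0 : a <= t0) by (unfold t0; nra). assert (T1 : t1 = t0 + h) by (unfold t0, t1; ring).
    destruct (MVT_gen relaxation t0 t1 velocity) as [xi [Hxi E]].
    { intros t _; apply relaxation_derive. }
    { intros t _; apply continuity_pt_filterlim, (cont_derive _ _ _ (relaxation_derive t)). }
    rewrite Rmin_left, Rmax_right in Hxi by lra. replace (t1 - t0) with h in E by lra.
    assert (V := velocity_variation xi t1 ltac:(lra)).
    assert (EX : exp (- (lam * (xi - a))) <= exp (- (lam * (t0 - a)))) by (apply exp_monotone; nra).
    assert (D : 0 < 1 + h * lam) by nra.
    assert (R1 : relaxation t1 - (euler h n + h * g t1) / (1 + h * lam)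
      = (h * (velocity xi - velocity t1) + (relaxation t0 - euler h n)) / (1 + h * lam)).
    { assert (EV : velocity t1 = g t1 - lam * relaxation t1) by (unfold relaxation; field; lra).
      rewrite EV. apply Rmult_eq_reg_r with (1 + h * lam); [|lra].
      transitivity (relaxation t1 * (1 + h * lam) - (euler h n + h * g t1)); [field; lra|].
      transitivity ((relaxation t0 + velocity xi * h) + h * lam * relaxation t1 - (euler h n + h * g t1)); [lra|].
      field; lra. }
    rewrite R1. unfold Rdiv. rewrite Rabs_mult, (Rabs_right (/ _)) by (apply Rle_ge, Rlt_le, Rinv_0_lt_compat, D).
    apply Rle_trans with (Rabs (h * (velocity xi - velocity t1) + (relaxation t0 - euler h n))).
    { rewrite <- Rmult_1_r. apply Rmult_le_compat_l; [apply Rabs_pos|]. rewrite <- Rinv_1. apply Rinv_le_contravar; nra. }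
    eapply Rle_trans; [apply Rabs_triang|]. rewrite Rabs_mult, (Rabs_right h) by lra.
    replace (t0 - a) with (INR n * h) in EX by (unfold t0; ring).
    replace (t1 - a) with ((INR n + 1) * h) in V by (unfold t1; ring).
    assert (A0 := Rabs_pos (g a)). assert (G0 : 0 <= G) by (eapply Rle_trans; [apply Rabs_pos | apply (HG t0)]).
    assert (V2 : Rabs (velocity xi - velocity t1) <=
      Rabs (g a) * (exp (- (lam * (INR n * h))) - exp (- (lam * ((INR n + 1) * h)))) + 2 * G * h).
    { eapply Rle_trans; [exact V|]. apply Rplus_le_compat.
      - apply Rmult_le_compat_l; lra.
      - apply Rmult_le_compat_l; lra. }
    apply Rle_trans with (h * (Rabs (g a) * (exp (- (lam * (INR n * h))) - exp (- (lam * ((INR n + 1) * h)))) + 2 * G * h)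
      + h * (Rabs (g a) * (1 - exp (- (lam * (INR n * h)))) + 2 * G * (INR n * h))).
    + apply Rplus_le_compat; [apply Rmult_le_compat_l; lra | exact IHn].
    + apply Req_le; ring.
Qed.

End Euler.

(** * Reduction of the problem data to [q] and to normalised relaxation equations *)

(** As [alpha] is the sum of its floor and [q], each shift of the sine by [PI] changes its sign, and
    the power of [-1] in [cD] cancels these changes. *)
Lemma order_facts alpha : 0 < alpha -> (forall n : nat, alpha <> INR n) ->
  0 < qD alpha < 1 /\ INR (mD alpha) - alpha = 1 - qD alpha /\ cD alpha = sin (qD alpha * PI) / PI.
Proof.
  intros Ha Hn.
  assert (Hz : forall z : Z, alpha <> IZR z).
  { intros z E. destruct (Z.le_gt_cases 0 z) as [Hz|Hz].
    - apply (Hn (Z.to_nat z)). rewrite INR_IZR_INZ, Z2Nat.id by exact Hz. exact E.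
    - assert (IZR z < 0) by (apply IZR_lt; lia). lra. }
  destruct (base_Int_part alpha) as [F1 F2]. destruct (base_Int_part (- alpha)) as [G1 G2].
  assert (N1 := Hz (Int_part alpha)). assert (N2 := Hz (- Int_part (- alpha))%Z). rewrite opp_IZR in N2.
  assert (Ec : Rceil alpha = (Int_part alpha + 1)%Z).
  { unfold Rceil.
    assert (Int_part alpha < - Int_part (- alpha))%Z by (apply lt_IZR; rewrite opp_IZR; lra).
    assert (- Int_part (- alpha) < Int_part alpha + 2)%Z by (apply lt_IZR; rewrite opp_IZR, plus_IZR; lra).
    lia. }
  assert (Hf : (0 <= Int_part alpha)%Z).
  { assert (-1 < Int_part alpha)%Z by (apply lt_IZR; lra). lia. }
  assert (Eq : qD alpha = alpha - IZR (Int_part alpha)) by (unfold qD; rewrite Ec, plus_IZR; ring).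
  split; [rewrite Eq; lra|]. split.
  - unfold mD. rewrite INR_IZR_INZ, Z2Nat.id by (rewrite Ec; lia). rewrite Eq, Ec, plus_IZR. ring.
  - unfold cD, Rfloor. replace alpha with (qD alpha + IZR (Int_part alpha)) at 2 by (rewrite Eq; ring).
    rewrite <- (Z2Nat.id _ Hf). set (n := Z.to_nat (Int_part alpha)).
    rewrite <- pow_powerRZ, <- INR_IZR_INZ. f_equal.
    generalize (qD alpha); intros u. clearbody n. clear - u. induction n.
    + simpl. rewrite Rplus_0_r; ring.
    + rewrite <- IHn, S_INR. replace ((u + (INR n + 1)) * PI) with ((u + INR n) * PI + PI) by ring.
      rewrite neg_sin. simpl; ring.
Qed.

Lemma phiBE_euler alpha a h gs g n w : (forall j, (1 <= j <= n)%nat -> gs j = g (a + INR j * h)) ->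
  phiBE alpha h gs n w = cD alpha * exp (w * qD alpha) * euler a (exp w) g h n.
Proof.
  induction n; intros H; [simpl; ring|].
  change (phiBE alpha h gs (S n) w) with
    ((phiBE alpha h gs n w + h * cD alpha * exp (w * qD alpha) * gs (S n)) / (1 + h * exp w)).
  change (euler a (exp w) g h (S n)) with ((euler a (exp w) g h n + h * g (a + INR (S n) * h)) / (1 + h * exp w)).
  rewrite IHn, H by (lia || (intros; apply H; lia)). unfold Rdiv; ring.
Qed.

(** [exp(x) exp(w q)] is 1 at [w = -x/q] and [exp(x/(1-q))] at [w = x/(1-q)]: only the second half
    magnifies the time-stepping error. *)
Lemma phihat_euler alpha a h gs g n x : 0 < qD alpha < 1 ->
  (forall j, (1 <= j <= n)%nat -> gs j = g (a + INR j * h)) ->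
  phihat alpha h gs n x = cD alpha * (/ qD alpha * euler a (exp (- x / qD alpha)) g h n
    + / (1 - qD alpha) * (exp (x / (1 - qD alpha)) * euler a (exp (x / (1 - qD alpha))) g h n)).
Proof.
  intros Hq H. unfold phihat. rewrite !(phiBE_euler alpha a h gs g n) by exact H.
  set (q := qD alpha) in *.
  assert (E1 : exp x * exp (- x / q * q) = 1).
  { rewrite <- exp_plus. replace (x + - x / q * q) with 0 by (field; lra). apply exp_0. }
  assert (E2 : exp x * exp (x / (1 - q) * q) = exp (x / (1 - q))) by (rewrite <- exp_plus; f_equal; field; lra).
  set (A := euler a (exp (- x / q)) g h n). set (B := euler a (exp (x / (1 - q))) g h n).
  transitivity (cD alpha * (/ q * ((exp x * exp (- x / q * q)) * A) + / (1 - q) * ((exp x * exp (x / (1 - q) * q)) * B))); [ring|].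
  rewrite E1, E2; ring.
Qed.

(** * Comparison of the convolutions *)

Section Assembly.
Variables (q a G : R) (g g1 : R -> R).
Hypothesis Hq : 0 < q < 1.
Hypothesis Dg : forall t, is_derive g t (g1 t).
Hypothesis C1 : forall t, continuous g1 t.
Hypothesis HG : forall t, Rabs (g1 t) <= G.

(** For [k 0 = 0], this is the convolution of [k'] with [g] after integration by parts. It is linear
    in [k], so comparing operators reduces to comparing kernels in sup norm on [[0, T]]. *)
Definition convolve (k : R -> R) (t : R) : R := k (t - a) * g a + RInt (fun u => k (t - u) * g1 u) a t.

Lemma convolve_integrand_cont k t u : (forall s, continuous k s) -> continuous (fun u => k (t - u) * g1 u) u.
Proof.
  intros Hk. apply (cont_mul (fun u => k (t - u)) g1); [|apply C1].
  apply (continuous_comp (fun u => t - u) k); [cont | apply Hk].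
Qed.

Lemma convolve_sum (F : nat -> R -> R) K t : (forall k s, continuous (F k) s) ->
  (forall s, continuous (fun s => sum_n_m (fun k => F k s) 1 K) s) /\
  convolve (fun s => sum_n_m (fun k => F k s) 1 K) t = sum_n_m (fun k => convolve (F k) t) 1 K.
Proof.
  intros HF. induction K.
  - replace (fun s => sum_n_m (fun k => F k s) 1 0) with (fun _ : R => 0)
      by (apply functional_extensionality; intros; rewrite rsum_empty by lia; reflexivity).
    split.
    { intros s. apply continuous_ext with (fun _ => 0); [| cont]. intros u; rewrite rsum_empty by lia; reflexivity. }
    rewrite rsum_empty by lia. unfold convolve.
    rewrite (RInt_ext _ (fun _ => 0)) by (intros; simpl; ring).
    rewrite RInt_const. unfold scal; simpl; unfold mult; simpl; ring.
  - destruct IHK as [IC IE].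
    replace (fun s => sum_n_m (fun k => F k s) 1 (S K)) with (fun s => sum_n_m (fun k => F k s) 1 K + F (S K) s)
      by (apply functional_extensionality; intros; rewrite rsum_Sm by lia; reflexivity).
    split.
    { intros s. apply continuous_ext with (fun s => sum_n_m (fun k => F k s) 1 K + F (S K) s).
      2: apply (cont_add (fun s => sum_n_m (fun k => F k s) 1 K)); [apply IC | apply HF].
      intros u; rewrite rsum_Sm by lia; reflexivity. }
    rewrite rsum_Sm, <- IE by lia. unfold convolve.
    rewrite (RInt_ext _ (fun u => sum_n_m (fun k => F k (t - u)) 1 K * g1 u + F (S K) (t - u) * g1 u)) by (intros; simpl; ring).
    rewrite rint_add.
    + rring.
    + apply ex_RInt_cont. intros u. apply (convolve_integrand_cont (fun s => sum_n_m (fun k => F k s) 1 K)), IC.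
    + apply ex_RInt_cont. intros u. apply (convolve_integrand_cont (F (S K))), HF.
Qed.

Lemma convolve_sub_bound (k l : R -> R) T E t : a <= t <= a + T ->
  (forall s, continuous k s) -> (forall s, continuous l s) ->
  (forall s, 0 <= s <= T -> Rabs (k s - l s) <= E) ->
  Rabs (convolve k t - convolve l t) <= E * (Rabs (g a) + T * G).
Proof.
  intros Ht Hk Hl H. unfold convolve.
  assert (E0 : 0 <= E) by (eapply Rle_trans; [apply Rabs_pos | apply (H 0); lra]).
  assert (G0 : 0 <= G) by (eapply Rle_trans; [apply Rabs_pos | apply (HG a)]).
  assert (X1 : ex_RInt (fun u => k (t - u) * g1 u) a t) by (apply ex_RInt_cont; intros; apply convolve_integrand_cont, Hk).
  assert (X2 : ex_RInt (fun u => l (t - u) * g1 u) a t) by (apply ex_RInt_cont; intros; apply convolve_integrand_cont, Hl).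
  assert (S := rint_sub _ _ a t X1 X2). assert (X := ex_rint_sub _ _ a t X1 X2).
  cbv beta in S, X.
  assert (B := abs_RInt_le_const (fun u => k (t - u) * g1 u - l (t - u) * g1 u) a t (E * G) ltac:(lra) X). cbv beta in B. rewrite S in B.
  replace (k (t - a) * g a + RInt (fun u => k (t - u) * g1 u) a t - (l (t - a) * g a + RInt (fun u => l (t - u) * g1 u) a t))
    with ((k (t - a) - l (t - a)) * g a + (RInt (fun u => k (t - u) * g1 u) a t - RInt (fun u => l (t - u) * g1 u) a t)) by rring.
  eapply Rle_trans; [apply Rabs_triang|].
  apply Rle_trans with (E * Rabs (g a) + (t - a) * (E * G)).
  - apply Rplus_le_compat.
    + rewrite Rabs_mult. apply Rmult_le_compat_r; [apply Rabs_pos | apply H; lra].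
    + apply B. intros u Hu. replace (k (t - u) * g1 u - l (t - u) * g1 u) with ((k (t - u) - l (t - u)) * g1 u) by ring.
      rewrite Rabs_mult. apply Rmult_le_compat; [apply Rabs_pos | apply Rabs_pos | apply H; lra | apply HG].
  - assert ((t - a) * (E * G) <= T * (E * G)); [|lra]. apply Rmult_le_compat_r; [apply Rmult_le_pos; assumption | lra].
Qed.

(** [abel_kernel] extended by 0, hence continuous on the whole line. *)
Definition abel (s : R) : R := / Gamma (1 - q) * power_primitive q s.

Lemma abel_cont s : continuous abel s.
Proof. unfold abel. apply cont_mul; [cont | apply power_primitive_cont; lra]. Qed.

Lemma kernel_0_cont x s : continuous (fun s => kernel q s 0 x) s.
Proof.
  apply continuous_ext with (fun s => sin (q * PI) / PI * (/ q * (exp (x / q) * (1 - exp (- (s * exp (- x / q)))))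
    + / (1 - q) * (1 - exp (- (s * exp (x / (1 - q))))))).
  - intros u; symmetry; apply kernel_0, Hq.
  - cont.
Qed.

Lemma abel_integral s : 0 <= s -> abel s = LInt (kernel q s 0).
Proof.
  intros [Hs|<-].
  - rewrite kernel_integral by assumption. unfold abel, abel_kernel. rewrite power_primitive_pos by exact Hs.
    unfold Rdiv. rewrite Rinv_mult. ring.
  - rewrite (LInt_ext _ (fun _ => 0)).
    + rewrite LInt_zero. unfold abel, power_primitive. destruct Rle_dec; [ring | lra].
    + intros x _. rewrite kernel_0 by exact Hq. rewrite !Rmult_0_l, Ropp_0, exp_0. ring.
Qed.

Lemma caputo_convolve alpha y t : a < t -> INR (mD alpha) - alpha = 1 - q ->
  (forall u, a <= u <= t -> y u = g u) -> Caputo alpha a y t = convolve abel t.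
Proof.
  intros Hat Em Hy. unfold Caputo. rewrite Em. replace (1 - q - 1) with (- q) by ring.
  assert (I := caputo_by_parts q a t g g1 Hq Hat Dg C1).
  assert (J : is_RInt_gen (fun u => Rpower (t - u) (- q) * y u) (at_point a) (at_left t)
    (power_primitive q (t - a) * g a + RInt (fun u => power_primitive q (t - u) * g1 u) a t)).
  { revert I. apply (is_RInt_gen_ext (V := R_NormedModule)).
    apply (Filter_prod _ _ _ (fun u => u = a) (fun v => a < v < t)).
    - reflexivity.
    - exists (mkposreal (t - a) ltac:(lra)). intros v Hv Hvt. change (Rabs (v - t) < t - a) in Hv.
      apply Rabs_lt_between in Hv; lra.
    - intros u v -> Hv x Hx. simpl in Hx. rewrite Rmin_left, Rmax_right in Hx by lra. rewrite Hy by lra. reflexivity. }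
  rewrite (is_RInt_gen_unique (V := R_CompleteNormedModule) _ _ J). unfold convolve, abel.
  rewrite (RInt_ext (fun u => / Gamma (1 - q) * power_primitive q (t - u) * g1 u)
    (fun u => / Gamma (1 - q) * (power_primitive q (t - u) * g1 u))) by (intros; simpl; ring).
  rewrite rint_scal; [rring|].
  apply ex_RInt_cont. intros u. apply convolve_integrand_cont. intros; apply power_primitive_cont; lra.
Qed.

(** For fixed [x], the kernel is a combination of the kernels [(1 - exp(- lam s)) / lam] at the two
    rates; thus convolution returns the exact solutions that the Euler scheme approximates. *)
Lemma convolve_kernel x t :
  convolve (fun s => kernel q s 0 x) t
  = sin (q * PI) / PI * (/ q * relaxation a (exp (- x / q)) g g1 t
     + / (1 - q) * (exp (x / (1 - q)) * relaxation a (exp (x / (1 - q))) g g1 t)).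
Proof.
  set (l1 := exp (- x / q)). set (l2 := exp (x / (1 - q))). set (c := sin (q * PI) / PI).
  assert (L1 : 0 < l1) by apply exp_pos. assert (L2 : 0 < l2) by apply exp_pos.
  assert (K : forall s, kernel q s 0 x = c / q * ((1 - exp (- (l1 * s))) / l1) + c / (1 - q) * l2 * ((1 - exp (- (l2 * s))) / l2)).
  { intros s. rewrite kernel_0 by exact Hq. fold l1 l2 c.
    replace (exp (x / q)) with (/ l1).
    - rewrite (Rmult_comm l1 s), (Rmult_comm l2 s). field. lra.
    - unfold l1. rewrite <- exp_Ropp. f_equal. field; lra. }
  rewrite !relaxation_kernel by assumption. unfold convolve. rewrite K.
  rewrite (RInt_ext _ (fun u => c / q * ((1 - exp (- (l1 * (t - u)))) / l1 * g1 u)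
    + c / (1 - q) * l2 * ((1 - exp (- (l2 * (t - u)))) / l2 * g1 u))) by (intros; rewrite K; rring).
  assert (X : forall l, ex_RInt (fun u => (1 - exp (- (l * (t - u)))) / l * g1 u) a t).
  { intros l. apply ex_RInt_cont; intros u. unfold Rdiv. cont. }
  rewrite rint_add by (apply ex_rint_scal, X). rewrite !rint_scal by apply X.
  unfold Rdiv; rring.
Qed.

Lemma convolve_kernel_euler h n x : 0 < h -> 0 <= x ->
  Rabs (convolve (fun s => kernel q s 0 x) (a + INR n * h)
    - sin (q * PI) / PI * (/ q * euler a (exp (- x / q)) g h n
        + / (1 - q) * (exp (x / (1 - q)) * euler a (exp (x / (1 - q))) g h n)))
  <= Rabs (sin (q * PI) / PI) * (/ q + / (1 - q)) * (h * (Rabs (g a) + 2 * G * (INR n * h))) * exp (x / (1 - q)).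
Proof.
  intros Hh Hx. rewrite convolve_kernel.
  assert (B : forall l, 0 < l -> Rabs (relaxation a l g g1 (a + INR n * h) - euler a l g h n)
    <= h * (Rabs (g a) + 2 * G * (INR n * h))).
  { intros l Hl. eapply Rle_trans; [apply (euler_error a l G g g1 Hl Dg C1 HG h n Hh)|].
    apply Rmult_le_compat_l; [lra|]. apply Rplus_le_compat_r.
    assert (P := exp_pos (- (l * (INR n * h)))). assert (P2 := Rabs_pos (g a)). nra. }
  assert (B1 := B _ (exp_pos (- x / q))). assert (B2 := B _ (exp_pos (x / (1 - q)))).
  set (r1 := relaxation a (exp (- x / q)) g g1 (a + INR n * h)) in *.
  set (r2 := relaxation a (exp (x / (1 - q))) g g1 (a + INR n * h)) in *.
  set (e1 := euler a (exp (- x / q)) g h n) in *. set (e2 := euler a (exp (x / (1 - q))) g h n) in *.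
  set (M := h * (Rabs (g a) + 2 * G * (INR n * h))) in *. set (c := sin (q * PI) / PI).
  (* The first half carries no exponential factor; bounding 1 by this one lets a single exponential
     cover both. *)
  assert (L : 1 <= exp (x / (1 - q))).
  { apply Rle_trans with (exp 0); [rewrite exp_0; lra|]. apply exp_monotone. apply Rmult_le_pos; [lra | apply Rlt_le, Rinv_0_lt_compat; lra]. }
  set (l := exp (x / (1 - q))) in *.
  replace (c * (/ q * r1 + / (1 - q) * (l * r2)) - c * (/ q * e1 + / (1 - q) * (l * e2)))
    with (c * (/ q * (r1 - e1) + / (1 - q) * (l * (r2 - e2)))) by ring.
  rewrite Rabs_mult, !Rmult_assoc. apply Rmult_le_compat_l; [apply Rabs_pos|].
  assert (I1 : 0 < / q) by (apply Rinv_0_lt_compat; lra). assert (I2 : 0 < / (1 - q)) by (apply Rinv_0_lt_compat; lra).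
  assert (M0 : 0 <= M) by (eapply Rle_trans; [apply Rabs_pos | exact B1]).
  eapply Rle_trans; [apply Rabs_triang|]. rewrite !Rabs_mult.
  rewrite (Rabs_right (/ q)), (Rabs_right (/ (1 - q))), (Rabs_right l) by lra.
  rewrite Rmult_plus_distr_r. apply Rplus_le_compat; (apply Rmult_le_compat_l; [lra|]).
  - nra.
  - rewrite (Rmult_comm M l). apply Rmult_le_compat_l; lra.
Qed.

End Assembly.

Lemma Rpower_neg_nat_le p n x : 1 <= x -> p <= INR n -> / x ^ n <= Rpower x (- p).
Proof.
  intros Hx Hp. rewrite <- Rpower_pow, <- Rpower_Ropp by lra. apply Rle_Rpower; lra.
Qed.

Theorem theorem1 (alpha a T : R) (y : R -> R) (Y : nat -> R -> R)
  (xGL wGL : nat -> nat -> R) :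
  0 < alpha -> (forall n : nat, alpha <> INR n) -> 0 < T ->
  Ck_derivs a (a + T) (S (mD alpha)) y Y ->
  (forall K : nat, (1 <= K)%nat -> is_gauss_laguerre K (xGL K) (wGL K)) ->
  forall p : R, 0 < p ->
  exists C1 C2 : R, forall K N : nat, (1 <= K)%nat -> (1 <= N)%nat ->
    let h := T / INR N in
    let g := fun n : nat => Y (mD alpha) (a + INR n * h) in
    forall n : nat, (1 <= n <= N)%nat ->
      Rabs (Caputo alpha a (Y (mD alpha)) (a + INR n * h)
            - sum_n_m (fun k => wGL K k * phihat alpha h g n (xGL K k)) 1 K)
      <= C1 * Rpower (INR K) (- p)
         + C2 * (h * exp ((1 + qD alpha) / (1 - qD alpha) * (4 * INR K + 2))).
Proof.
  intros Ha Hn HT [_ [HD HC]] HGL p Hp.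
  destruct (order_facts alpha Ha Hn) as [Hq [Em Ec]].
  destruct (C1_extension a (a + T) (Y (mD alpha)) (Y (S (mD alpha)))) as [g [g1 [G [Dg [Cg1 [HG Hg]]]]]].
  { lra. }
  { intros t Ht; apply HD; [lia | exact Ht]. }
  { exact HC. }
  set (q := qD alpha) in *. set (c := sin (q * PI) / PI) in *.
  destruct (INR_archimed 1 p) as [r Hr]; [lra|]. rewrite Rmult_1_r in Hr.
  (* Order [3 + r] pays for the factor [K^3] and leaves [K^-r] with [r > p]. *)
  destruct (gauss_laguerre_error xGL wGL HGL (kernel_bound q T) (3 + r)) as [CG [CG0 HCG]].
  assert (G0 : 0 <= G) by (eapply Rle_trans; [apply Rabs_pos | apply (HG a)]).
  (* The constant of [convolve_kernel_euler], with [n h] replaced by its bound [T]. It is fixed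
     before [K] and [N], so every joint limit is covered. *)
  set (L := Rabs c * (/ q + / (1 - q)) * (Rabs (g a) + 2 * G * T)).
  exists (CG * (Rabs (g a) + T * G)), L.
  intros K N HK HN h gs n Hnn.
  assert (HR := HGL K HK).
  assert (N1 : 1 <= INR N) by (apply (le_INR 1), HN). assert (K1 : 1 <= INR K) by (apply (le_INR 1), HK).
  assert (n1 : 1 <= INR n) by (apply (le_INR 1); lia). assert (nN : INR n <= INR N) by (apply le_INR; lia).
  assert (Hh : 0 < h) by (apply Rdiv_lt_0_compat; lra).
  assert (HhN : INR N * h = T) by (unfold h; field; lra).
  assert (Tn : forall j, (j <= n)%nat -> 0 <= INR j * h <= T).
  { intros j Hj. assert (0 <= INR j) by apply pos_INR. assert (INR j <= INR N) by (apply le_INR; lia).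
    split; [apply Rmult_le_pos; lra|]. rewrite <- HhN. apply Rmult_le_compat_r; lra. }
  set (t := a + INR n * h). assert (Ht : a < t <= a + T) by (unfold t; specialize (Tn n ltac:(lia)); nra).
  set (kern := fun k s => wGL K k * kernel q s 0 (xGL K k)).
  assert (Ckern : forall k s, continuous (kern k) s).
  { intros k s. unfold kern. apply cont_mul; [cont | apply kernel_0_cont, Hq]. }
  destruct (convolve_sum a g g1 Cg1 kern K t Ckern) as [Csum Esum].
  rewrite (caputo_convolve q a g g1 Hq Dg Cg1 alpha) by
    (exact Em || lra || (intros u Hu; symmetry; apply Hg; lra)).
  (* [Q] is the quadrature sum with the exact solutions of the relaxation equations; inserting it
     separates the quadrature error from the time-stepping error. *)
  set (Q := convolve a g g1 (fun s => sum_n_m (fun k => kern k s) 1 K) t) in *.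
  replace (convolve a g g1 (abel q) t - sum_n_m (fun k => wGL K k * phihat alpha h gs n (xGL K k)) 1 K)
    with ((convolve a g g1 (abel q) t - Q) + (Q - sum_n_m (fun k => wGL K k * phihat alpha h gs n (xGL K k)) 1 K)) by rring.
  eapply Rle_trans; [apply Rabs_triang|]. apply Rplus_le_compat.
  - eapply Rle_trans.
    + apply (convolve_sub_bound a G g g1 Cg1 HG (abel q) _ T (CG * / INR K ^ r) t); [lra | intros; apply abel_cont, Hq | exact Csum |].
      intros s Hs. rewrite abel_integral by (exact Hq || lra). unfold kern.
      eapply Rle_trans; [apply (HCG K (kernel q s) HK)|].
      * apply kernel_smooth.
      * intros j X. apply kernel_le; [exact Hq | exact Hs].
      * apply Req_le. rewrite pow_add. assert (X := pow_nonzero (INR K) r ltac:(lra)). assert (INR K <> 0) by lra. field. tauto.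
    + assert (B := Rpower_neg_nat_le p r (INR K) K1 ltac:(lra)).
      assert (0 <= Rabs (g a) + T * G) by (assert (X := Rabs_pos (g a)); nra).
      apply Rle_trans with (CG * (Rabs (g a) + T * G) * / INR K ^ r); [apply Req_le; ring|].
      apply Rmult_le_compat_l; [apply Rmult_le_pos; assumption | exact B].
  - rewrite Esum, <- rsum_sub. eapply Rle_trans; [apply rsum_abs|].
    assert (HL : 0 <= L).
    { unfold L. assert (0 < / q) by (apply Rinv_0_lt_compat; lra). assert (0 < / (1 - q)) by (apply Rinv_0_lt_compat; lra).
      assert (X := Rabs_pos (g a)). apply Rmult_le_pos; [apply Rmult_le_pos; [apply Rabs_pos | lra] | nra]. }
    (* All nodes share one bound, and the positive weights sum to 1, so the number of nodes adds no
       factor. *)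
    apply Rle_trans with (sum_n_m (fun k => L * (h * exp ((1 + q) / (1 - q) * (4 * INR K + 2))) * wGL K k) 1 K).
    2:{ rewrite rsum_scal. rewrite (weight_sum K (xGL K) (wGL K) HK HR). apply Req_le; rring. }
    apply rsum_le. intros k Hk.
    assert (W := weight_pos K _ _ HK HR k Hk). assert (X0 := node_nonneg K _ _ HK HR k Hk).
    assert (XB := node_bound xGL wGL HGL K k Hk).
    assert (Ek : convolve a g g1 (kern k) t = wGL K k * convolve a g g1 (fun s => kernel q s 0 (xGL K k)) t).
    { unfold convolve, kern.
      rewrite (RInt_ext _ (fun u => wGL K k * (kernel q (t - u) 0 (xGL K k) * g1 u))) by (intros; simpl; ring).
      rewrite rint_scal; [rring|]. apply ex_RInt_cont; intros u.
      apply (convolve_integrand_cont g1 Cg1 (fun s => kernel q s 0 (xGL K k))). intros; apply kernel_0_cont, Hq. }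
    rewrite Ek, <- Rmult_minus_distr_l, Rabs_mult, (Rabs_right (wGL K k)) by lra.
    rewrite (Rmult_comm _ (wGL K k)). apply Rmult_le_compat_l; [lra|].
    rewrite (phihat_euler alpha a h gs g n) by
      (exact Hq || (intros j Hj; unfold gs; symmetry; apply Hg; specialize (Tn j ltac:(lia)); lra)).
    fold q. rewrite Ec. fold c.
    eapply Rle_trans; [apply (convolve_kernel_euler q a G g g1 Hq Dg Cg1 HG h n (xGL K k) Hh X0)|]. fold c.
    replace (L * (h * exp ((1 + q) / (1 - q) * (4 * INR K + 2))))
      with (Rabs c * (/ q + / (1 - q)) * (h * (Rabs (g a) + 2 * G * T)) * exp ((1 + q) / (1 - q) * (4 * INR K + 2)))
      by (unfold L; ring).
    assert (I1 : 0 < / q) by (apply Rinv_0_lt_compat; lra). assert (I2 : 0 < / (1 - q)) by (apply Rinv_0_lt_compat; lra).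
    assert (A0 := Rabs_pos (g a)). assert (T1 := Tn n ltac:(lia)).
    assert (P1 : 0 <= 2 * G * (INR n * h) <= 2 * G * T) by (split; [apply Rmult_le_pos; lra | apply Rmult_le_compat_l; lra]).
    apply Rmult_le_compat.
    + apply Rmult_le_pos; [apply Rmult_le_pos; [apply Rabs_pos | lra] | apply Rmult_le_pos; lra].
    + left; apply exp_pos.
    + apply Rmult_le_compat_l; [apply Rmult_le_pos; [apply Rabs_pos | lra] | apply Rmult_le_compat_l; lra].
    (* There is room here: [x_k <= 4K - 2 <= (1 + q) (4K + 2)]. *)
    + apply exp_monotone. unfold Rdiv. rewrite (Rmult_comm (1 + q)), Rmult_assoc, (Rmult_comm (xGL K k)).
      apply Rmult_le_compat_l; [lra|]. nra.
Qed.
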